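(* Let $\mathbf{A}\in\mathbb{Q}^{m\times n}$ and assume that $r<s<l<\min\{m,n\}$. Let $\boldsymbol{\Omega}\in\mathbb{Q}^{n\times s}$ and $\boldsymbol{\Psi}\in\mathbb{Q}^{l\times m}$ be independently drawn quaternion sub-Gaussian matrices, and assume that every entry of the real matrices $\boldsymbol{\Omega}_r$ and $\boldsymbol{\Psi}_r$ has the same sub-Gaussian norm $K$. Put $\mathbf{Y}=\mathbf{A}\boldsymbol{\Omega}$, $\mathbf{W}=\boldsymbol{\Psi}\mathbf{A}$; let $\mathbf{H}\in\mathbb{Q}^{m\times s}$ be produced from $\mathbf{Y}$ by a rangefinder map (so $\mathbf{H}$ is determined by $\mathbf{Y}$) such that $\mathcal{R}(\mathbf{H})=\mathcal{R}(\mathbf{Y})$ and $\mathbf{H}$ has full column rank, and let $\mathbf{X}=(\boldsymbol{\Psi}\mathbf{H})^\dagger\mathbf{W}$. Then, for $t>0$, $$\|\mathbf{H}\mathbf{X}-\mathbf{A}\|_F\le\left(1+\frac{K\sqrt{l}\sqrt{2\left(\log(\min\{m-s,n\})+\log(4l)+1\right)/c_1}}{\sqrt{l}-C_K\sqrt{s}-t}\right)\left(1+\frac{K\sqrt{s}\sqrt{2\left(\log(\min\{m,n\}-r)+\log(4s)+1\right)/c_1}}{\sqrt{s}-C_K\sqrt{r}-t}\right)\|\Sigma_2\|_F$$ with probability at least $$1-2\exp\left(-\frac{2c_2t^2}{K^4}\right)-\frac{1}{\min\{m-s,n\}}-\frac{1}{\min\{m,n\}-r},$$ where $c_1>0$,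 $c_2>0$ are absolute constants and $C_K>0$ depends only on $K$.
   Context: $\mathbb{Q}$ denotes the real quaternions; for a quaternion matrix, $\mathcal{R}(\cdot)$ is the right linear span of the columns, $\|\cdot\|_F$ is the Frobenius norm, $^\dagger$ is the Moore-Penrose inverse. A real random variable $\xi$ is sub-Gaussian if $\mathbb{P}\{|\xi|>t\}\le\exp(1-ct^2)$ for all $t>0$ and some constant $c>0$; its sub-Gaussian norm is $\|\xi\|_{\psi_2}=\sup_{p\ge1}p^{-1/2}(\mathbb{E}|\xi|^p)^{1/p}$. For a quaternion matrix $\mathbf{G}=G_w+G_x\mathbf{i}+G_y\mathbf{j}+G_z\mathbf{k}$, set $\mathbf{G}_r=[G_w^T,G_x^T,G_y^T,G_z^T]^T$ (a real matrix). $\mathbf{G}$ is a quaternion sub-Gaussian matrix if all entries of $\mathbf{G}_r$ are independent sub-Gaussian random variables. $\Sigma_2$ is the diagonal block of the quaternion SVD of $\mathbf{A}$ containing all singular values except the $r$ largest, i.e. $\|\Sigma_2\|_F=\left(\sum_{j>r}\sigma_j(\mathbf{A})^2\right)^{1/2}$.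
   Formalization: The entries of Ω_r and Ψ_r are additionally assumed to have mean 0 and variance 1, and both denominators √l − C_K√s − t and √s − C_K√r − t are assumed positive; without these the claim is false (e.g. constant entries K in Ψ_r). *)

(* Defs.v *)
From HB Require Import structures.
From mathcomp Require Import all_boot all_order all_algebra.
From mathcomp Require Import ring.
From mathcomp Require Import all_classical all_reals all_analysis.

Set Implicit Arguments.
Unset Strict Implicit.
Unset Printing Implicit Defensive.

Import Order.TTheory GRing.Theory Num.Theory.

Local Open Scope classical_set_scope.
Local Open Scope ring_scope.

(** * Quaternions *)

Record quat (R : Type) : Type := Quat { qw : R; qx : R; qy : R; qz : R }.

Section QuatChoice.
Variable R : Type.
Definition quat_to_tuple (p : quat R) : R * R * R * R :=
  (qw p, qx p, qy p, qz p).
Definition quat_of_tuple (u : R * R * R * R) : quat R :=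
  Quat u.1.1.1 u.1.1.2 u.1.2 u.2.
Lemma quat_to_tupleK : cancel quat_to_tuple quat_of_tuple.
Proof. by case. Qed.
End QuatChoice.

HB.instance Definition _ (R : eqType) :=
  Equality.copy (quat R) (can_type (@quat_to_tupleK R)).
HB.instance Definition _ (R : choiceType) :=
  Choice.copy (quat R) (can_type (@quat_to_tupleK R)).

Section QuatRing.
Variable R : comNzRingType.
Implicit Types p q : quat R.

Definition addq p q : quat R :=
  Quat (qw p + qw q) (qx p + qx q) (qy p + qy q) (qz p + qz q).
Definition oppq p : quat R := Quat (- qw p) (- qx p) (- qy p) (- qz p).
Definition zeroq : quat R := Quat 0 0 0 0.
Definition oneq : quat R := Quat 1 0 0 0.
Definition mulq p q : quat R :=
  Quat (qw p * qw q - qx p * qx q - qy p * qy q - qz p * qz q)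
       (qw p * qx q + qx p * qw q + qy p * qz q - qz p * qy q)
       (qw p * qy q - qx p * qz q + qy p * qw q + qz p * qx q)
       (qw p * qz q + qx p * qy q - qy p * qx q + qz p * qw q).

Fact addqA : associative addq.
Proof. by move=> [? ? ? ?] [? ? ? ?] [? ? ? ?]; rewrite /addq /= !addrA. Qed.
Fact addqC : commutative addq.
Proof. by move=> p q; congr Quat; rewrite addrC. Qed.
Fact add0q : left_id zeroq addq.
Proof. by move=> [? ? ? ?]; rewrite /addq /= !add0r. Qed.
Fact addNq : left_inverse zeroq oppq addq.
Proof. by move=> [? ? ? ?]; rewrite /addq /= !addNr. Qed.

HB.instance Definition _ :=
  GRing.isZmodule.Build (quat R) addqA addqC add0q addNq.

Fact mulqA : associative mulq.
Proof.
by move=> [? ? ? ?] [? ? ? ?] [? ? ? ?]; rewrite /mulq /=; congr Quat; ring.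
Qed.
Fact mul1q : left_id oneq mulq.
Proof. by move=> [? ? ? ?]; rewrite /mulq /=; congr Quat; ring. Qed.
Fact mulq1 : right_id oneq mulq.
Proof. by move=> [? ? ? ?]; rewrite /mulq /=; congr Quat; ring. Qed.
Fact mulqDl : left_distributive mulq addq.
Proof.
by move=> [? ? ? ?] [? ? ? ?] [? ? ? ?]; rewrite /mulq /addq /=; congr Quat; ring.
Qed.
Fact mulqDr : right_distributive mulq addq.
Proof.
by move=> [? ? ? ?] [? ? ? ?] [? ? ? ?]; rewrite /mulq /addq /=; congr Quat; ring.
Qed.
Fact oneq_neq0 : oneq != zeroq.
Proof. by apply/eqP => -[] /eqP; rewrite oner_eq0. Qed.

HB.instance Definition _ :=
  GRing.Zmodule_isNzRing.Build (quat R) mulqA mul1q mulq1 mulqDl mulqDr oneq_neq0.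

Definition conjq p : quat R := Quat (qw p) (- qx p) (- qy p) (- qz p).
Definition realq (x : R) : quat R := Quat x 0 0 0.
Definition normsq p : R := qw p ^+ 2 + qx p ^+ 2 + qy p ^+ 2 + qz p ^+ 2.

End QuatRing.

(** * Quaternion matrices *)

Section QuatMatrix.
Variable R : realType.

Definition qadj m n (M : 'M[quat R]_(m, n)) : 'M[quat R]_(n, m) :=
  map_mx (@conjq R) M^T.

Definition qfrob m n (M : 'M[quat R]_(m, n)) : R :=
  Num.sqrt (\sum_i \sum_j normsq (M i j)).

(* [M *m x] has entries \sum_j M i j * x j: the columns of M are combined with
   scalars acting on the right. *)
Definition qrange m n (M : 'M[quat R]_(m, n)) : set 'cV[quat R]_m :=
  [set M *m x | x in [set: 'cV[quat R]_n]].

Definition qfull_col_rank m n (M : 'M[quat R]_(m, n)) : Prop :=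
  forall x : 'cV[quat R]_n, M *m x = 0 -> x = 0.

Definition is_qpinv m n (M : 'M[quat R]_(m, n)) (N : 'M[quat R]_(n, m)) : Prop :=
  [/\ M *m N *m M = M, N *m M *m N = N,
      qadj (M *m N) = M *m N & qadj (N *m M) = N *m M].

(* The Penrose equations always have exactly one solution, so the default
   value 0 of xget is irrelevant. *)
Definition qpinv m n (M : 'M[quat R]_(m, n)) : 'M[quat R]_(n, m) :=
  xget 0 [set N | is_qpinv M N].

Definition qunitary n (U : 'M[quat R]_n) : Prop :=
  qadj U *m U = 1%:M /\ U *m qadj U = 1%:M.

(* Singular values are indexed from 0: [sigma j] is the (j+1)-st largest one;
   only the indices j < min(m, n) are meaningful. *)
Definition is_qsvd m n (A : 'M[quat R]_(m, n))
    (U : 'M[quat R]_m) (sigma : nat -> R) (V : 'M[quat R]_n) : Prop :=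
  [/\ qunitary U, qunitary V,
      (forall i j : nat, (i <= j < minn m n)%N -> 0 <= sigma j <= sigma i) &
      A = U *m (\matrix_(i < m, j < n)
                  (if i == j :> nat then realq (sigma i) else 0)) *m qadj V].

Definition frob_Sigma2 m n (r : nat) (sigma : nat -> R) : R :=
  Num.sqrt (\sum_(r <= j < minn m n) sigma j ^+ 2).

Definition qreal m n (G : 'M[quat R]_(m, n)) : 'M[R]_(m + (m + (m + m)), n) :=
  col_mx (map_mx (@qw R) G)
    (col_mx (map_mx (@qx R) G)
      (col_mx (map_mx (@qy R) G) (map_mx (@qz R) G))).

End QuatMatrix.

(** * Sub-Gaussian random variables and matrices *)

Section SubGaussian.
Context (d : measure_display) (T : measurableType d) (R : realType).
Variable P : probability T R.

Definition subgaussian (xi : T -> R) : Prop :=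
  measurable_fun setT xi /\
  exists2 c : R, 0 < c &
    forall t : R, 0 < t ->
      (P [set w | (t < `|xi w|)%R] <= (expR (1 - c * t ^+ 2))%:E)%E.

Definition psi2_norm (xi : T -> R) : \bar R :=
  ereal_sup [set ((p `^ (- 2^-1))%:E * 'N[P]_p%:E[EFin \o xi])%E
            | p in [set p : R | 1 <= p]].

Definition independent_rvs (I : finType) (X : I -> T -> R) : Prop :=
  forall (J : {set I}) (B : I -> set R), (forall i, measurable (B i)) ->
    P (\bigcap_(i in [set` J]) (X i @^-1` B i)) =
    (\prod_(i in J) P (X i @^-1` B i))%E.

Definition generated_sigma (I : Type) (X : I -> T -> R) : set (set T) :=
  <<s [set E | exists i (B : set R), measurable B /\ E = X i @^-1` B] >>.

Definition independent_families (I J : Type)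
    (X : I -> T -> R) (Y : J -> T -> R) : Prop :=
  forall E F : set T, generated_sigma X E -> generated_sigma Y F ->
    P (E `&` F) = (P E * P F)%E.

Definition qentries m n (G : T -> 'M[quat R]_(m, n))
    (ij : 'I_(m + (m + (m + m))) * 'I_n) (w : T) : R :=
  qreal (G w) ij.1 ij.2.

Definition qsubgaussian m n (G : T -> 'M[quat R]_(m, n)) : Prop :=
  (forall ij, subgaussian (qentries G ij)) /\ independent_rvs (qentries G).

Definition qstandardized m n (G : T -> 'M[quat R]_(m, n)) : Prop :=
  forall ij, ('E_P[qentries G ij] = 0 /\ 'V_P[qentries G ij] = 1)%E.

(* "S has probability at least p" for a set S that need not be measurable
   (below, S involves an arbitrary, possibly non-measurable, rangefinder);
   for measurable S this is p <= P S. *)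
Definition prob_ge (S : set T) (p : R) : Prop :=
  exists E : set T, [/\ measurable E, E `<=` S & (p%:E <= P E)%E].

End SubGaussian.

(* Main.v *)
Require Import Defs.
From mathcomp Require Import all_boot all_order all_algebra.
From mathcomp Require Import all_classical all_reals all_analysis.
From mathcomp Require Import measurable_realfun ring lra zify.

(* Let W collect the r leading right singular vectors of A, so that
   A (1 - W W^* ) has Frobenius norm |Sigma_2|, and let G be a right inverse
   of W^* Omega.  The matrix E = A - A Omega G W^* satisfies A - E = H C for
   some C, hence H X - A = H (Psi H)^+ Psi E - E.  Thus |H X - A| <= (1 + b) |E|
   and |E| <= (1 + a) |Sigma_2| as soon as |Omega^* x|^2 >= s |x|^2 on the range
   of W, |Psi y|^2 >= l |y|^2 on the range of A Omega, and Omega^*, Psi enlarge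
   the matrices (1 - W W^* ) A^* and E by at most a sqrt s and b sqrt l.

   Upper bounds for a fixed matrix are Chernoff bounds.  The mean of |Psi y|^2 is
   4 l |y|^2, and positivity of the denominators forces l >= C_K s and
   s >= C_K r; so, instead of the sharp estimate of the least singular value, a
   union bound over integer points suffices, every real vector being rounded to
   an integer one at a controlled cost for the quadratic form.  Conditioning on
   Omega (Fubini) handles the dependence of E and A Omega. *)

Set Implicit Arguments.
Unset Strict Implicit.
Unset Printing Implicit Defensive.

Import Order.TTheory GRing.Theory Num.Theory numFieldNormedType.Exports.

Local Open Scope classical_set_scope.
Local Open Scope ring_scope.

(** * Independence *)

(** The rangefinder may be non-measurable, so every bad event is phrased through [Omega] and [Psi];
    [H] enters only through its range, which is that of [A *m Omega].

    Rounding suits the form x -> |Phi x|^2 - c |Y x|^2: its cost is a quarter of the trace, hence at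
    most a Frobenius norm |Phi Q|^2, which the Chernoff bound for a fixed matrix controls, so that
    no operator norm of Phi has to be estimated. Of the mean 4 l |y|^2, half is given up to the
    lower tail at integer points, a quarter to the rounding, and l |y|^2 remains. The same rounding
    turns the existence of a bad real vector into a countable union, hence a measurable event.

    Unit variance forces 2 K^2 >= 1, which bounds the rate [kap / K ^+ 2] by 1. The two range
    events, one for Omega and one for Psi, must share the single term 2 q of the claim, q being its
    exponential; the rate is chosen so that each costs 2 q^2. *)

Section independent_elements.
Local Open Scope ereal_scope.
Context d d1 d2 (T : measurableType d) (T1 : measurableType d1)
  (T2 : measurableType d2) (R : realType) (P : probability T R).
Variables (X : {mfun T >-> T1}) (Y : {mfun T >-> T2}).
Hypothesis indXY : forall A B, measurable A -> measurable B ->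
  P (X @^-1` A `&` Y @^-1` B) = P (X @^-1` A) * P (Y @^-1` B).

Let XY (w : T) := (X w, Y w).

Let mXY : measurable_fun setT XY.
Proof. exact: measurable_fun_pair. Qed.

Lemma joint_lawE (A : set (T1 * T2)) : measurable A ->
  P (XY @^-1` A) = (distribution P X \x distribution P Y) A.
Proof.
move=> mA; pose mXY' := mfun_Sub (mem_set mXY).
by rewrite (@product_measure_unique _ _ _ _ _ _ _ (distribution P mXY')).
Qed.

Lemma ind_ge0_integral (f : T1 * T2 -> \bar R) : measurable_fun [set: T1 * T2] f ->
  (forall z, 0 <= f z) ->
  \int[P]_w f (X w, Y w) = \int[P]_w \int[P]_v f (X w, Y v).
Proof.
move=> mf f0; pose mXY' := mfun_Sub (mem_set mXY).
transitivity (\int[distribution P mXY']_z f z).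
  by rewrite ge0_integral_distribution.
transitivity (\int[(distribution P X \x distribution P Y)]_z f z).
  apply: eq_measure_integral => //= A mA _.
  by rewrite -joint_lawE.
rewrite fubini_tonelli1 // ge0_integral_distribution //=; first last.
- by move=> x; apply: integral_ge0.
- exact: measurable_fun_fubini_tonelli_F.
apply: eq_integral => w _; rewrite /= /fubini_F.
rewrite ge0_integral_distribution //.
exact: measurableT_comp.
Qed.

(** Conditioning on [X]: a bound valid for each frozen value of [X] survives averaging over its law.
    This is what allows [Psi] to act on matrices built from [Omega]. *)
Lemma ind_section_le (A : set (T1 * T2)) (e : \bar R) : measurable A ->
  (forall w, P [set v | A (X w, Y v)] <= e) ->
  P [set w | A (X w, Y w)] <= e.
Proof.
move=> mA le_e; rewrite (joint_lawE mA) /= /product_measure1 /=.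
rewrite ge0_integral_distribution //; last exact: measurable_fun_xsection.
have -> : e = \int[P]_w cst e w.
  rewrite integral_cst //.
  by rewrite [X in _ * X]probability_setT mule1.
apply: ge0_le_integral => //.
- apply: measurableT_comp => //; exact: measurable_fun_xsection.
- move=> w _ /=; rewrite /distribution /pushforward.
  suff -> : Y @^-1` xsection A (X w) = [set v | A (X w, Y v)] by exact: le_e.
  by apply/seteqP; split => v /=; rewrite xsectionE.
Qed.

Lemma ind_prod_integral (f : T1 -> \bar R) (g : T2 -> \bar R) :
  measurable_fun setT f -> measurable_fun setT g ->
  (forall z, 0 <= f z) -> (forall z, 0 <= g z) ->
  \int[P]_w (f (X w) * g (Y w)) = \int[P]_w f (X w) * \int[P]_w g (Y w).
Proof.
move=> mf mg f0 g0.
rewrite (@ind_ge0_integral (fun z => f z.1 * g z.2)) /=; first last.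
- by move=> z; rewrite mule_ge0.
- by apply: emeasurable_funM; apply: measurableT_comp.
under eq_integral => w _.
  rewrite ge0_integralZl //; [|by apply: measurableT_comp].
  over.
rewrite ge0_integralZr //; first by apply: measurableT_comp.
by apply: integral_ge0.
Qed.

End independent_elements.

(** * Independence of generated sigma-algebras *)

Section generated_independence.
Local Open Scope ereal_scope.
Context d (T : measurableType d) (R : realType) (P : probability T R).

(** Both sides are finite measures in [E]: [P] restricted to [F], and [P] scaled by [P F]. They
    agree on the pi-system [G], hence on the sigma-algebra it generates. *)
Lemma ind_gen1 (G : set (set T)) (F : set T) : G `<=` measurable ->
  setI_closed G -> G setT -> measurable F ->
  (forall E, G E -> P (E `&` F) = P E * P F) ->
  forall E, <<s G >> E -> P (E `&` F) = P E * P F.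
Proof.
move=> mG IG GT mF GF E sE.
have PF0 : (0 <= fine (P F))%R by apply: fine_ge0.
pose m1 := mrestr P mF; pose m2 := mscale (NngNum PF0) P.
have m2E (A : set T) : m2 A = P A * P F.
  by rewrite /m2 /mscale /= fineK ?fin_num_measure // muleC.
rewrite -m2E -[LHS]/(m1 E).
apply: (g_sigma_algebra_measure_unique G mG (fun=> setT)) => //.
- by rewrite bigcup_const.
- by move=> A GA; rewrite -[RHS]/(m2 A) m2E /= /mrestr GF.
- move=> _; rewrite /= /mrestr setTI; apply: le_lt_trans (ltry 1).
  exact: probability_le1.
Qed.

Lemma ind_gen (G1 G2 : set (set T)) :
  G1 `<=` measurable -> setI_closed G1 -> G1 setT ->
  G2 `<=` measurable -> setI_closed G2 -> G2 setT ->
  (forall E F, G1 E -> G2 F -> P (E `&` F) = P E * P F) ->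
  forall E F, <<s G1 >> E -> <<s G2 >> F -> P (E `&` F) = P E * P F.
Proof.
move=> m1 I1 T1 m2 I2 T2 ind E F sE sF.
have mE := smallest_sub (@sigma_algebra_measurable _ T) m1 sE.
rewrite setIC muleC; apply: (ind_gen1 m2) => // F' GF'.
rewrite setIC muleC; apply: (ind_gen1 m1) => //.
  exact: m2.
by move=> E' GE'; exact: ind.
Qed.

End generated_independence.

(** * Functions of disjoint groups of independent variables *)

Section independent_groups.
Local Open Scope ereal_scope.
Context d (T : measurableType d) (R : realType) (P : probability T R).
Variables (I : finType) (X : I -> T -> R).
Hypothesis mX : forall i, measurable_fun setT (X i).
Hypothesis indX : independent_rvs P X.

Definition cylinders (A : {set I}) : set (set T) :=
  [set E | exists2 B : I -> set R, (forall i, measurable (B i)) &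
    E = \bigcap_(i in [set` A]) (X i @^-1` B i)].

Lemma cylinders_measurable A : cylinders A `<=` measurable.
Proof.
move=> _ [B mB ->]; apply: fin_bigcap_measurable => //.
by move=> i _; rewrite -[X in measurable X]setTI; exact: mX.
Qed.

Lemma cylindersT A : cylinders A setT.
Proof.
by exists (fun=> setT) => //; apply/seteqP; split.
Qed.

Lemma cylindersI A : setI_closed (cylinders A).
Proof.
move=> _ _ [B mB ->] [C mC ->]; exists (fun i => B i `&` C i).
  by move=> i; exact: measurableI.
by rewrite -bigcapI; apply: eq_bigcapr => i _; rewrite preimage_setI.
Qed.

Lemma cylindersS (A A' : {set I}) : A \subset A' -> cylinders A `<=` cylinders A'.
Proof.
move=> /fintype.subsetP AA' _ [B mB ->].
exists (fun i => if i \in A then B i else setT) => [i|]; first by case: ifP.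
apply/seteqP; split => w /= Bw i /=; first by move=> _; case: ifPn => // /Bw.
by move=> iA; have := Bw i (AA' i iA); rewrite /= iA.
Qed.

(** The sample space carrying only the information of the coordinates in [A]: measurability on this
    copy expresses that a function depends on these coordinates alone. *)
Definition sigma_of (A : {set I}) := g_sigma_algebraType (cylinders A).

Lemma cylinders_ind (A B : {set I}) : (forall i, i \in A -> i \notin B) ->
  forall E F, cylinders A E -> cylinders B F -> P (E `&` F) = P E * P F.
Proof.
move=> dAB _ _ [C mC ->] [D mD ->].
(* Glued along the disjoint index sets, the two boxes form one box over [A :|: B], to which [indX]
   applies once more. *)
rewrite !indX //; pose CD i := if i \in A then C i else D i.
have mCD i : measurable (CD i) by rewrite /CD; case: ifP.
have := indX (A :|: B)%SET mCD.
have -> : \bigcap_(i in [set` (A :|: B)%SET]) (X i @^-1` CD i) =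
    \bigcap_(i in [set` A]) (X i @^-1` C i) `&`
    \bigcap_(i in [set` B]) (X i @^-1` D i).
  apply/seteqP; split => w /=.
    move=> CDw; split => i /= iA.
      by have := CDw i; rewrite /= /CD finset.in_setU iA => /(_ isT).
    have := CDw i; rewrite /= /CD finset.in_setU iA orbT => /(_ isT).
    by case: ifPn => // /dAB; rewrite iA.
  move=> [Cw Dw] i /=; rewrite finset.in_setU /CD.
  by case: ifPn => [iA _|iA /= iB]; [exact: Cw|exact: Dw].
move=> ->; rewrite (bigID (fun i => i \in A)) /=; congr (_ * _).
  apply: eq_big => [i|i /andP[_ iA]]; last by rewrite /CD iA.
  by rewrite finset.in_setU; case: (i \in A) => //=; rewrite andbF.
apply: eq_big => [i|i /andP[_ /negbTE iA]]; last by rewrite /CD iA.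
rewrite finset.in_setU; have := dAB i.
by case: (i \in A) => /=; rewrite ?andbT ?andbF // => /(_ isT)/negbTE ->.
Qed.

Lemma sigma_of_sub A : <<s cylinders A >> `<=` measurable.
Proof.
exact: smallest_sub (@sigma_algebra_measurable _ T) (@cylinders_measurable A).
Qed.

Lemma sigma_of_subS (A A' : {set I}) : A \subset A' ->
  <<s cylinders A >> `<=` <<s cylinders A' >>.
Proof. by move=> AA'; apply: sub_sigma_algebra2; exact: cylindersS. Qed.

Lemma sigma_of_ind (A B : {set I}) : (forall i, i \in A -> i \notin B) ->
  forall E F, <<s cylinders A >> E -> <<s cylinders B >> F ->
  P (E `&` F) = P E * P F.
Proof.
move=> dAB; apply: ind_gen.
- exact: cylinders_measurable.
- exact: cylindersI.
- exact: cylindersT.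
- exact: cylinders_measurable.
- exact: cylindersI.
- exact: cylindersT.
- exact: cylinders_ind.
Qed.

Lemma measurable_to_sigma (A : {set I}) :
  measurable_fun [set: T] (id : T -> sigma_of A).
Proof. by move=> _ B sB; rewrite setTI; exact: (@sigma_of_sub A). Qed.

Lemma measurable_sigma_ofS (A A' : {set I}) : A \subset A' ->
  measurable_fun [set: sigma_of A'] (id : sigma_of A' -> sigma_of A).
Proof. by move=> AA' _ B sB; rewrite setTI; apply: (sigma_of_subS AA' sB). Qed.

Lemma measurable_coord (A : {set I}) i : i \in A ->
  measurable_fun [set: sigma_of A] (X i : sigma_of A -> R).
Proof.
move=> iA _ B mB; rewrite setTI; apply: sub_sigma_algebra.
exists (fun j => if j == i then B else setT) => [j|]; first by case: ifP.
apply/seteqP; split => w /=; last by move/(_ i iA); rewrite /= eqxx.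
by move=> Bw j _ /=; case: eqP => // ->.
Qed.

(** The identity maps into [sigma_of A] and [sigma_of B] are independent random elements, and [f],
    [g] are functions of them. *)
Lemma ind_integral2 (A B : {set I}) (f g : T -> \bar R) :
  (forall i, i \in A -> i \notin B) ->
  measurable_fun [set: sigma_of A] (f : sigma_of A -> _) ->
  measurable_fun [set: sigma_of B] (g : sigma_of B -> _) ->
  (forall w, 0 <= f w) -> (forall w, 0 <= g w) ->
  \int[P]_w (f w * g w) = \int[P]_w f w * \int[P]_w g w.
Proof.
move=> dAB mf mg f0 g0.
pose X1 := mfun_Sub (mem_set (measurable_to_sigma (A := A))).
pose X2 := mfun_Sub (mem_set (measurable_to_sigma (A := B))).
apply: (@ind_prod_integral _ _ _ T (sigma_of A) (sigma_of B) R P X1 X2) => //.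
by move=> E F mE mF; apply: (sigma_of_ind dAB).
Qed.

Lemma ind_integral_prod (G : eqType) (A : G -> {set I}) (F : G -> T -> R)
    (s : seq G) :
  uniq s -> (forall a b i, i \in A a -> i \in A b -> a = b) ->
  (forall a, measurable_fun [set: sigma_of (A a)] (F a : sigma_of (A a) -> _)) ->
  (forall a w, (0 <= F a w)%R) ->
  \int[P]_w (\prod_(a <- s) F a w)%:E = \prod_(a <- s) \int[P]_w (F a w)%:E.
Proof.
move=> us dA mF F0; elim: s us => [_|b s IH /= /andP[bs us]].
  under eq_integral do rewrite big_nil.
  rewrite integral_cst // [X in _ * X]probability_setT mule1.
  by rewrite big_nil.
rewrite big_cons -(IH us) {IH}.
under eq_integral do rewrite big_cons EFinM.
(* The union of the remaining groups: the product over [s] is measurable for it, and it misses [A b]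
   because [b] is not in [s]. *)
pose B := [set i | has (fun a => i \in A a) s]%SET.
apply: (@ind_integral2 (A b) B (EFin \o F b)
  (fun w => (\prod_(a <- s) F a w)%:E)).
- move=> i iAb; apply: contra bs; rewrite inE => /hasP[a sa iAa].
  by rewrite (dA b a i).
- exact: (proj2 (@measurable_EFinP _ (sigma_of (A b)) R setT (F b)) (mF b)).
- apply: (proj2 (@measurable_EFinP _ (sigma_of B) R setT _)).
  apply: (@measurable_prod _ (sigma_of B)) => a sa.
  apply: (measurableT_comp (mF a)).
  apply: measurable_sigma_ofS; apply/fintype.subsetP => i iAa.
  by rewrite inE; apply/hasP; exists a.
- by move=> w; rewrite lee_fin.
- by move=> w; rewrite lee_fin; apply: prodr_ge0.
Qed.

End independent_groups.

(** * Exponential moments *)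

Section exponential_inequalities.
Variable R : realType.
Implicit Types x y a : R.

Lemma powr_fact_le_expR x n : 0 <= x -> x ^+ n / n`!%:R <= expR x.
Proof.
move=> x0; case: n => [|n].
  by rewrite expr0 fact0 divr1; apply: le_trans (expR_ge1Dx x); rewrite lerDl.
by apply: le_trans (expR_ge1Dxn n x0); rewrite lerDr.
Qed.

Lemma expR_le_inv x : x < 1 -> expR x <= (1 - x)^-1.
Proof.
move=> x1; rewrite -[expR x]invrK -expRN lef_pV2 ?posrE ?expR_gt0 ?subr_gt0 //.
exact: expR_ge1Dx.
Qed.

(** For a centered variable the linear term vanishes in expectation, leaving the exponential of a
    square. Up to 1/2 the inequality follows from exp x <= 1 / (1 - x) and exp(2 x^2) >= 1 + 2 x^2;
    beyond, from x <= 2 x^2. *)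
Lemma expR_le_quad x : expR x <= x + expR (2 * x ^+ 2).
Proof.
have e2 := expR_ge1Dx (2 * x ^+ 2).
have [x0|x0] := leP x 0.
  have e1 : expR x <= (1 - x)^-1 by apply: expR_le_inv; lra.
  apply: le_trans e1 _; rewrite -div1r ler_pdivrMr; last by lra.
  by apply: le_trans (_ : (x + (1 + 2 * x ^+ 2)) * (1 - x) <= _); [nra|nra].
have [x1|x1] := leP x (2^-1).
  have e1 : expR x <= (1 - x)^-1 by apply: expR_le_inv; lra.
  apply: le_trans e1 _; rewrite -div1r ler_pdivrMr; last by lra.
  by apply: le_trans (_ : (x + (1 + 2 * x ^+ 2)) * (1 - x) <= _); [nra|nra].
have : expR x <= expR (2 * x ^+ 2) by rewrite ler_expR; nra.
lra.
Qed.

(** The exponential lies above its tangent at the weighted mean [m], and the linear parts cancel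
    after averaging. *)
Lemma expR_jensen (E : finType) (w y : E -> R) :
  (forall e, 0 <= w e) -> \sum_e w e = 1 ->
  expR (\sum_e w e * y e) <= \sum_e w e * expR (y e).
Proof.
move=> w0 w1; set m := \sum_e _ * y e.
have le_e e : w e * (expR m * (1 + (y e - m))) <= w e * expR (y e).
  apply: ler_wpM2l => //.
  rewrite -[y e in leRHS](subrK m) expRD [leRHS]mulrC.
  by apply: ler_wpM2l; rewrite ?expR_ge0 // expR_ge1Dx.
apply: le_trans (ler_sum _ (fun e _ => le_e e)).
have -> : \sum_e w e * (expR m * (1 + (y e - m))) =
    expR m * ((1 - m) * \sum_e w e + m).
  rewrite mulrDr mulrA mulr_sumr /m mulr_sumr -big_split /=.
  by apply: eq_bigr => e _; ring.
by rewrite w1; lra.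
Qed.

Lemma expR_convex_le a y : 0 <= a <= 1 -> expR (a * y) <= 1 - a + a * expR y.
Proof.
move=> /andP[a0 a1].
have := @expR_jensen bool (fun b => if b then a else 1 - a)
  (fun b => if b then y else 0).
rewrite !big_bool /= mulr0 addr0 expR0 mulr1 => H.
have {}H : expR (a * y) <= a * expR y + (1 - a).
  by apply: H => [[]|]; rewrite ?subr_ge0 //; lra.
by lra.
Qed.

Lemma expRN_le_quad x : 0 <= x -> expR (- x) <= 1 - x + x ^+ 2.
Proof.
move=> x0; have e1 : expR (- x) <= (1 - (- x))^-1 by apply: expR_le_inv; lra.
apply: le_trans e1 _; rewrite -div1r ler_pdivrMr; last by lra.
by nra.
Qed.

End exponential_inequalities.

Section moments.
Local Open Scope ereal_scope.
Context d (T : measurableType d) (R : realType) (P : probability T R).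
Implicit Types (f g : T -> R) (X : T -> R).

Lemma integral_probability_cst (c : R) : \int[P]_w c%:E = c%:E.
Proof. by rewrite integral_cst // [X in _ * X]probability_setT mule1. Qed.

Lemma ge0_le_expectation f g : measurable_fun setT f -> measurable_fun setT g ->
  (forall w, (0 <= f w)%R) -> (forall w, (f w <= g w)%R) ->
  \int[P]_w (f w)%:E <= \int[P]_w (g w)%:E.
Proof.
move=> mf mg f0 fg; apply: ge0_le_integral => //.
- by move=> w _; rewrite lee_fin.
- exact/measurable_EFinP.
- exact/measurable_EFinP.
- by move=> w _; rewrite lee_fin.
Qed.

Lemma ge0_expectationD f g : measurable_fun setT f -> measurable_fun setT g ->
  (forall w, (0 <= f w)%R) -> (forall w, (0 <= g w)%R) ->
  \int[P]_w (f w + g w)%:E = \int[P]_w (f w)%:E + \int[P]_w (g w)%:E.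
Proof.
move=> mf mg f0 g0; rewrite -ge0_integralD //.
- by move=> w _; rewrite lee_fin.
- exact/measurable_EFinP.
- by move=> w _; rewrite lee_fin.
- exact/measurable_EFinP.
Qed.

Lemma ge0_expectationZ (c : R) f : measurable_fun setT f ->
  (forall w, (0 <= f w)%R) -> (0 <= c)%R ->
  \int[P]_w (c * f w)%:E = c%:E * \int[P]_w (f w)%:E.
Proof.
move=> mf f0 c0; rewrite -ge0_integralZl //.
- exact/measurable_EFinP.
- by move=> w _; rewrite lee_fin.
Qed.

Lemma chernoff_bound f (c u : R) : measurable_fun setT f ->
  \int[P]_w (expR (f w))%:E <= u%:E ->
  P [set w | (c <= f w)%R] <= (u * expR (- c))%:E.
Proof.
move=> mf fu; have mexp : measurable_fun setT (fun w => expR (f w)).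
  exact: (measurableT_comp (@measurable_expR R)).
have mS : measurable [set w | (c <= f w)%R].
  rewrite -[X in measurable X]setTI.
  exact: measurable_fun_le.
rewrite -[X in P X]setIT -integral_indic //.
apply: le_trans (_ : \int[P]_w (expR (- c) * expR (f w))%:E <= _).
  apply: ge0_le_expectation => //.
  - exact: measurable_funM.
  - move=> w; rewrite indicE; case: (boolP (w \in _)) => wS /=.
      rewrite -expRD -[leLHS]expR0 ler_expR; move: wS; rewrite inE /=; lra.
    by rewrite mulr_ge0 ?expR_ge0.
rewrite ge0_expectationZ //.
by rewrite mulrC EFinM lee_pmul2l // lte_fin expR_gt0.
Qed.

Lemma expR_series (y : R) :
  (expR y)%:E = \sum_(0 <= k <oo) (y ^+ k / k`!%:R)%:E.
Proof.
rewrite /expR -EFin_lim; last exact: is_cvg_series_exp_coeff.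
by congr (limn _); apply/funext => n /=; rewrite sumEFin.
Qed.

(** The exponential is expanded in its series. Since k^k / k! <= e^k, the k-th mean is at most 2 (a
    l e)^k <= 2 * 4^-k <= 2^-k for k > 0, and the term k = 0 is 1; the sum is at most 2. *)
Lemma exp_square_moment X (a l : R) : measurable_fun setT X ->
  (0 <= a)%R -> (0 <= l)%R -> (4 * expR 1 * a * l <= 1)%R ->
  (forall k, (0 < k)%N ->
    \int[P]_w (X w ^+ (2 * k))%:E <= (2 * (a * k%:R) ^+ k)%:E) ->
  \int[P]_w (expR (l * X w ^+ 2))%:E <= 2%:E.
Proof.
move=> mX a0 l0 al HX.
have t0 (k : nat) w : (0 <= (l * X w ^+ 2) ^+ k / k`!%:R)%R.
  by rewrite divr_ge0 // exprn_ge0 // mulr_ge0 // sqr_ge0.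
have mt (k : nat) : measurable_fun setT (fun w => (l * X w ^+ 2) ^+ k / k`!%:R)%R.
  apply: measurable_funM => //; apply: measurable_funX.
  by apply: measurable_funM => //; apply: measurable_funX.
under eq_integral do rewrite expR_series.
rewrite integral_nneseries //; last 2 first.
- by move=> k; exact/measurable_EFinP.
- by move=> k w _; rewrite lee_fin.
have le_t k : \int[P]_w ((l * X w ^+ 2) ^+ k / k`!%:R)%:E <= (2 ^- k)%:E.
  case: k => [|k].
    under eq_integral do rewrite expr0 fact0 divr1.
    by rewrite integral_probability_cst expr0 invr1.
  have -> : \int[P]_w ((l * X w ^+ 2) ^+ k.+1 / k.+1`!%:R)%:E =
      (l ^+ k.+1 / k.+1`!%:R)%:E * \int[P]_w (X w ^+ (2 * k.+1))%:E.
    rewrite -ge0_expectationZ //.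
    - by apply: eq_integral => w _; rewrite exprMn -exprM; congr EFin; ring.
    - exact: measurable_funX.
    - by move=> w; rewrite exprM exprn_ge0 // sqr_ge0.
    - by rewrite divr_ge0 // exprn_ge0.
  apply: le_trans (lee_wpmul2l _ (HX k.+1 isT)) _.
    by rewrite lee_fin divr_ge0 // exprn_ge0.
  rewrite -EFinM lee_fin.
  have -> : (l ^+ k.+1 / k.+1`!%:R * (2 * (a * k.+1%:R) ^+ k.+1) =
    2 * (a * l) ^+ k.+1 * (k.+1%:R ^+ k.+1 / k.+1`!%:R))%R.
    by rewrite !exprMn; ring.
  have al0 : (0 <= a * l)%R by rewrite mulr_ge0.
  apply: (@le_trans _ _ (2 * (a * l) ^+ k.+1 * expR 1 ^+ k.+1)%R).
    apply: ler_wpM2l; first by rewrite mulr_ge0 // exprn_ge0.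
    rewrite -expRM_natl mulr1; exact: powr_fact_le_expR.
  rewrite -mulrA -exprMn.
  have ale : (0 <= a * l * expR 1 <= 4^-1)%R.
    rewrite mulr_ge0 ?expR_ge0 //=; lra.
  have : ((a * l * expR 1) ^+ k.+1 <= 4^-1 ^+ k.+1)%R.
    by apply: lerXn2r; rewrite ?nnegrE; lra.
  have -> : (4^-1 = 2^-1 * 2^-1 :> R)%R by rewrite -invfM -natrM.
  rewrite [((2^-1 * 2^-1) ^+ _)%R]exprMn => H.
  apply: (@le_trans _ _ (2 * (2^-1 ^+ k.+1 * 2^-1 ^+ k.+1))%R).
    by rewrite ler_pM2l.
  rewrite -exprVn !exprS; set p := (2^-1 ^+ k)%R.
  have : (0 <= p <= 1)%R.
    by rewrite /p exprn_ge0 //= exprn_ile1 //; lra.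
  nra.
apply: lime_le.
  by apply: is_cvg_nneseries => k _ _; apply: integral_ge0 => w _; rewrite lee_fin.
near=> n; apply: le_trans (lee_sum _ (fun k _ => le_t k)) _.
rewrite sumEFin lee_fin big_mkord.
suff -> : (\sum_(i < n) 2 ^- i = 2 - 2 * 2 ^- n :> R)%R.
  by rewrite lerBlDr lerDl mulr_ge0 // invr_ge0 exprn_ge0.
elim: (n) => [|m IH]; first by rewrite big_ord0 expr0 invr1; lra.
rewrite big_ord_recr /= IH exprS invfM; lra.
Unshelve. all: by end_near. Qed.

(** The supremum is used only at the exponent p = 2 k, where K sqrt(2 k) bounds the L^p norm; its
    power 2 k is (2 K^2 k)^k. *)
Lemma psi2_moment X (K : R) k : measurable_fun setT X ->
  psi2_norm P X = K%:E -> (0 < k)%N ->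
  (0 <= K)%R /\ \int[P]_w (X w ^+ (2 * k))%:E <= ((2 * K ^+ 2 * k%:R) ^+ k)%:E.
Proof.
move=> mX XK k0; set p : R := ((2 * k)%:R)%R.
have p1 : (1 <= p)%R by rewrite /p ler1n muln_gt0.
have p0 : (0 < p)%R by apply: lt_le_trans p1.
have XpE : \int[P]_w (X w ^+ (2 * k))%:E = 'N[P]_p%:E[EFin \o X] `^ p.
  rewrite powR_Lnorm ?gt_eqF //; apply: eq_integral => w _ /=.
  by rewrite /p powR_mulrn // !exprM real_normK ?num_real.
have : (p `^ (- 2^-1))%:E * 'N[P]_p%:E[EFin \o X] <= K%:E.
  by rewrite -XK; apply: ereal_sup_ubound; exists p.
have pp : (0 < p `^ (- 2^-1))%R by apply: powR_gt0.
have N0 : 0 <= 'N[P]_p%:E[EFin \o X] by exact: Lnorm_ge0.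
move=> NK; have K0 : (0 <= K)%R.
  by rewrite -lee_fin; apply: le_trans NK; rewrite mule_ge0 // lee_fin ltW.
split => //; rewrite XpE.
have {NK}NK : 'N[P]_p%:E[EFin \o X] <= (K * p `^ 2^-1)%:E.
  move: NK; rewrite muleC -lee_pdivlMr // => /le_trans; apply.
  by rewrite -EFinM lee_fin powRN invrK.
apply: (@le_trans _ _ ((K * p `^ 2^-1)%:E `^ p)).
  apply: gt0_ler_poweR; rewrite ?(ltW p0) // in_itv /= ?leey ?andbT //.
  by rewrite lee_fin mulr_ge0 // powR_ge0.
have Ks0 : (0 <= K * p `^ 2^-1)%R by rewrite mulr_ge0 // powR_ge0.
rewrite poweR_EFin lee_fin {2}/p powR_mulrn // exprM powR12_sqrt ?(ltW p0) //.
rewrite [((K * _) ^+ 2)%R]exprMn sqr_sqrtr ?(ltW p0) // /p natrM.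
by rewrite mulrA [(K ^+ 2 * 2)%R]mulrC.
Qed.

(** Two regimes. For large t, completing the square gives t X <= t^2 / (4 L) + L X^2, and the factor
    2 is below exp(2 t^2 / L). For small t, [expR_le_quad] removes the linear term and convexity
    handles the remaining exponential. *)
Lemma expR_moment_centered X (L t : R) : measurable_fun setT X -> (0 < L)%R ->
  \int[P]_w (X w)%:E = 0 -> \int[P]_w (X w ^+ 2)%:E < +oo ->
  \int[P]_w (expR (L * X w ^+ 2))%:E <= 2%:E ->
  \int[P]_w (expR (t * X w))%:E <= (expR (3 * t ^+ 2 / L))%:E.
Proof.
move=> mX L0 EX0 EX2 EL.
have mX2 c : measurable_fun setT (fun w => expR (c * X w ^+ 2)).
  apply: (measurableT_comp (@measurable_expR R)).
  by apply: measurable_funM => //; exact: measurable_funX.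
have mtX c : measurable_fun setT (fun w => expR (c * X w)).
  by apply: (measurableT_comp (@measurable_expR R)); exact: measurable_funM.
have [tL|tL] := leP (2 * t ^+ 2)%R L; last first.
  apply: (@le_trans _ _ (\int[P]_w (expR (t ^+ 2 / (4 * L)) * expR (L * X w ^+ 2))%:E)).
    apply: ge0_le_expectation => // [|w].
      exact: measurable_funM.
    rewrite -expRD ler_expR -subr_ge0.
    suff -> : (t ^+ 2 / (4 * L) + L * X w ^+ 2 - t * X w =
      L * (X w - t / (2 * L)) ^+ 2)%R by rewrite mulr_ge0 ?sqr_ge0 // ltW.
    by field; rewrite gt_eqF.
  rewrite ge0_expectationZ //.
  apply: le_trans (lee_wpmul2l _ EL) _; first by rewrite lee_fin expR_ge0.
  rewrite -EFinM lee_fin.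
  have : (2 <= expR (2 * t ^+ 2 / L))%R.
    apply: le_trans (expR_ge1Dx _); suff : (1 <= 2 * t ^+ 2 / L)%R by lra.
    by rewrite ler_pdivlMr // mul1r ltW.
  move=> /(ler_wpM2l (expR_ge0 (t ^+ 2 / (4 * L)))) /le_trans; apply.
  rewrite -expRD ler_expR -subr_ge0.
  suff -> : (3 * t ^+ 2 / L - (t ^+ 2 / (4 * L) + 2 * t ^+ 2 / L) =
    3 / 4 * (t ^+ 2 / L))%R.
    by rewrite mulr_ge0 ?divr_ge0 ?sqr_ge0 ?(ltW L0).
  by field; rewrite gt_eqF.
have iX : P.-integrable setT (EFin \o X).
  apply: (@le_integrable _ _ _ P _ measurableT _ (fun w => (1 + X w ^+ 2)%:E)).
  - exact/measurable_EFinP.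
  - move=> w _; rewrite /= lee_fin; have := sqr_ge0 (`|X w| - 1)%R.
    have := real_normK (num_real (X w)).
    rewrite [`|(1 + _)%R|%R]ger0_norm ?addr_ge0 ?sqr_ge0 //; nra.
  - apply/integrableP; split.
      by apply/measurable_EFinP; apply: measurable_funD => //; exact: measurable_funX.
    under eq_integral => w _ do
      rewrite gee0_abs ?lee_fin ?addr_ge0 ?sqr_ge0 //.
    rewrite (@ge0_expectationD (cst 1%R)) //.
    + by rewrite integral_probability_cst lte_add_pinfty // ltry.
    + exact: measurable_funX.
    + by move=> w; rewrite sqr_ge0.
(* As [al] lies in [0, 1], the exponent 2 t^2 X^2 = al L X^2 interpolates between 0 and L X^2;
   convexity bounds the mean by 1 - al + 2 al = 1 + al. *)
set al := (2 * t ^+ 2 / L)%R.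
have al01 : (0 <= al <= 1)%R.
  apply/andP; split; last by rewrite /al ler_pdivrMr // mul1r.
  apply: divr_ge0; last exact: ltW.
  by apply: mulr_ge0 => //; exact: sqr_ge0.
have Eal : \int[P]_w (expR (2 * (t * X w) ^+ 2))%:E <= (1 + al)%:E.
  apply: (@le_trans _ _ (\int[P]_w ((1 - al) + al * expR (L * X w ^+ 2))%:E)).
    apply: ge0_le_expectation => // [||w].
    - under eq_fun do rewrite exprMn mulrA; exact: mX2.
    - by apply: measurable_funD => //; exact: measurable_funM.
    - apply: le_trans (expR_convex_le _ al01).
      by rewrite ler_expR exprMn /al le_eqVlt; apply/orP; left; apply/eqP; field;
        rewrite gt_eqF.
  have [al0 al1] := andP al01.
  rewrite (@ge0_expectationD (cst (1 - al)%R)) //; last 3 first.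
  - exact: measurable_funM.
  - by move=> w /=; rewrite subr_ge0.
  - by move=> w; rewrite mulr_ge0 // expR_ge0.
  rewrite integral_probability_cst ge0_expectationZ //.
  apply: le_trans (leeD2l _ (lee_wpmul2l _ EL)) _; first by rewrite lee_fin.
  by rewrite -EFinM -EFinD lee_fin; lra.
apply: (@le_trans _ _ (\int[P]_w (t * X w + expR (2 * (t * X w) ^+ 2))%:E)).
  apply: ge0_le_expectation => // [|w]; last exact: expR_le_quad.
  apply: measurable_funD; first exact: measurable_funM.
  by under eq_fun do rewrite exprMn mulrA; exact: mX2.
have imt : P.-integrable setT (fun w => t%:E * (X w)%:E) by exact: integrableZl.
rewrite (_ : \int[P]_w _ = \int[P]_w (t%:E * (X w)%:E) +
    \int[P]_w (expR (2 * (t * X w) ^+ 2))%:E); last first.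
  rewrite -integralD //; apply/integrableP; split.
    apply/measurable_EFinP; under eq_fun do rewrite exprMn mulrA; exact: mX2.
  under eq_integral => w _ do rewrite gee0_abs ?lee_fin ?expR_ge0 //.
  by apply: le_lt_trans Eal _; rewrite ltry.
rewrite integralZl // EX0 mule0 add0e; apply: le_trans Eal _.
rewrite lee_fin; apply: le_trans (expR_ge1Dx _) _.
rewrite ler_expR /al ler_wpM2r ?invr_ge0 ?(ltW L0) // ler_wpM2r ?sqr_ge0 //; lra.
Qed.

End moments.

Section zero_mean_product.
Local Open Scope ereal_scope.
Context d (T : measurableType d) (R : realType) (P : probability T R).
Variables (X Y : {mfun T >-> R}).
Hypothesis indXY : forall A B, measurable A -> measurable B ->
  P (X @^-1` A `&` Y @^-1` B) = P (X @^-1` A) * P (Y @^-1` B).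

(** The integrand changes sign, so Fubini replaces Tonelli: under the product law each inner
    integral is x times the zero mean of [Y]. *)
Lemma ind_expectation0 : P.-integrable setT (EFin \o Y) ->
  P.-integrable setT (fun w => (X w * Y w)%:E) ->
  \int[P]_w (Y w)%:E = 0 -> \int[P]_w (X w * Y w)%:E = 0.
Proof.
move=> iY iXY EY.
have mXY : measurable_fun setT (fun w => (X w, Y w)) by exact: measurable_fun_pair.
pose XY := mfun_Sub (mem_set mXY).
pose f (z : R * R) := (z.1 * z.2)%:E.
have mf : measurable_fun [set: R * R] f.
  by apply/measurable_EFinP; apply: measurable_funM.
have jointE (A : set (R * R)) : measurable A ->
    distribution P XY A = (distribution P X \x distribution P Y) A.
  by move=> mA; rewrite -(joint_lawE indXY mA).
transitivity (\int[distribution P XY]_z f z).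
  by rewrite integral_distribution.
transitivity (\int[(distribution P X \x distribution P Y)]_z f z).
  by apply: eq_measure_integral => A mA _; exact: jointE.
have fi : (distribution P X \x distribution P Y).-integrable setT f.
  apply/integrableP; split => //.
  rewrite (@eq_measure_integral _ _ _ _ (distribution P XY)); last first.
    by move=> A mA _ /=; rewrite -jointE.
  rewrite ge0_integral_distribution //; last exact: measurableT_comp.
  by case/integrableP : iXY.
rewrite -integral12_prod_meas1 //.
have iY' : (distribution P Y).-integrable setT (EFin : R -> \bar R).
  apply/integrableP; split; first exact/measurable_EFinP.
  rewrite ge0_integral_distribution //; first by case/integrableP : iY.
  by apply: measurableT_comp => //; exact/measurable_EFinP.
rewrite integral0_eq // => x _; rewrite /fubini_F /f /=.
under eq_integral do rewrite EFinM.
by rewrite integralZl // integral_distribution ?EY ?mule0.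
Qed.

End zero_mean_product.

Section exp_square_of_mgf.
Local Open Scope ereal_scope.
Context d (T : measurableType d) (R : realType) (P : probability T R).

(** For t > 0, X^(2k) <= (2k)! t^(-2k) (exp(t X) + exp(- t X)). The choice 3 t^2 S / L = k and (2k)!
    <= (2k)^(2k) bound the moments by 2 (a k)^k with a = 12 e S / L; the rate 1 / (4 e a) of
    [exp_square_moment] then produces the constant 48 e^2. *)
Lemma exp_square_of_mgf (X : T -> R) (S L : R) : measurable_fun setT X ->
  (0 < S)%R -> (0 < L)%R ->
  (forall t, \int[P]_w (expR (t * X w))%:E <= (expR (3 * t ^+ 2 * S / L))%:E) ->
  \int[P]_w (expR (L / (48 * expR 1 ^+ 2) / S * X w ^+ 2))%:E <= 2%:E.
Proof.
move=> mX S0 L0 mgf; have e0 := expR_gt0 (1 : R).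
have LS0 : (0 < L / S)%R by rewrite divr_gt0.
apply: (@exp_square_moment _ _ _ _ _ (12 * expR 1 * S / L)) => //.
- by rewrite !mulr_ge0 ?invr_ge0 ?(ltW L0) ?(ltW S0) ?(ltW e0).
- by rewrite !mulr_ge0 ?invr_ge0 ?mulr_ge0 ?exprn_ge0 ?(ltW L0) ?(ltW S0) ?(ltW e0).
- rewrite le_eqVlt; apply/orP; left; apply/eqP.
  by field; rewrite !gt_eqF.
move=> k k0; have kR0 : (0 < k%:R :> R)%R by rewrite ltr0n.
pose t : R := Num.sqrt (k%:R * L / (3 * S)).
have t2 : (t ^+ 2 = k%:R * L / (3 * S))%R.
  by rewrite sqr_sqrtr // divr_ge0 ?mulr_ge0 ?(ltW L0) ?(ltW S0).
have t0 : (0 < t)%R by rewrite sqrtr_gt0 divr_gt0 ?mulr_gt0.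
have mtX c : measurable_fun setT (fun w => expR (c * X w)).
  by apply: (measurableT_comp (@measurable_expR R)); exact: measurable_funM.
pose c : R := ((2 * k)`!%:R / t ^+ (2 * k))%R.
have c0 : (0 <= c)%R by rewrite divr_ge0 // exprn_ge0 // ltW.
apply: (@le_trans _ _ (\int[P]_w (c * (expR (t * X w) + expR (- t * X w)))%:E)).
  apply: ge0_le_expectation => // [|||w].
  - exact: measurable_funX.
  - by apply: measurable_funM => //; exact: measurable_funD.
  - by move=> w; rewrite exprM exprn_ge0 // sqr_ge0.
  rewrite /c mulrAC ler_pdivlMr ?exprn_gt0 // -exprMn.
  rewrite -ler_pdivrMl ?ltr0n ?fact_gt0 // mulrC.
  have -> : ((X w * t) ^+ (2 * k) = `|t * X w| ^+ (2 * k))%R.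
    by rewrite !exprM real_normK ?num_real // mulrC.
  apply: le_trans (powr_fact_le_expR _ (normr_ge0 _)) _.
  have [h|h] := ger0P (t * X w)%R.
    by rewrite lerDl expR_ge0.
  by rewrite mulNr lerDr expR_ge0.
rewrite ge0_expectationZ //; last exact: measurable_funD.
rewrite ge0_expectationD //.
apply: (@le_trans _ _ (c%:E * (expR k%:R + expR k%:R)%:E)).
  apply: lee_wpmul2l; rewrite ?lee_fin // EFinD.
  have tk : (3 * t ^+ 2 * S / L = k%:R)%R.
    by rewrite t2; field; rewrite !gt_eqF.
  by apply: leeD; apply: le_trans (mgf _) _; rewrite ?sqrrN tk.
rewrite -EFinM lee_fin /c exprM t2.
have -> : ((12 * expR 1 * S / L * k%:R) ^+ k =
    (4 * k%:R ^+ 2) ^+ k / (k%:R * L / (3 * S)) ^+ k * expR k%:R)%R.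
  rewrite (_ : expR k%:R = expR 1 ^+ k)%R; last by rewrite -expRM_natl mulr1.
  rewrite -exprVn -!exprMn; congr (_ ^+ _)%R.
  by field; rewrite !gt_eqF.
rewrite (_ : expR k%:R + expR k%:R = 2 * expR k%:R)%R; last by ring.
rewrite mulrCA.
rewrite ler_pM2l // ler_pM2r ?expR_gt0 // ler_pM2r; last first.
  by rewrite invr_gt0 exprn_gt0 // divr_gt0 ?mulr_gt0.
have -> : (4 * k%:R ^+ 2 = (2 * k)%:R ^+ 2 :> R)%R by rewrite natrM exprMn; ring.
rewrite -exprM -natrX ler_nat.
elim: (2 * k)%N => // n IH; rewrite factS expnS leq_mul2l /=.
by apply: (leq_trans IH); case: n {IH} => // n; rewrite leq_exp2r.
Qed.

End exp_square_of_mgf.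

Lemma lee_prod (R : realType) (I : Type) (s : seq I) (f g : I -> \bar R) :
  (forall i, 0 <= f i <= g i)%E -> (\prod_(i <- s) f i <= \prod_(i <- s) g i)%E.
Proof.
move=> fg; have g0 i : (0 <= g i)%E by have /andP[/le_trans + ?] := fg i; apply.
elim: s => [|i s IH]; rewrite ?big_nil // !big_cons.
have /andP[f0 lefg] := fg i; apply: lee_pmul => //.
by apply: prode_ge0 => j _; have /andP[] := fg j.
Qed.

(** * Chernoff bounds for sums of squares of linear forms *)

Section independent_rows.
Local Open Scope ereal_scope.
Context d (T : measurableType d) (R : realType) (P : probability T R).
Variables (l : nat) (J : finType) (X : 'I_l * J -> T -> R) (L : R).
Hypothesis mX : forall p, measurable_fun setT (X p).
Hypothesis indX : independent_rvs P X.
Hypothesis EX : forall p, \int[P]_w (X p w)%:E = 0.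
Hypothesis EX2 : forall p, \int[P]_w (X p w ^+ 2)%:E = 1.
Hypothesis L0 : (0 < L)%R.
Hypothesis EL : forall p, \int[P]_w (expR (L * X p w ^+ 2))%:E <= 2%:E.

Definition rowform (b : J -> R) (i : 'I_l) (w : T) : R :=
  (\sum_j b j * X (i, j) w)%R.

Let row (i : 'I_l) : {set 'I_l * J} := [set p | p.1 == i]%SET.

Lemma measurable_rowform b i : measurable_fun setT (rowform b i).
Proof.
by apply: measurable_sum => j; exact: measurable_funM.
Qed.

Let measurable_row_rowform b i :
  measurable_fun [set: sigma_of X (row i)] (rowform b i : sigma_of X (row i) -> R).
Proof.
apply: (@measurable_sum _ (sigma_of X (row i))) => j.
apply: (@measurable_funM _ (sigma_of X (row i))); first exact: measurable_cst.
by apply: measurable_coord; rewrite inE.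
Qed.

Lemma rowform_mgf b i t :
  \int[P]_w (expR (t * rowform b i w))%:E <=
  (expR (3 * t ^+ 2 * (\sum_j b j ^+ 2) / L))%:E.
Proof.
under eq_integral do rewrite /rowform mulr_sumr expR_sum.
pose A (j : J) : {set 'I_l * J} := [set (i, j)]%SET.
rewrite (@ind_integral_prod _ _ _ P _ _ mX indX _ A
  (fun j w => expR (t * (b j * X (i, j) w)))) //; first last.
- move=> j; apply: (measurableT_comp (@measurable_expR R)).
  apply: (@measurable_funM _ (sigma_of X (A j))); first exact: measurable_cst.
  apply: (@measurable_funM _ (sigma_of X (A j))); first exact: measurable_cst.
  by apply: measurable_coord; rewrite inE.
- by move=> j k p; rewrite !inE => /eqP -> /eqP [].
- exact: index_enum_uniq.
rewrite mulr_sumr mulr_suml expR_sum -prodEFin.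
apply: lee_prod => j; apply/andP; split.
  by apply: integral_ge0 => w _; rewrite lee_fin expR_ge0.
under eq_integral do rewrite mulrA.
apply: le_trans (expR_moment_centered (t * b j) (mX _) L0 (EX _) _ (EL _)) _.
  by rewrite EX2 ltry.
by rewrite lee_fin ler_expR exprMn mulrA.
Qed.

Let integrable_entry p : P.-integrable setT (EFin \o X p).
Proof.
apply: (@le_integrable _ _ _ P _ measurableT _ (fun w => (1 + X p w ^+ 2)%:E)).
- exact/measurable_EFinP.
- move=> w _; rewrite /= lee_fin; have := sqr_ge0 (`|X p w| - 1)%R.
  have := real_normK (num_real (X p w)).
  rewrite [`|(1 + _)%R|%R]ger0_norm ?addr_ge0 ?sqr_ge0 //; nra.
- apply/integrableP; split.
    by apply/measurable_EFinP; apply: measurable_funD => //; exact: measurable_funX.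
  under eq_integral => w _ do
    rewrite gee0_abs ?lee_fin ?addr_ge0 ?sqr_ge0 //.
  rewrite (@ge0_expectationD _ _ _ _ (cst 1%R)) //.
  + by rewrite integral_probability_cst EX2 lte_add_pinfty // ltry.
  + exact: measurable_funX.
  + by move=> w; rewrite sqr_ge0.
Qed.

Let integrable_entries p q : P.-integrable setT (fun w => (X p w * X q w)%:E).
Proof.
apply: (@le_integrable _ _ _ P _ measurableT _
  (fun w => (X p w ^+ 2 + X q w ^+ 2)%:E)).
- by apply/measurable_EFinP; exact: measurable_funM.
- move=> w _; rewrite /= lee_fin.
  rewrite [`|(_ ^+ 2 + _)%R|%R]ger0_norm ?addr_ge0 ?sqr_ge0 // normrM.
  have := sqr_ge0 (`|X p w| - `|X q w|)%R.
  have := real_normK (num_real (X p w)); have := real_normK (num_real (X q w)).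
  have := sqr_ge0 (X p w); have := sqr_ge0 (X q w); nra.
- apply/integrableP; split.
    by apply/measurable_EFinP; apply: measurable_funD; exact: measurable_funX.
  under eq_integral => w _ do
    rewrite gee0_abs ?lee_fin ?addr_ge0 ?sqr_ge0 //.
  rewrite ge0_expectationD.
  + by rewrite !EX2 lte_add_pinfty // ltry.
  + exact: measurable_funX.
  + exact: measurable_funX.
  + by move=> w; rewrite sqr_ge0.
  + by move=> w; rewrite sqr_ge0.
Qed.

Let entries_uncorrelated p q : p != q -> \int[P]_w (X p w * X q w)%:E = 0.
Proof.
move=> pq; pose Xp := mfun_Sub (mem_set (mX p)).
pose Xq := mfun_Sub (mem_set (mX q)).
refine (@ind_expectation0 _ _ _ P Xp Xq _
  (integrable_entry q) (integrable_entries p q) (EX q)).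
move=> A B mA mB.
apply: (@sigma_of_ind _ _ _ P _ _ mX indX [set p]%SET [set q]%SET).
- by move=> i; rewrite !inE => /eqP ->.
- rewrite -[X in <<s _ >> X]setTI.
  by apply: (@measurable_coord _ _ _ _ X [set p]%SET p) => //; rewrite inE.
- rewrite -[X in <<s _ >> X]setTI.
  by apply: (@measurable_coord _ _ _ _ X [set q]%SET q) => //; rewrite inE.
Qed.

Lemma rowform_variance b i :
  \int[P]_w (rowform b i w ^+ 2)%:E = (\sum_j b j ^+ 2)%:E.
Proof.
transitivity (\int[P]_w \sum_j \sum_k
    ((b j * b k)%:E * (X (i, j) w * X (i, k) w)%:E)).
  apply: eq_integral => w _; rewrite expr2 /rowform mulr_suml -sumEFin.
  apply: eq_bigr => j _; rewrite mulr_sumr -sumEFin; apply: eq_bigr => k _.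
  by rewrite -EFinM; congr EFin; ring.
rewrite integral_sum //; last first.
  by move=> j; apply: (integrable_sum measurableT) => k _; exact: integrableZl.
rewrite -sumEFin; apply: eq_bigr => j _.
rewrite integral_sum //; last by move=> k; exact: integrableZl.
rewrite (bigD1 j) //= integralZl // big1 ?adde0 => [|k kj].
  by under eq_integral do rewrite -expr2; rewrite EX2 mule1 -expr2.
rewrite integralZl // entries_uncorrelated ?mule0 //.
by apply: contra kj => /eqP [->].
Qed.

Section energy.
Variables (E : finType) (b : E -> J -> R).

(** In the application [e] runs over the columns of a matrix B and the four real components, and
    this is the squared norm of row [i] of Phi B. *)
Definition energy (i : 'I_l) (w : T) : R := (\sum_e rowform (b e) i w ^+ 2)%R.
Definition total_energy (w : T) : R := (\sum_i energy i w)%R.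

Let L1 : R := (L / (48 * expR 1 ^+ 2))%R.

Let L1_gt0 : (0 < L1)%R.
Proof. by rewrite divr_gt0 // mulr_gt0 // exprn_gt0 // expR_gt0. Qed.

Lemma energy_ge0 i w : (0 <= energy i w)%R.
Proof. by apply: sumr_ge0 => e _; exact: sqr_ge0. Qed.

Lemma measurable_energy i : measurable_fun setT (energy i).
Proof.
apply: measurable_sum => e; apply: measurable_funX; exact: measurable_rowform.
Qed.

Lemma measurable_total_energy : measurable_fun setT total_energy.
Proof. by apply: measurable_sum => i; exact: measurable_energy. Qed.

Variable S : R.
Hypothesis SE : S = (\sum_e \sum_j b e j ^+ 2)%R.
Hypothesis S0 : (0 < S)%R.

Let mexp c i : measurable_fun setT (fun w => expR (c * energy i w)).
Proof.
apply: (measurableT_comp (@measurable_expR R)); apply: measurable_funM => //.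
exact: measurable_energy.
Qed.

Lemma energy_mean i : \int[P]_w (energy i w)%:E = S%:E.
Proof.
rewrite /energy; under eq_integral do rewrite -sumEFin.
rewrite ge0_integral_sum //; last 2 first.
- move=> e; apply/measurable_EFinP; apply: measurable_funX.
  exact: measurable_rowform.
- by move=> e w _; rewrite lee_fin sqr_ge0.
by rewrite SE -sumEFin; apply: eq_bigr => e _; rewrite rowform_variance.
Qed.

(** The forms within a row are dependent, so Jensen replaces independence: the exponent is the
    average of the [y e] with weights [Se e / S], and each [y e] has exponential moment at most 2.
    If [Se e] = 0, the form is zero and the convention 1/0 = 0 makes [y e] vanish. *)
Lemma energy_exp_moment i : \int[P]_w (expR (L1 / S * energy i w))%:E <= 2%:E.
Proof.
pose Se e : R := (\sum_j b e j ^+ 2)%R.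
have Se0 e : (0 <= Se e)%R by apply: sumr_ge0 => j _; exact: sqr_ge0.
pose y e w : R := (L1 / Se e * rowform (b e) i w ^+ 2)%R.
have my e : measurable_fun setT (fun w => expR (y e w)).
  apply: (measurableT_comp (@measurable_expR R)); apply: measurable_funM => //.
  by apply: measurable_funX; exact: measurable_rowform.
have Ey e : \int[P]_w (expR (y e w))%:E <= 2%:E.
  have [Se_eq0|] := eqVneq (Se e) 0%R.
    under eq_integral do rewrite /y Se_eq0 invr0 mulr0 mul0r expR0.
    by rewrite integral_probability_cst lee_fin; lra.
  move=> Se_neq0; have Se_gt0 : (0 < Se e)%R by rewrite lt_neqAle eq_sym Se_neq0 Se0.
  apply: exp_square_of_mgf => //; first exact: measurable_rowform.
  by move=> t; exact: rowform_mgf.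
have w0 e : (0 <= Se e / S)%R by rewrite divr_ge0 // ltW.
have w1 : (\sum_e Se e / S = 1)%R.
  by rewrite -mulr_suml -SE divff // gt_eqF.
apply: (@le_trans _ _ (\int[P]_w (\sum_e Se e / S * expR (y e w))%:E)).
  apply: ge0_le_expectation => // [|w].
    by apply: measurable_sum => e; exact: measurable_funM.
  apply: le_trans (expR_jensen (fun e => y e w) w0 w1).
  rewrite ler_expR /energy mulr_sumr; apply: ler_sum => e _.
  rewrite /y; have [Se_eq0|Se_neq0] := eqVneq (Se e) 0%R.
    suff -> : rowform (b e) i w = 0%R by rewrite expr0n /= !mulr0.
    rewrite /rowform big1 // => j _.
    suff /eqP : (b e j ^+ 2 = 0)%R by rewrite sqrf_eq0 => /eqP ->; rewrite mul0r.
    move: Se_eq0; rewrite /Se => /eqP; rewrite psumr_eq0; last first.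
      by move=> k _; exact: sqr_ge0.
    by move=> /allP /(_ j); rewrite mem_index_enum => /(_ isT) /eqP.
  rewrite le_eqVlt; apply/orP; left; apply/eqP; field.
  by rewrite Se_neq0 gt_eqF.
under eq_integral do rewrite -sumEFin.
rewrite ge0_integral_sum //; last 2 first.
- by move=> e; apply/measurable_EFinP; exact: measurable_funM.
- by move=> e w _; rewrite lee_fin mulr_ge0 // expR_ge0.
apply: (@le_trans _ _ (\sum_e (Se e / S)%:E * 2%:E)).
  apply: lee_sum => e _; rewrite ge0_expectationZ //.
  by apply: lee_wpmul2l => //; rewrite lee_fin.
under eq_bigr do rewrite -EFinM.
by rewrite sumEFin -mulr_suml w1 mul1r.
Qed.

Lemma total_energy_mgf c (u : R) : (0 <= u)%R ->
  (forall i, \int[P]_w (expR (c * energy i w))%:E <= u%:E) ->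
  \int[P]_w (expR (c * total_energy w))%:E <= (u ^+ l)%:E.
Proof.
move=> u0 Eu; under eq_integral do rewrite /total_energy mulr_sumr expR_sum.
rewrite (@ind_integral_prod _ _ _ P _ _ mX indX _ row
  (fun i w => expR (c * energy i w))) //; first last.
- move=> i; apply: (measurableT_comp (@measurable_expR R)).
  apply: (@measurable_funM _ (sigma_of X (row i))); first exact: measurable_cst.
  apply: (@measurable_sum _ (sigma_of X (row i))) => e.
  exact: (@measurable_funX _ (sigma_of X (row i))).
- by move=> i j p; rewrite !inE => /eqP -> /eqP.
- exact: index_enum_uniq.
apply: (@le_trans _ _ (\prod_(i < l) u%:E)).
  apply: lee_prod => i; rewrite Eu andbT.
  by apply: integral_ge0 => w _; rewrite lee_fin expR_ge0.
by rewrite prodEFin prodr_const card_ord.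
Qed.

Lemma total_energy_upper (t : R) :
  P [set w | (l%:R * t * S <= total_energy w)%R] <=
  (2 ^+ l * expR (- (l%:R * (L1 * t))))%:E.
Proof.
have -> : [set w | (l%:R * t * S <= total_energy w)%R] =
    [set w | (l%:R * (L1 * t) <= L1 / S * total_energy w)%R].
  have H w : (l%:R * t * S <= total_energy w)%R =
      (l%:R * (L1 * t) <= L1 / S * total_energy w)%R.
    rewrite [(L1 / S * _)%R]mulrAC ler_pdivlMr //.
    rewrite (_ : l%:R * (L1 * t) * S = L1 * (l%:R * t * S))%R; last by ring.
    by rewrite ler_pM2l.
  by apply/seteqP; split => w /=; rewrite H.
apply: chernoff_bound.
  by apply: measurable_funM => //; exact: measurable_total_energy.
by apply: total_energy_mgf => // i; exact: energy_exp_moment.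
Qed.

Lemma energy_square i :
  \int[P]_w (energy i w ^+ 2)%:E <= (4 * (S / L1) ^+ 2)%:E.
Proof.
apply: (@le_trans _ _ (\int[P]_w (2 * (S / L1) ^+ 2 * expR (L1 / S * energy i w))%:E)).
  apply: ge0_le_expectation => // [|||w].
  - by apply: measurable_funX; exact: measurable_energy.
  - exact: measurable_funM.
  - by move=> w; exact: sqr_ge0.
  set u := (L1 / S * energy i w)%R.
  have u0 : (0 <= u)%R.
    by apply: mulr_ge0; [apply: ltW; exact: divr_gt0|exact: energy_ge0].
  have -> : energy i w = (S / L1 * u)%R by rewrite /u; field; rewrite !gt_eqF.
  have := powr_fact_le_expR 2 u0; rewrite (_ : 2`! = 2)%N // => H.
  rewrite exprMn -mulrA; rewrite [(2 * _)%R]mulrCA.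
  apply: ler_wpM2l; first exact: sqr_ge0.
  by move: H; rewrite ler_pdivrMr // mulrC.
rewrite ge0_expectationZ //; last by rewrite mulr_ge0 // sqr_ge0.
apply: le_trans (lee_wpmul2l _ (energy_exp_moment i)) _.
  by rewrite lee_fin mulr_ge0 // sqr_ge0.
by rewrite -EFinM lee_fin; lra.
Qed.

Lemma total_energy_lower :
  P [set w | (total_energy w <= l%:R * S / 2)%R] <=
  (expR (- (l%:R * L1 ^+ 2 / 64)))%:E.
Proof.
(* This m minimizes - m S / 2 + 4 (m S / L1)^2, the exponent per row that exp(-x) <= 1 - x + x^2
   yields with mean S, second moment at most 4 (S / L1)^2 and threshold S / 2. *)
pose m := (L1 ^+ 2 / (16 * S))%R.
have m0 : (0 < m)%R by rewrite divr_gt0 ?mulr_gt0 // exprn_gt0.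
have -> : [set w | (total_energy w <= l%:R * S / 2)%R] =
    [set w | (- (m * (l%:R * S / 2)) <= - m * total_energy w)%R].
  by apply/seteqP; split => w /=; rewrite mulNr lerN2 ler_pM2l.
apply: (le_trans (@chernoff_bound _ _ _ P (fun w => - m * total_energy w)%R
  (- (m * (l%:R * S / 2)))%R (expR (- (3 * L1 ^+ 2 / 64)) ^+ l)%R _ _)).
- by apply: measurable_funM => //; exact: measurable_total_energy.
- apply: total_energy_mgf => [|i]; first exact: expR_ge0.
  apply: (@le_trans _ _ (1 - 3 * L1 ^+ 2 / 64)%:E); last first.
    by rewrite lee_fin; exact: expR_ge1Dx.
  have -> : (1 - 3 * L1 ^+ 2 / 64 =
      1 + m ^+ 2 * (4 * (S / L1) ^+ 2) - m * S)%R.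
    by rewrite /m; field; rewrite !gt_eqF.
  rewrite EFinB leeBrDr //.
  have mE := measurable_energy i.
  have mE2 : measurable_fun setT (fun w => energy i w ^+ 2)%R.
    exact: measurable_funX.
  rewrite EFinM -(energy_mean i) -ge0_expectationZ ?(ltW m0) //; last first.
    by move=> w; exact: energy_ge0.
  rewrite -ge0_expectationD //; last 2 first.
  - exact: measurable_funM.
  - by move=> w; rewrite mulr_ge0 ?(ltW m0) ?energy_ge0.
  apply: (@le_trans _ _ (\int[P]_w (1 + m ^+ 2 * energy i w ^+ 2)%:E)).
    apply: ge0_le_expectation => // [|||w].
    - by apply: measurable_funD => //; exact: measurable_funM.
    - by apply: measurable_funD => //; exact: measurable_funM.
    - by move=> w; rewrite addr_ge0 ?expR_ge0 // mulr_ge0 ?(ltW m0) ?energy_ge0.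
    have u0 : (0 <= m * energy i w)%R by rewrite mulr_ge0 ?(ltW m0) ?energy_ge0.
    by have := expRN_le_quad u0; rewrite exprMn mulNr; lra.
  rewrite (@ge0_expectationD _ _ _ _ (cst 1%R)) //; last 2 first.
  - exact: measurable_funM.
  - by move=> w; rewrite mulr_ge0 ?sqr_ge0.
  rewrite integral_probability_cst ge0_expectationZ ?sqr_ge0 //; last first.
    by move=> w; exact: sqr_ge0.
  rewrite EFinD; apply: leeD2l; rewrite [leRHS]EFinM.
  apply: lee_wpmul2l; last exact: energy_square.
  by rewrite lee_fin sqr_ge0.
- rewrite lee_fin -expRM_natl -expRD ler_expR le_eqVlt; apply/orP; left; apply/eqP.
  by rewrite /m; field; rewrite gt_eqF.
Qed.

End energy.

End independent_rows.

(** * Quaternion matrices *)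

Section quaternions.
Variable R : realType.
Implicit Types p q : quat R.

Lemma quatP p q : qw p = qw q -> qx p = qx q -> qy p = qy q -> qz p = qz q ->
  p = q.
Proof. by case: p q => [? ? ? ?] [? ? ? ?] /= -> -> -> ->. Qed.

Lemma qw_sum I (s : seq I) (F : I -> quat R) :
  qw (\sum_(i <- s) F i) = \sum_(i <- s) qw (F i).
Proof. by elim/big_rec2: _ => // i y1 y2 _ <-. Qed.
Lemma qx_sum I (s : seq I) (F : I -> quat R) :
  qx (\sum_(i <- s) F i) = \sum_(i <- s) qx (F i).
Proof. by elim/big_rec2: _ => // i y1 y2 _ <-. Qed.
Lemma qy_sum I (s : seq I) (F : I -> quat R) :
  qy (\sum_(i <- s) F i) = \sum_(i <- s) qy (F i).
Proof. by elim/big_rec2: _ => // i y1 y2 _ <-. Qed.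
Lemma qz_sum I (s : seq I) (F : I -> quat R) :
  qz (\sum_(i <- s) F i) = \sum_(i <- s) qz (F i).
Proof. by elim/big_rec2: _ => // i y1 y2 _ <-. Qed.

Lemma conjqM p q : conjq (p * q) = conjq q * conjq p.
Proof. by apply: quatP => /=; ring. Qed.

Lemma conjqD p q : conjq (p + q) = conjq p + conjq q.
Proof. by apply: quatP => /=; ring. Qed.

Lemma conjqK : involutive (@conjq R).
Proof. by move=> p; apply: quatP => /=; ring. Qed.

Lemma conjq_sum I (s : seq I) (F : I -> quat R) :
  conjq (\sum_(i <- s) F i) = \sum_(i <- s) conjq (F i).
Proof.
elim/big_rec2: _ => [|i y1 y2 _ <-]; last exact: conjqD.
by apply: quatP => /=; rewrite ?oppr0.
Qed.

Definition qdot p q : R := qw p * qw q + qx p * qx q + qy p * qy q + qz p * qz q.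

Lemma normsqE p : normsq p = qdot p p.
Proof. by rewrite /normsq /qdot !expr2. Qed.

Lemma normsq_ge0 p : 0 <= normsq p.
Proof. by rewrite /normsq !addr_ge0 // sqr_ge0. Qed.

Lemma normsq_eq0 p : normsq p = 0 -> p = 0.
Proof.
rewrite /normsq => p0.
have w0 := sqr_ge0 (qw p); have x0 := sqr_ge0 (qx p).
have y0 := sqr_ge0 (qy p); have z0 := sqr_ge0 (qz p).
by apply: quatP; apply/eqP; rewrite -sqrf_eq0; apply/eqP; move: p0; lra.
Qed.

Lemma normsqM p q : normsq (p * q) = normsq p * normsq q.
Proof. by rewrite /normsq /=; ring. Qed.

Lemma normsq_conj p : normsq (conjq p) = normsq p.
Proof. by rewrite /normsq /=; ring. Qed.

End quaternions.

Section quaternion_matrices.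
Variable R : realType.

(** The real part of the trace of M^* N: a real inner product, symmetric and bilinear although the
    entries do not commute, for which [qadj] is the adjoint. *)
Definition mdot m n (M N : 'M[quat R]_(m, n)) : R :=
  \sum_i \sum_j qdot (M i j) (N i j).

Definition nsq m n (M : 'M[quat R]_(m, n)) : R := \sum_i \sum_j normsq (M i j).

Lemma qfrobE m n (M : 'M[quat R]_(m, n)) : qfrob M = Num.sqrt (nsq M).
Proof. by []. Qed.

Lemma nsqE m n (M : 'M[quat R]_(m, n)) : nsq M = mdot M M.
Proof. by do 2!apply: eq_bigr => ? _; rewrite normsqE. Qed.

Lemma nsq_ge0 m n (M : 'M[quat R]_(m, n)) : 0 <= nsq M.
Proof. by do 2!apply: sumr_ge0 => ? _; exact: normsq_ge0. Qed.

Lemma qfrob_sqr m n (M : 'M[quat R]_(m, n)) : qfrob M ^+ 2 = nsq M.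
Proof. by rewrite qfrobE sqr_sqrtr // nsq_ge0. Qed.

Lemma nsq_eq0 m n (M : 'M[quat R]_(m, n)) : nsq M = 0 -> M = 0.
Proof.
move=> M0; apply/matrixP => i j; rewrite mxE; apply: normsq_eq0; apply/eqP.
move/eqP: M0; rewrite psumr_eq0 => [/allP|i' _]; last first.
  by apply: sumr_ge0 => j' _; exact: normsq_ge0.
move=> /(_ i); rewrite mem_index_enum => /(_ isT) /=.
rewrite psumr_eq0 => [/allP|j' _]; last exact: normsq_ge0.
by move=> /(_ j); rewrite mem_index_enum => /(_ isT).
Qed.

Lemma nsq0 m n : nsq (0 : 'M[quat R]_(m, n)) = 0.
Proof.
by rewrite /nsq !big1 // => i _; rewrite big1 // => j _; rewrite mxE /normsq /=; ring.
Qed.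

Lemma mdotC m n (M N : 'M[quat R]_(m, n)) : mdot M N = mdot N M.
Proof. by do 2!apply: eq_bigr => ? _; rewrite /qdot; ring. Qed.

Lemma mdotDl m n (M M' N : 'M[quat R]_(m, n)) :
  mdot (M + M') N = mdot M N + mdot M' N.
Proof.
rewrite -big_split; apply: eq_bigr => i _; rewrite -big_split.
by apply: eq_bigr => j _; rewrite mxE /qdot /=; ring.
Qed.

Lemma mdotNl m n (M N : 'M[quat R]_(m, n)) : mdot (- M) N = - mdot M N.
Proof.
rewrite -sumrN; apply: eq_bigr => i _; rewrite -sumrN.
by apply: eq_bigr => j _; rewrite mxE /qdot /=; ring.
Qed.

Lemma mdotZl m n (a : R) (M N : 'M[quat R]_(m, n)) :
  mdot (realq a *: M) N = a * mdot M N.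
Proof.
rewrite mulr_sumr; apply: eq_bigr => i _; rewrite mulr_sumr.
by apply: eq_bigr => j _; rewrite mxE /qdot /=; ring.
Qed.

Lemma mdotDr m n (M N N' : 'M[quat R]_(m, n)) :
  mdot M (N + N') = mdot M N + mdot M N'.
Proof. by rewrite mdotC mdotDl !(mdotC _ M). Qed.

Lemma mdotZr m n (a : R) (M N : 'M[quat R]_(m, n)) :
  mdot M (realq a *: N) = a * mdot M N.
Proof. by rewrite mdotC mdotZl mdotC. Qed.

Lemma mdotNr m n (M N : 'M[quat R]_(m, n)) : mdot M (- N) = - mdot M N.
Proof. by rewrite mdotC mdotNl mdotC. Qed.

Lemma nsqD m n (M N : 'M[quat R]_(m, n)) :
  nsq (M + N) = nsq M + 2 * mdot M N + nsq N.
Proof. by rewrite !nsqE mdotDl !mdotDr (mdotC N M); ring. Qed.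

Lemma nsqN m n (M : 'M[quat R]_(m, n)) : nsq (- M) = nsq M.
Proof. by rewrite !nsqE mdotNl mdotNr opprK. Qed.

Lemma nsqZ m n (a : R) (M : 'M[quat R]_(m, n)) :
  nsq (realq a *: M) = a ^+ 2 * nsq M.
Proof. by rewrite !nsqE mdotZl mdotZr; ring. Qed.

Lemma mdot_le m n (M N : 'M[quat R]_(m, n)) : mdot M N <= qfrob M * qfrob N.
Proof.
set a := qfrob M; set b := qfrob N.
have a0 : 0 <= a by exact: sqrtr_ge0.
have b0 : 0 <= b by exact: sqrtr_ge0.
have aE : a ^+ 2 = nsq M by exact: qfrob_sqr.
have bE : b ^+ 2 = nsq N by exact: qfrob_sqr.
have [M0|aN0] := eqVneq a 0.
  have -> : M = 0 by apply: nsq_eq0; rewrite -aE M0 expr0n.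
  rewrite M0 mul0r /mdot big1 // => i _; rewrite big1 // => j _.
  by rewrite mxE /qdot /=; lra.
have [N0|bN0] := eqVneq b 0.
  have -> : N = 0 by apply: nsq_eq0; rewrite -bE N0 expr0n.
  rewrite N0 mulr0 /mdot big1 // => i _; rewrite big1 // => j _.
  by rewrite mxE /qdot /=; lra.
have ab0 : 0 < a * b by rewrite mulr_gt0 // lt_neqAle eq_sym ?aN0 ?bN0.
have := nsq_ge0 (realq b *: M - realq a *: N).
rewrite nsqD nsqN !nsqZ mdotNr mdotZl mdotZr -aE -bE => H.
rewrite -(ler_pM2l ab0); nra.
Qed.

Lemma qfrobD m n (M N : 'M[quat R]_(m, n)) : qfrob (M + N) <= qfrob M + qfrob N.
Proof.
rewrite -(@ler_pXn2r _ 2) ?nnegrE ?addr_ge0 ?sqrtr_ge0 //.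
rewrite qfrob_sqr nsqD -!qfrob_sqr.
by have := mdot_le M N; nra.
Qed.

Lemma qfrobN m n (M : 'M[quat R]_(m, n)) : qfrob (- M) = qfrob M.
Proof. by rewrite !qfrobE nsqN. Qed.

Lemma qadjK m n (M : 'M[quat R]_(m, n)) : qadj (qadj M) = M.
Proof. by apply/matrixP => i j; rewrite !mxE conjqK. Qed.

Lemma qadjM m n p (M : 'M[quat R]_(m, n)) (N : 'M[quat R]_(n, p)) :
  qadj (M *m N) = qadj N *m qadj M.
Proof.
apply/matrixP => i j; rewrite !mxE conjq_sum; apply: eq_bigr => k _.
by rewrite !mxE conjqM.
Qed.

Lemma qadj1 n : qadj (1%:M : 'M[quat R]_n) = 1%:M.
Proof.
apply/matrixP => i j; rewrite !mxE eq_sym.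
by case: (i == j); apply: quatP => /=; rewrite ?oppr0.
Qed.

Lemma qadj0 m n : qadj (0 : 'M[quat R]_(m, n)) = 0.
Proof. by apply/matrixP => i j; rewrite !mxE; apply: quatP => /=; rewrite ?oppr0. Qed.

Lemma nsq_adj m n (M : 'M[quat R]_(m, n)) : nsq (qadj M) = nsq M.
Proof.
rewrite /nsq exchange_big; do 2!apply: eq_bigr => ? _.
by rewrite !mxE normsq_conj.
Qed.

Lemma mdot_mulmxl m n p (A : 'M[quat R]_(m, n)) (M : 'M[quat R]_(n, p)) N :
  mdot (A *m M) N = mdot M (qadj A *m N).
Proof.
transitivity (\sum_i \sum_j \sum_k qdot (A i k * M k j) (N i j)).
  do 2!apply: eq_bigr => ? _; rewrite mxE /qdot qw_sum qx_sum qy_sum qz_sum.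
  by rewrite !mulr_suml -!big_split.
transitivity (\sum_k \sum_j \sum_i qdot (A i k * M k j) (N i j)).
  rewrite exchange_big [RHS]exchange_big /=; apply: eq_bigr => j _.
  by rewrite exchange_big.
do 2!apply: eq_bigr => ? _; rewrite mxE /qdot qw_sum qx_sum qy_sum qz_sum.
rewrite !mulr_sumr -!big_split /=; apply: eq_bigr => i _.
by rewrite !mxE /=; ring.
Qed.

Lemma qadj_nsq m n (A : 'M[quat R]_(m, n)) p (M : 'M[quat R]_(n, p)) :
  nsq (A *m M) = mdot M (qadj A *m A *m M).
Proof. by rewrite nsqE mdot_mulmxl mulmxA. Qed.

Lemma nsq_unitary m n p (A : 'M[quat R]_(m, n)) (M : 'M[quat R]_(n, p)) :
  qadj A *m A = 1%:M -> nsq (A *m M) = nsq M.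
Proof. by move=> AA; rewrite qadj_nsq AA mul1mx nsqE. Qed.

Lemma col_mulmx m n p (A : 'M[quat R]_(m, n)) (M : 'M[quat R]_(n, p)) j :
  col j (A *m M) = A *m col j M.
Proof.
by apply/matrixP => i k; rewrite !mxE; apply: eq_bigr => u _; rewrite mxE.
Qed.

Lemma nsq_cols m n (M : 'M[quat R]_(m, n)) : nsq M = \sum_j nsq (col j M).
Proof.
rewrite /nsq exchange_big; apply: eq_bigr => j _; apply: eq_bigr => i _.
by rewrite big_ord1 mxE.
Qed.

Lemma nsq_mulmx_le m n p (A : 'M[quat R]_(m, n)) (M : 'M[quat R]_(n, p)) (c : R) :
  (forall x : 'cV_n, nsq (A *m x) <= c * nsq x) -> nsq (A *m M) <= c * nsq M.
Proof.
move=> Ac; rewrite [nsq M]nsq_cols nsq_cols mulr_sumr; apply: ler_sum => j _.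
by rewrite col_mulmx; exact: Ac.
Qed.

Lemma nsq_mulmxr_le m n p (A : 'M[quat R]_(n, p)) (M : 'M[quat R]_(m, n)) (c : R) :
  (forall x : 'rV_n, nsq (x *m A) <= c * nsq x) -> nsq (M *m A) <= c * nsq M.
Proof.
move=> Ac; rewrite -nsq_adj qadjM -[nsq M]nsq_adj; apply: nsq_mulmx_le => x.
by rewrite -nsq_adj qadjM qadjK -[nsq x]nsq_adj; exact: Ac.
Qed.

Lemma nsq_mul_unitary_adj m n p (A : 'M[quat R]_(p, n)) (M : 'M[quat R]_(m, n)) :
  qadj A *m A = 1%:M -> nsq (M *m qadj A) = nsq M.
Proof.
by move=> AA; rewrite -nsq_adj qadjM qadjK nsq_unitary // nsq_adj.
Qed.

(** The real matrix of x -> S x in the coordinates [qreal]. It gives access to determinants and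
    adjugates, which need commuting entries. *)
Definition qleft m n (S : 'M[quat R]_(m, n)) :
    'M[R]_(m + (m + (m + m)), n + (n + (n + n))) :=
  let A := map_mx (@qw R) S in let B := map_mx (@qx R) S in
  let C := map_mx (@qy R) S in let D := map_mx (@qz R) S in
  col_mx (row_mx A (row_mx (- B) (row_mx (- C) (- D))))
    (col_mx (row_mx B (row_mx A (row_mx (- D) C)))
      (col_mx (row_mx C (row_mx D (row_mx A (- B))))
        (row_mx D (row_mx (- C) (row_mx B A))))).

Lemma qrealM m n p (S : 'M[quat R]_(m, n)) (X : 'M[quat R]_(n, p)) :
  qreal (S *m X) = qleft S *m qreal X.
Proof.
rewrite /qreal /qleft !mul_col_mx !mul_row_col.
congr col_mx; last congr col_mx; last congr col_mx.
- apply/matrixP => i j; rewrite !mxE qw_sum -!big_split.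
  by apply: eq_bigr => k _; rewrite !mxE /=; ring.
- apply/matrixP => i j; rewrite !mxE qx_sum -!big_split.
  by apply: eq_bigr => k _; rewrite !mxE /=; ring.
- apply/matrixP => i j; rewrite !mxE qy_sum -!big_split.
  by apply: eq_bigr => k _; rewrite !mxE /=; ring.
- apply/matrixP => i j; rewrite !mxE qz_sum -!big_split.
  by apply: eq_bigr => k _; rewrite !mxE /=; ring.
Qed.

Definition qofreal m n (V : 'M[R]_(m + (m + (m + m)), n)) : 'M[quat R]_(m, n) :=
  \matrix_(i, j) Quat (usubmx V i j) (usubmx (dsubmx V) i j)
    (usubmx (dsubmx (dsubmx V)) i j) (dsubmx (dsubmx (dsubmx V)) i j).

Lemma qofrealK m n : cancel (@qofreal m n) (@qreal R m n).
Proof.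
move=> V; rewrite /qreal -[RHS]vsubmxK -[dsubmx V in RHS]vsubmxK.
rewrite -[dsubmx (dsubmx V) in RHS]vsubmxK.
by congr col_mx; [|congr col_mx; [|congr col_mx]]; apply/matrixP => i j; rewrite !mxE.
Qed.

Lemma qrealK m n : cancel (@qreal R m n) (@qofreal m n).
Proof.
move=> M; apply/matrixP => i j; rewrite mxE /qreal !col_mxKd !col_mxKu !mxE.
by case: (M i j).
Qed.

Lemma qreal0 m n : qreal (0 : 'M[quat R]_(m, n)) = 0.
Proof.
rewrite /qreal; have E (f : quat R -> R) : f 0 = 0 ->
    map_mx f (0 : 'M[quat R]_(m, n)) = 0.
  by move=> f0; apply/matrixP => i j; rewrite !mxE.
by rewrite !E // !col_mx0.
Qed.

Lemma qleft_unit n (S : 'M[quat R]_n) : qfull_col_rank S -> \det (qleft S) != 0.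
Proof.
move=> injS; rewrite -unitfE -[_ \in _]/(qleft S \in unitmx) -unitmx_tr -row_free_unit.
apply: inj_row_free => v /(congr1 trmx); rewrite trmx_mul trmxK trmx0 => vS.
have : qreal (S *m qofreal v^T) = 0 by rewrite qrealM qofrealK.
rewrite -(qreal0 n 1) => /(can_inj (@qrealK n 1)) /injS /(congr1 (@qreal R n 1)).
by rewrite qofrealK qreal0 => /(congr1 trmx); rewrite trmxK trmx0.
Qed.

(** The real inverse by Cramer's rule, applied to the coordinates of the identity. Being rational in
    the entries, it stays measurable for a random [S]. *)
Definition qinv n (S : 'M[quat R]_n) : 'M[quat R]_n :=
  qofreal ((\det (qleft S))^-1 *: (\adj (qleft S) *m qreal 1%:M)).

Lemma mulmx_qinv n (S : 'M[quat R]_n) : qfull_col_rank S -> S *m qinv S = 1%:M.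
Proof.
move=> injS; apply: (can_inj (@qrealK n n)); rewrite qrealM qofrealK.
rewrite -scalemxAr mulmxA mul_mx_adj mul_scalar_mx scalerA mulVf ?scale1r //.
exact: qleft_unit.
Qed.

Lemma mulqinvmx n (S : 'M[quat R]_n) : qfull_col_rank S -> qinv S *m S = 1%:M.
Proof.
move=> injS; have E : S *m (qinv S *m S - 1%:M) = 0.
  by rewrite mulmxBr mulmxA mulmx_qinv // mul1mx mulmx1 subrr.
apply/eqP; rewrite -subr_eq0; apply/eqP/matrixP => i j.
have : col j (qinv S *m S - 1%:M) = 0.
  by apply: injS; rewrite -col_mulmx E; apply/matrixP => a b; rewrite !mxE.
by move=> /matrixP /(_ i 0); rewrite !mxE.
Qed.

Lemma mulmx_inj m n p (A : 'M[quat R]_(m, n)) (M : 'M[quat R]_(n, p)) :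
  qfull_col_rank A -> A *m M = 0 -> M = 0.
Proof.
move=> injA AM; apply/matrixP => i j.
have : col j M = 0.
  by apply: injA; rewrite -col_mulmx AM; apply/matrixP => a b; rewrite !mxE.
by move=> /matrixP /(_ i 0); rewrite !mxE.
Qed.

Lemma gram_inj m n (A : 'M[quat R]_(m, n)) :
  qfull_col_rank A -> qfull_col_rank (qadj A *m A).
Proof.
move=> injA x Ax; apply: injA; apply: nsq_eq0; rewrite qadj_nsq Ax.
by rewrite /mdot big1 // => i _; rewrite big1 // => j _; rewrite !mxE /qdot /=; ring.
Qed.

Lemma qadj_qinv n (S : 'M[quat R]_n) : qfull_col_rank S -> qadj S = S ->
  qadj (qinv S) = qinv S.
Proof.
move=> injS SS; have E : qadj (qinv S) *m S = 1%:M.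
  by rewrite -{2}SS -qadjM mulmx_qinv // qadj1.
by rewrite -[LHS]mulmx1 -(mulmx_qinv injS) mulmxA E mul1mx.
Qed.

(** With independent columns, (A^* A)^-1 A^* solves the Penrose equations, which excludes the
    default branch of [xget]. *)
Lemma qpinv_exists m n (A : 'M[quat R]_(m, n)) : qfull_col_rank A ->
  is_qpinv A (qpinv A).
Proof.
move=> injA; rewrite /qpinv.
case: xgetP => [N -> //|/(_ (qinv (qadj A *m A) *m qadj A)) []].
have injG := gram_inj injA; set G := qadj A *m A in injG *.
have GG : qadj G = G by rewrite /G qadjM qadjK.
have NA : qinv G *m qadj A *m A = 1%:M by rewrite -mulmxA mulqinvmx.
split.
- by rewrite -mulmxA NA mulmx1.
- by rewrite NA mul1mx.
- by rewrite qadjM qadjM qadjK (qadj_qinv injG GG) mulmxA.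
- by rewrite NA qadj1.
Qed.

Lemma qpinv_left m n (A : 'M[quat R]_(m, n)) : qfull_col_rank A ->
  qpinv A *m A = 1%:M.
Proof.
move=> injA; have [ANA _ _ _] := qpinv_exists injA.
apply/eqP; rewrite -subr_eq0; apply/eqP; apply: (mulmx_inj injA).
by rewrite mulmxBr mulmxA ANA mulmx1 subrr.
Qed.

(** Pythagoras: |M|^2 - |Q M|^2 = |M - Q M|^2 for an orthogonal projection Q. *)
Lemma nsq_proj_le m p (Q : 'M[quat R]_m) (M : 'M[quat R]_(m, p)) :
  Q *m Q = Q -> qadj Q = Q -> nsq (Q *m M) <= nsq M.
Proof.
move=> QQ QE; have : 0 <= nsq (M - Q *m M) by exact: nsq_ge0.
rewrite nsqD nsqN mdotNr (mdotC M) mdot_mulmxl QE.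
by rewrite [nsq (Q *m M)]nsqE mdot_mulmxl QE mulmxA QQ; lra.
Qed.

Lemma nsq_qpinv_le m n p (A : 'M[quat R]_(m, n)) (M : 'M[quat R]_(m, p)) :
  qfull_col_rank A -> nsq (A *m (qpinv A *m M)) <= nsq M.
Proof.
move=> injA; have [ANA NAN ANE _] := qpinv_exists injA.
by rewrite mulmxA; apply: nsq_proj_le => //; rewrite mulmxA ANA.
Qed.

Lemma realqC (a : R) (p : quat R) : p * realq a = realq a * p.
Proof. by apply: quatP => /=; ring. Qed.

Lemma realqM (a b : R) : realq a * realq b = realq (a * b).
Proof. by apply: quatP => /=; ring. Qed.

Lemma scaleqAr m n p (a : R) (A : 'M[quat R]_(m, n)) (B : 'M[quat R]_(n, p)) :
  A *m (realq a *: B) = realq a *: (A *m B).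
Proof.
apply/matrixP => i j; rewrite !mxE mulr_sumr; apply: eq_bigr => k _.
by rewrite !mxE mulrA realqC mulrA.
Qed.

Lemma qadjZ m n (a : R) (A : 'M[quat R]_(m, n)) :
  qadj (realq a *: A) = realq a *: qadj A.
Proof.
apply/matrixP => i j; rewrite !mxE conjqM -realqC; congr (_ * _).
by apply: quatP => /=; rewrite ?oppr0.
Qed.

Lemma gram_col m (v : 'cV[quat R]_m) : qadj v *m v = (realq (nsq v))%:M.
Proof.
apply/matrixP => i j; rewrite !ord1 !mxE mulr1n.
have E k : qadj v 0 k * v k 0 = realq (normsq (v k 0)).
  by rewrite !mxE; apply: quatP => /=; rewrite /normsq; ring.
under eq_bigr do rewrite E.
apply: quatP; rewrite /= ?qw_sum ?qx_sum ?qy_sum ?qz_sum /=; try by rewrite big1.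
by apply: eq_bigr => k _; rewrite big_ord1.
Qed.

(** Gram-Schmidt without a rank assumption: a column dependent on its predecessors yields a zero
    column, so [Q *m qadj Q] still projects onto the range of [Y], and each column adds at most 1 to
    |Q|^2. *)
Lemma orthonormalization m s (Y : 'M[quat R]_(m, s)) :
  exists Q : 'M[quat R]_(m, s),
    [/\ Q *m qadj Q *m Y = Y, exists M, Q = Y *m M & nsq Q <= s%:R].
Proof.
elim: s Y => [|s IH] Y.
  exists Y; split; first by apply/matrixP => i [].
    by exists 1%:M; rewrite mulmx1.
  by rewrite nsq_cols big_ord0.
rewrite -addn1 in Y *.
have [Q [QY [M QM] Qs]] := IH (lsubmx Y).
set Y' := lsubmx Y in QY QM; set y := rsubmx Y.
have QQQ : Q *m qadj Q *m Q = Q by rewrite {3}QM mulmxA QY -QM.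
pose v := y - Q *m qadj Q *m y.
have Qv : qadj Q *m v = 0.
  rewrite /v mulmxBr !mulmxA.
  have -> : qadj Q *m Q *m qadj Q = qadj Q.
    by rewrite -[RHS](congr1 (@qadj R _ _) QQQ) !qadjM qadjK mulmxA.
  by rewrite subrr.
have vQ : qadj v *m Q = 0.
  by rewrite -[qadj v *m Q]qadjK qadjM qadjK Qv qadj0.
have vY' : qadj v *m Y' = 0 by rewrite -QY !mulmxA vQ !mul0mx.
have vy : qadj v *m y = (realq (nsq v))%:M.
  have -> : y = v + Q *m qadj Q *m y by rewrite /v subrK.
  by rewrite mulmxDr !mulmxA vQ !mul0mx addr0 gram_col.
(* For [v] = 0 the convention 1/0 = 0 makes [q] the zero column. *)
pose c := (qfrob v)^-1; pose q := realq c *: v.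
have qqE p (Z : 'M[quat R]_(m, p)) :
    q *m qadj q *m Z = realq (c ^+ 2) *: (v *m (qadj v *m Z)).
  by rewrite /q qadjZ -scalemxAl scaleqAr scalerA realqM -scalemxAl mulmxA.
have qqy : q *m qadj q *m y = v.
  rewrite qqE vy.
  have -> : v *m (realq (nsq v))%:M = realq (nsq v) *: v.
    by rewrite -scalemx1 scaleqAr mulmx1.
  rewrite scalerA realqM /c -qfrob_sqr -exprMn.
  have [v0|v0] := eqVneq (qfrob v) 0.
    have -> : v = 0 by apply: nsq_eq0; rewrite -qfrob_sqr v0 expr0n.
    by rewrite scaler0.
  by rewrite mulVf // expr1n scale1r.
have qqY' : q *m qadj q *m Y' = 0.
  by rewrite qqE vY' mulmx0 scaler0.
have row_mx_gram p1 p2 p3 (A : 'M[quat R]_(m, p1)) (B : 'M[quat R]_(m, p2))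
    (Z : 'M[quat R]_(m, p3)) :
    row_mx A B *m qadj (row_mx A B) *m Z = A *m qadj A *m Z + B *m qadj B *m Z.
  have -> : qadj (row_mx A B) = col_mx (qadj A) (qadj B).
    by rewrite /qadj tr_row_mx map_col_mx.
  by rewrite mul_row_col mulmxDl.
exists (row_mx Q q); split.
- rewrite -[Y]hsubmxK -/Y' -/y row_mx_gram !mul_mx_row QY qqY' qqy.
  by rewrite add_row_mx addr0 /v addrC subrK.
- exists (block_mx M (- (M *m (realq c *: (qadj Q *m y)))) 0 (realq c)%:M).
  rewrite -[Y]hsubmxK -/Y' -/y mul_row_block mulmx0 addr0 -QM; congr row_mx.
  rewrite mulmxN mulmxA -QM -scalemx1 !scaleqAr mulmx1 /q /v scalerBr addrC.
  by rewrite mulmxA.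
- rewrite nsq_cols big_split_ord /= big_ord1 natrD; apply: lerD.
    apply: le_trans Qs; rewrite nsq_cols; apply: ler_sum => j _.
    by rewrite colKl.
  rewrite colKr (_ : col 0 q = q); last by apply/matrixP => i j; rewrite mxE !ord1.
  rewrite /q nsqZ /c -qfrob_sqr -exprMn.
  have [v0|v0] := eqVneq (qfrob v) 0; first by rewrite v0 mulr0 expr0n ler01.
  by rewrite mulVf // expr1n.
Qed.

End quaternion_matrices.

(** * Lower bound on a subspace *)

Section rounding.
Variables (R : realType) (D : finType).
Implicit Types (t : {ffun D -> R}) (z : {ffun D -> int}).

Definition shift_coord t e (u : R) : {ffun D -> R} :=
  [ffun e' => t e' + (if e' == e then u else 0)].

Definition of_int z : {ffun D -> R} := [ffun e => (z e)%:~R].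

Variables (f : {ffun D -> R} -> R) (h : D -> R).
Hypothesis f_quad : forall t e, exists g k, k <= h e /\
  forall u, f (shift_coord t e u) = f t + u * g + u ^+ 2 * k.
Hypothesis h_ge0 : forall e, 0 <= h e.

(* A coordinate is rounded up or down: with the weights making the rounding
   unbiased, the average of the two values of [f] exceeds [f t] by
   [p * (1 - p) * k <= h / 4]. *)
Lemma round_one t e : exists u (n : int),
  [/\ `|u| <= 1, t e + u = n%:~R & f (shift_coord t e u) <= f t + h e / 4].
Proof.
have [g [k [kh fE]]] := f_quad t e.
set n := Num.floor (t e); pose p := t e - n%:~R.
have p0 : 0 <= p by rewrite subr_ge0 floor_le_tmp.
have p1 : p <= 1.
  by rewrite lerBlDl ltW // -[1]/(1%:~R) -intrD; exact: floorD1_gt.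
have he := h_ge0 e.
have [H|H] := leP (f (shift_coord t e (- p))) (f t + h e / 4).
  exists (- p), n; split => //; first by rewrite normrN ger0_norm.
  by rewrite /p; ring.
exists (1 - p), (n + 1); split.
- by rewrite ger0_norm ?subr_ge0 // lerBlDr lerDl.
- by rewrite /p intrD; ring.
move: H; rewrite !fE => H.
have kp : p * (1 - p) * k <= h e / 4.
  have : p * (1 - p) * k <= p * (1 - p) * h e.
    by apply: ler_wpM2l => //; rewrite mulr_ge0 // subr_ge0.
  have : (p * (1 - p)) * h e <= 4^-1 * h e.
    apply: ler_wpM2r => //; have := sqr_ge0 (2 * p - 1); nra.
  lra.
have : (1 - p) * (h e / 4) <= (1 - p) * (- p * g + (- p) ^+ 2 * k).
  by apply: ler_wpM2l; [rewrite subr_ge0|lra].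
move=> H1; have p_gt0 : 0 < p.
  rewrite lt_neqAle p0 andbT; apply/eqP => p00; move: H; rewrite -p00; lra.
rewrite -(ler_pM2l p_gt0); nra.
Qed.

(** [f_quad] holds at every point with the same [h], so the costs of rounding the coordinates one
    after another add up. *)
Lemma round_all t : exists z, (forall e, `|(z e)%:~R - t e| <= 1) /\
  f (of_int z) <= f t + (\sum_e h e) / 4.
Proof.
suff [t' [t't t'int ft']] : exists t', [/\ forall e, `|t' e - t e| <= 1,
    forall e, exists n : int, t' e = n%:~R & f t' <= f t + (\sum_e h e) / 4].
  have [z zE] := choice t'int; exists [ffun e => z e]; split.
    by move=> e; rewrite ffunE -zE.
  suff -> : of_int [ffun e => z e] = t' by [].
  by apply/ffunP => e; rewrite !ffunE.
(* Coordinates outside the processed list stay equal to those of [t], so each one is moved once, by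
   at most 1. *)
have : exists t', [/\ forall e, `|t' e - t e| <= 1,
    forall e, e \notin enum D -> t' e = t e,
    forall e, e \in enum D -> exists n : int, t' e = n%:~R &
    f t' <= f t + (\sum_(e <- enum D) h e) / 4].
  elim: (enum D) (enum_uniq D) => [_|e s IH /= /andP[es us]].
    exists t; split => //; first by move=> e; rewrite subrr normr0.
    by rewrite big_nil mul0r addr0.
  have [t' [t't t's t'int ft']] := IH us.
  have [u [n [u1 uE fu]]] := round_one t' e.
  exists (shift_coord t' e u); split.
  - move=> e'; rewrite ffunE; case: eqP => [->|_]; last by rewrite addr0.
    by rewrite (t's e es) addrC addKr.
  - move=> e'; rewrite inE negb_or => /andP[/negbTE ee' es'].
    by rewrite ffunE ee' addr0 t's.
  - move=> e'; rewrite inE ffunE; case: eqP => [-> _|_ /= es']; first by exists n.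
    by have [n' ->] := t'int _ es'; exists n'; rewrite addr0.
  - by rewrite big_cons; apply: le_trans fu _; lra.
move=> [t' [t't _ t'int]]; rewrite big_enum /= => ft'; exists t'; split => // e.
by apply: t'int; rewrite mem_enum.
Qed.

(** The rounding cost H is fixed while the form scales with c^2: for c = 1 + H / (- f t), c^2 f t <=
    c f t = f t - H, so rounding c t leaves the value at most f t. *)
Lemma round_negative t : (forall c t', f [ffun e => c * t' e] = c ^+ 2 * f t') ->
  f t < 0 -> exists z, f (of_int z) < 0.
Proof.
move=> f_hom ft; set H := (\sum_e h e) / 4.
have H0 : 0 <= H by rewrite divr_ge0 // sumr_ge0.
pose c := 1 + H / - f t.
have [z [_ fz]] := round_all [ffun e => c * t e].
exists z; apply: le_lt_trans fz _; rewrite f_hom -/H.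
have Hf : 0 <= H / - f t by rewrite divr_ge0 // oppr_ge0 ltW.
have c1 : c <= c ^+ 2 by rewrite /c; nra.
have : c ^+ 2 * f t <= c * f t by rewrite ler_nM2r.
have -> : c * f t = f t - H by rewrite /c; field; rewrite lt_eqF.
lra.
Qed.

End rounding.

(** * Counting integer points in a ball *)

Section lattice_points.
Variables (R : realType) (D : finType) (M : nat).

Definition centered (i : 'I_(2 * M).+1) : int := i%:Z - M%:Z.

Lemma sum_gauss_le : \sum_i expR (- ((centered i)%:~R ^+ 2)) <= 3 :> R.
Proof.
pose g (n : nat) : R := 2 ^- n.
have expg (k : int) : expR (- (k%:~R ^+ 2)) <= g `|k|%N :> R.
  rewrite /g expRN lef_pV2 ?posrE ?expR_gt0 ?exprn_gt0 //.
  have e2 : 2 <= expR 1 :> R by apply: le_trans (expR_ge1Dx 1); lra.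
  apply: (@le_trans _ _ (expR 1 ^+ `|k|)).
    by apply: lerXn2r; rewrite ?nnegrE // ltW.
  rewrite -expRM_natl mulr1 ler_expR -(real_normK (num_real k%:~R)).
  rewrite -intr_norm -abszE -[(Posz `|k|)%:~R]/(`|k|%N%:R) -natrX ler_nat.
  by case: absz => // n; rewrite -mulnn leq_pmulr.
have g_sum n : \sum_(i < n) g i = 2 - 2 * g n.
  rewrite /g; elim: n => [|n IH]; first by rewrite big_ord0 expr0 invr1; lra.
  rewrite big_ord_recr /= IH exprS invfM; lra.
have g0 n : 0 <= g n by rewrite /g invr_ge0 exprn_ge0.
apply: le_trans (ler_sum _ (fun i _ => expg (centered i))) _.
rewrite -(big_mkord xpredT (fun i => g `|i%:Z - M%:Z|%N)) /=.
rewrite (@big_cat_nat _ _ _ M) //=; last by rewrite mul2n -addnn -addnS leq_addr.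
have -> : 3 = 1 + 2 :> R by lra.
apply: lerD.
  rewrite big_nat_rev /= add0n big_mkord.
  rewrite (eq_bigr (fun i : 'I_M => 2^-1 * g i)) => [|i _]; last first.
    rewrite /g -invfM -exprS; congr (_ ^- _).
    by rewrite distnEr ?leq_subr // subKn.
  by rewrite -mulr_sumr g_sum; have := g0 M; lra.
rewrite -{1}[M]add0n big_addn big_mkord.
rewrite (eq_bigr (fun i : 'I_((2 * M).+1 - M) => g i)) => [|i _]; last first.
  by congr g; rewrite PoszD addrK.
by rewrite g_sum; have := g0 ((2 * M).+1 - M)%N; lra.
Qed.

(** The exponential Markov inequality for counting: the indicator of |z|^2 <= B is at most exp(B -
    |z|^2), whose sum factors over the coordinates. The bound is uniform in the box size [M]. *)
Lemma lattice_count (B : R) :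
  \sum_(z : {ffun D -> 'I_(2 * M).+1} |
     \sum_e (centered (z e))%:~R ^+ 2 <= B) 1 <= expR B * 3 ^+ #|D| :> R.
Proof.
apply: (@le_trans _ _ (\sum_(z : {ffun D -> 'I_(2 * M).+1})
  expR B * \prod_e expR (- ((centered (z e))%:~R ^+ 2)))).
  rewrite big_mkcond /=; apply: ler_sum => z _; rewrite -expR_sum -expRD sumrN.
  case: ifP => [zB|_]; last exact: expR_ge0.
  by rewrite -[leLHS]expR0 ler_expR subr_ge0.
rewrite -mulr_sumr ler_pM2l ?expR_gt0 //.
rewrite -(bigA_distr_bigA (fun _ i => expR (- ((centered i)%:~R ^+ 2)))) /=.
rewrite -prodr_const; apply: ler_prod => e _.
by rewrite sum_gauss_le andbT sumr_ge0 // => i _; exact: expR_ge0.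
Qed.

End lattice_points.

Lemma sum_pair (V : nmodType) (I J : finType) (F : I * J -> V) :
  \sum_e F e = \sum_a \sum_k F (a, k).
Proof. by rewrite pair_bigA; apply: eq_bigr => -[]. Qed.

(** * Real coordinates of quaternion vectors *)

Section quaternion_coordinates.
Variable R : realType.

Definition qunit (a : 'I_4) : quat R :=
  Quat (a == 0 :> nat)%:R (a == 1 :> nat)%:R (a == 2 :> nat)%:R (a == 3 :> nat)%:R.

Definition qcomp (a : 'I_4) (p : quat R) : R := qdot (qunit a) p.

Lemma qunit_norm a : normsq (qunit a) = 1.
Proof.
case: a => [[|[|[|[|//]]]]] i; rewrite /normsq /=; ring.
Qed.

Lemma sum4 (V : nmodType) (F : 'I_4 -> V) :
  \sum_a F a = F 0 + F 1 + F 2 + F 3.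
Proof.
by rewrite !big_ord_recl big_ord0 addr0 !addrA; do !congr (_ + _); congr F;
  exact: val_inj.
Qed.

Lemma qcomp_norm p : \sum_a qcomp a p ^+ 2 = normsq p.
Proof. by rewrite sum4 /qcomp /qdot /normsq /=; ring. Qed.

Lemma qcomp_sum p : \sum_a realq (qcomp a p) * qunit a = p.
Proof. by rewrite sum4; apply: quatP; rewrite /qcomp /qdot /=; ring. Qed.

Lemma qcompD a p q : qcomp a (p + q) = qcomp a p + qcomp a q.
Proof. by rewrite /qcomp /qdot /=; ring. Qed.

Lemma qcompZ a (c : R) p : qcomp a (realq c * p) = c * qcomp a p.
Proof. by rewrite /qcomp /qdot /=; ring. Qed.

Lemma qcomp0 a : qcomp a 0 = 0.
Proof. by rewrite /qcomp /qdot /=; ring. Qed.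

Lemma qcomp_sumr a I (s : seq I) (F : I -> quat R) :
  qcomp a (\sum_(i <- s) F i) = \sum_(i <- s) qcomp a (F i).
Proof.
elim/big_rec2: _ => [|i y1 y2 _ <-]; [exact: qcomp0|exact: qcompD].
Qed.

Definition qvec s (t : {ffun 'I_4 * 'I_s -> R}) : 'cV[quat R]_s :=
  \col_k \sum_a realq (t (a, k)) * qunit a.

Definition qbase s (e : 'I_4 * 'I_s) : 'cV[quat R]_s :=
  \col_k (if k == e.2 then qunit e.1 else 0).

Definition qcoord s (x : 'cV[quat R]_s) : {ffun 'I_4 * 'I_s -> R} :=
  [ffun e => qcomp e.1 (x e.2 0)].

Lemma qcoordK s : cancel (@qcoord s) (@qvec s).
Proof.
move=> x; apply/matrixP => k j; rewrite ord1 mxE -[RHS]qcomp_sum.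
by apply: eq_bigr => a _; rewrite ffunE.
Qed.

Lemma qvec_shift s (t : {ffun 'I_4 * 'I_s -> R}) e u :
  qvec (shift_coord t e u) = qvec t + realq u *: qbase e.
Proof.
apply/matrixP => k j; rewrite !mxE.
under eq_bigr do rewrite ffunE.
rewrite (eq_bigr (fun a => realq (t (a, k)) * qunit a +
  (if (a, k) == e then realq u * qunit a else 0))) => [|a _]; last first.
  by case: ifP => _; apply: quatP; rewrite /=; ring.
rewrite big_split /=; congr (_ + _); case: e => b k' /=.
case: (eqVneq k k') => [->|kk'].
  rewrite (bigD1 b) //= eqxx big1 ?addr0 // => a ab.
  by rewrite xpair_eqE (negbTE ab).
rewrite mulr0 big1 // => a _; rewrite xpair_eqE (negbTE kk') andbF //.
Qed.

Lemma qvecZ s (t : {ffun 'I_4 * 'I_s -> R}) c :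
  qvec [ffun e => c * t e] = realq c *: qvec t.
Proof.
apply/matrixP => k j; rewrite !mxE mulr_sumr; apply: eq_bigr => a _.
by rewrite ffunE mulrA realqM.
Qed.

Lemma nsq_qvec s (t : {ffun 'I_4 * 'I_s -> R}) : nsq (qvec t) = \sum_e t e ^+ 2.
Proof.
rewrite sum_pair exchange_big.
apply: eq_bigr => k _; rewrite big_ord1 mxE !sum4 /normsq /=; ring.
Qed.

(** The trace of x -> |A x|^2 in real coordinates. Right multiplication by a unit quaternion
    preserves the norm of a column, so each column is counted once per unit. *)
Lemma sum_nsq_qbase m s (A : 'M[quat R]_(m, s)) :
  \sum_e nsq (A *m qbase e) = 4 * nsq A.
Proof.
rewrite sum_pair.
rewrite (eq_bigr (fun=> nsq A)) => [|a _].
  by rewrite sumr_const card_ord mulr_natl.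
rewrite [RHS]nsq_cols; apply: eq_bigr => k _; apply: eq_bigr => i _.
apply: eq_bigr => j _; rewrite !mxE (bigD1 k) //= big1 ?addr0 => [|k' k'k].
  by rewrite !mxE eqxx normsqM qunit_norm mulr1.
by rewrite !mxE (negbTE k'k) mulr0.
Qed.

Lemma nsq_shift m s (A : 'M[quat R]_(m, s)) (t : {ffun 'I_4 * 'I_s -> R}) e u :
  nsq (A *m qvec (shift_coord t e u)) = nsq (A *m qvec t) +
    u * (2 * mdot (A *m qvec t) (A *m qbase e)) + u ^+ 2 * nsq (A *m qbase e).
Proof.
by rewrite qvec_shift mulmxDr scaleqAr nsqD nsqZ mdotZr mulrCA.
Qed.

End quaternion_coordinates.

(** * Rounding for differences of quadratic forms *)

Section forms.
Opaque nsq mdot qvec qbase.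
Variables (R : realType) (l m s : nat).
Variables (A : 'M[quat R]_(l, s)) (Y : 'M[quat R]_(m, s)) (c : R).
Hypothesis c0 : 0 <= c.

Definition form_gap (t : {ffun 'I_4 * 'I_s -> R}) : R :=
  nsq (A *m qvec t) - c * nsq (Y *m qvec t).

(** As c >= 0, the subtracted form only lowers the second-order coefficient: the rounding cost is
    governed by [A] alone, a quarter of the trace 4 |A|^2. *)
Lemma form_gap_quad t e : exists g k, k <= nsq (A *m qbase R e) /\
  forall u, form_gap (shift_coord t e u) = form_gap t + u * g + u ^+ 2 * k.
Proof.
exists (2 * mdot (A *m qvec t) (A *m qbase R e) -
  c * (2 * mdot (Y *m qvec t) (Y *m qbase R e))).
exists (nsq (A *m qbase R e) - c * nsq (Y *m qbase R e)); split.
  by rewrite lerBlDr lerDl mulr_ge0 // nsq_ge0.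
move=> u; have alg (a b p q g k : R) : (a + u * g + u ^+ 2 * k) -
    c * (b + u * p + u ^+ 2 * q) =
    (a - c * b) + u * (g - c * p) + u ^+ 2 * (k - c * q) by ring.
have := congr2 (fun x y => x - c * y) (nsq_shift A t e u) (nsq_shift Y t e u).
by rewrite [in RHS]/=; move=> E; apply: (etrans E); exact: alg.
Qed.

Lemma form_gap_hom a (t : {ffun 'I_4 * 'I_s -> R}) :
  form_gap [ffun e => a * t e] = a ^+ 2 * form_gap t.
Proof. by rewrite /form_gap qvecZ !scaleqAr !nsqZ; ring. Qed.

Lemma form_gap_round (t : {ffun 'I_4 * 'I_s -> R}) :
  exists z : {ffun 'I_4 * 'I_s -> int}, (forall e, `|(z e)%:~R - t e| <= 1) /\
  form_gap (of_int R z) <= form_gap t + nsq A.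
Proof.
have [z [zt fz]] := round_all form_gap_quad (fun e => nsq_ge0 _) t.
exists z; split => //; apply: le_trans fz _.
by rewrite sum_nsq_qbase mulrAC divff ?mul1r.
Qed.

(** A quantifier over real vectors becomes countable, which makes such events measurable. *)
Lemma exists_int_vector : (exists x : 'cV_s, nsq (A *m x) < c * nsq (Y *m x)) <->
  exists z : {ffun 'I_4 * 'I_s -> int},
    nsq (A *m qvec (of_int R z)) < c * nsq (Y *m qvec (of_int R z)).
Proof.
split=> [[x Hx]|[z Hz]]; last by exists (qvec (of_int R z)).
have : form_gap (qcoord x) < 0 by rewrite /form_gap qcoordK subr_lt0.
move=> /(round_negative form_gap_quad (fun e => nsq_ge0 _) form_gap_hom) [z Hz].
by exists z; move: Hz; rewrite /form_gap subr_lt0.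
Qed.

End forms.

Lemma measure_bigsetU_le d (T : measurableType d) (R : realType)
    (P : probability T R) (I : Type) (s : seq I) (Q : pred I) (F : I -> set T) :
  (forall i, measurable (F i)) ->
  (P (\big[setU/set0]_(i <- s | Q i) F i) <= \sum_(i <- s | Q i) P (F i))%E.
Proof.
move=> mF; suff [] : measurable (\big[setU/set0]_(i <- s | Q i) F i) /\
  (P (\big[setU/set0]_(i <- s | Q i) F i) <= \sum_(i <- s | Q i) P (F i))%E by [].
elim/big_rec2: _ => [|i x y _ [my xy]]; first by rewrite measure0.
split; first exact: measurableU.
apply: le_trans (measureU2 P (mF i) my) _; exact: leeD2l.
Qed.

Lemma measurable_le_set d (T : measurableType d) (R : realType) (f g : T -> R) :
  measurable_fun setT f -> measurable_fun setT g ->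
  measurable [set w | f w <= g w].
Proof. by move=> mf mg; rewrite -[X in measurable X]setTI; exact: measurable_fun_le. Qed.

Lemma measurable_lt_set d (T : measurableType d) (R : realType) (f g : T -> R) :
  measurable_fun setT f -> measurable_fun setT g ->
  measurable [set w | f w < g w].
Proof.
move=> mf mg; have -> : [set w | f w < g w] = ~` [set w | g w <= f w].
  by apply/seteqP; split => w /=; [rewrite ltNge => /negP|move/negP; rewrite -ltNge].
by apply: measurableC; exact: measurable_le_set.
Qed.

(** * Random quaternion matrices on fixed matrices and ranges *)

Section random_quaternion_matrix.
Context d (T : measurableType d) (R : realType) (P : probability T R).
Variables (l m : nat) (X : 'I_l * ('I_4 * 'I_m) -> T -> R) (L : R).
Variable u : 'I_4 -> quat R.
Hypothesis mX : forall p, measurable_fun setT (X p).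
Hypothesis indX : independent_rvs P X.
Hypothesis EX : forall p, (\int[P]_w (X p w)%:E = 0)%E.
Hypothesis EX2 : forall p, (\int[P]_w (X p w ^+ 2)%:E = 1)%E.
Hypothesis L0 : 0 < L.
Hypothesis EL : forall p, (\int[P]_w (expR (L * X p w ^+ 2))%:E <= 2%:E)%E.
Hypothesis u_norm : forall a, normsq (u a) = 1.

(** The units [u] are 1, i, j, k for [Psi] and their conjugates for the adjoint of [Omega], so that
    one set of bounds serves both. *)
Definition of_entries (w : T) : 'M[quat R]_(l, m) :=
  \matrix_(i, k) \sum_a realq (X (i, (a, k)) w) * u a.

Local Notation Phi := of_entries.
Let L1 : R := L / (48 * expR 1 ^+ 2).

Let coef p (B : 'M[quat R]_(m, p)) (e : 'I_4 * 'I_p) (j : 'I_4 * 'I_m) : R :=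
  qcomp e.1 (u j.1 * B j.2 e.2).

Let nsq_PhiB p (B : 'M[quat R]_(m, p)) w :
  nsq (Phi w *m B) = total_energy X (coef B) w.
Proof.
apply: eq_bigr => i _; rewrite /energy sum_pair exchange_big.
apply: eq_bigr => e _; rewrite -qcomp_norm; apply: eq_bigr => c _.
congr (_ ^+ 2); rewrite /rowform sum_pair exchange_big mxE qcomp_sumr.
apply: eq_bigr => k _; rewrite mxE mulr_suml qcomp_sumr.
by apply: eq_bigr => a _; rewrite -mulrA qcompZ mulrC.
Qed.

(** Each entry of [B] meets four real random coefficients per row, each carrying a unit quaternion;
    hence the mean 4 l |B|^2. *)
Let coef_norm p (B : 'M[quat R]_(m, p)) :
  4 * nsq B = \sum_e \sum_j coef B e j ^+ 2.
Proof.
rewrite exchange_big sum_pair exchange_big /= /nsq mulr_sumr.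
apply: eq_bigr => k _.
rewrite [RHS](eq_bigr (fun=> \sum_e normsq (B k e))) => [|a _].
  by rewrite sumr_const card_ord mulr_natl.
rewrite sum_pair exchange_big; apply: eq_bigr => e _.
by rewrite /coef /= qcomp_norm normsqM u_norm mul1r.
Qed.

Lemma nsq_of_entries_upper p (B : 'M[quat R]_(m, p)) (t : R) : 0 < nsq B ->
  (P [set w | (l%:R * t * (4 * nsq B) <= nsq (Phi w *m B))%R] <=
   (2 ^+ l * expR (- (l%:R * (L1 * t))))%:E)%E.
Proof.
move=> B0; under eq_set do rewrite nsq_PhiB.
apply: (total_energy_upper mX indX EX EX2 L0 EL (coef_norm B)).
by rewrite mulr_gt0.
Qed.

Lemma nsq_of_entries_lower p (B : 'M[quat R]_(m, p)) : 0 < nsq B ->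
  (P [set w | (nsq (Phi w *m B) <= 2 * l%:R * nsq B)%R] <=
   (expR (- (l%:R * L1 ^+ 2 / 64)))%:E)%E.
Proof.
move=> B0; under eq_set do rewrite nsq_PhiB.
rewrite (_ : [set w | _] =
    [set w | total_energy X (coef B) w <= l%:R * (4 * nsq B) / 2]).
  apply: (total_energy_lower mX indX EX EX2 L0 EL (coef_norm B)).
  by rewrite mulr_gt0.
have -> // : 2 * l%:R * nsq B = l%:R * (4 * nsq B) / 2 by field.
Qed.

Lemma measurable_nsq_of_entries p (B : 'M[quat R]_(m, p)) :
  measurable_fun setT (fun w => nsq (Phi w *m B)).
Proof.
under eq_fun do rewrite nsq_PhiB.
exact: measurable_total_energy.
Qed.

(* The vectors [Y x] are the [Q x'], where the columns of [Q] are orthonormal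
   or zero.  Scale [x'] to squared length [4 s tau] and round it: unless
   [|Phi Q|^2] is large, a violation of the bound yields an integer vector [z]
   with [|z|^2 <= (2 tau + 2) 4 s] for which [|Phi Q z|^2] is at most half of its
   mean [4 l |Q z|^2]. *)
Lemma range_lower_bound s (Y : 'M[quat R]_(m, s)) (tau : R) : 0 < tau ->
  (P [set w | exists x : 'cV_s,
      (nsq (Phi w *m (Y *m x)) < l%:R * nsq (Y *m x))%R] <=
   (expR ((2 * tau + 2) * (4 * s)%:R) * 3 ^+ (4 * s) *
      expR (- (l%:R * L1 ^+ 2 / 64)) +
    2 ^+ l * expR (- (l%:R * (L1 * tau))))%:E)%E.
Proof.
move=> tau0; set bad := [set w | _].
have mbad : measurable bad.
  have -> : bad = \bigcup_(z : {ffun 'I_4 * 'I_s -> int}) [set w |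
      nsq (Phi w *m (Y *m qvec (of_int R z))) <
      l%:R * nsq (Y *m qvec (of_int R z))].
    apply/seteqP; split => w /=.
      move=> [x Hx]; have [|z Hz] := (exists_int_vector (Phi w *m Y) Y (ler0n R l)).1.
        by exists x; rewrite -mulmxA.
      by exists z => //=; rewrite mulmxA.
    by move=> [z _ /= Hz]; exists (qvec (of_int R z)).
  apply: countable_bigcupT_measurable => [|z]; first exact: countableP.
  by apply: measurable_lt_set => //; exact: measurable_nsq_of_entries.
have [Q [QY _ Qs]] := orthonormalization Y.
have [Q0|Q0] := eqVneq (nsq Q) 0.
  have -> : bad = set0.
    apply/seteqP; split => // w [x].
    by rewrite -QY (nsq_eq0 Q0) !mul0mx mulmx0 !nsq0 mulr0 ltxx.
  rewrite measure0 lee_fin addr_ge0 // !mulr_ge0 ?expR_ge0 ?exprn_ge0 //.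
have Q_gt0 : 0 < nsq Q by rewrite lt_neqAle eq_sym Q0 nsq_ge0.
have s0 : (0 < s)%N.
  by case: (s) Q Q0 {QY Qs Q_gt0} => // Q; rewrite nsq_cols big_ord0 eqxx.
have sR0 : 0 < s%:R :> R by rewrite ltr0n.
set B := (2 * tau + 2) * (4 * s)%:R.
have B0 : 0 <= B by rewrite mulr_ge0 ?ler0n //; lra.
(* Integer vectors with |z|^2 <= B have coordinates bounded by [M], so the union bound runs over a
   finite type. *)
pose M := Num.bound B.
have MB : B < M%:R by exact: archi_boundP.
pose Z := {ffun 'I_4 * 'I_s -> 'I_(2 * M).+1}.
pose zi (z : Z) : {ffun 'I_4 * 'I_s -> int} := [ffun e => centered (z e)].
pose v (z : Z) := Q *m qvec (of_int R (zi z)).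
pose E1 := [set w | l%:R * tau * (4 * nsq Q) <= nsq (Phi w *m Q)].
(* For [v z] = 0 the inequality always holds, so the empty set is taken instead; the bound needed at
   such a point is trivial. *)
pose F (z : Z) := if 0 < nsq (v z) then
  [set w | nsq (Phi w *m v z) <= 2 * l%:R * nsq (v z)] else set0.
pose E2 := \big[setU/set0]_(z : Z |
  \sum_e (centered (z e))%:~R ^+ 2 <= B) F z.
have mF z : measurable (F z).
  rewrite /F; case: ifP => // _.
  by apply: measurable_le_set => //; exact: measurable_nsq_of_entries.
have mE1 : measurable E1.
  by apply: measurable_le_set => //; exact: measurable_nsq_of_entries.
have mE2 : measurable E2 by apply: bigsetU_measurable.
have sub : bad `<=` E1 `|` E2.
  move=> w; apply: contraPP => /= /not_orP [/negP]; rewrite -ltNge => wE1 wE2.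
  move=> [x]; apply/negP; rewrite -leNgt; set y := Y *m x.
  have [y0|y_neq0] := eqVneq (nsq y) 0.
    by rewrite y0 mulr0; exact: nsq_ge0.
  have y0 : 0 < nsq y by rewrite lt_neqAle eq_sym y_neq0 nsq_ge0.
  have Qy : Q *m (qadj Q *m y) = y by rewrite /y !mulmxA QY.
  have nQy : nsq (qadj Q *m y) = nsq y by rewrite nsqE mdot_mulmxl qadjK Qy nsqE.
  pose r2 := tau * (4 * s)%:R / nsq y.
  have r20 : 0 < r2 by rewrite divr_gt0 // mulr_gt0 // ltr0n muln_gt0.
  pose r := Num.sqrt r2.
  have rE : r ^+ 2 = r2 by rewrite sqr_sqrtr // ltW.
  pose t := qcoord (realq r *: (qadj Q *m y)).
  have tE : qvec t = realq r *: (qadj Q *m y) by exact: qcoordK.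
  have t2 : \sum_e t e ^+ 2 = tau * (4 * s)%:R.
    by rewrite -nsq_qvec tE nsqZ nQy rE /r2 mulfVK.
  have c0 : 0 <= 2 * l%:R :> R by rewrite mulr_ge0.
  have [z [zt]] := form_gap_round (Phi w *m Q) Q c0 t.
  have z2 : \sum_e ((z e)%:~R : R) ^+ 2 <= B.
    apply: (@le_trans _ _ (\sum_e (2 * t e ^+ 2 + 2))).
      apply: ler_sum => e _; have := zt e; rewrite ler_norml => /andP[z1 z2].
      have : 0 <= (1 + (z e)%:~R - t e) * (1 - (z e)%:~R + t e).
        by apply: mulr_ge0; lra.
      have := sqr_ge0 ((z e)%:~R - 2 * t e); nra.
    rewrite big_split /= -mulr_sumr t2 sumr_const card_prod !card_ord /B.
    by rewrite -mulr_natr; lra.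
  have zM e : (`|z e| <= M)%N.
    rewrite -(ler_nat R); apply: ltW; apply: le_lt_trans MB; apply: le_trans z2.
    rewrite (bigD1 e) //=.
    apply: (@le_trans _ _ (((z e)%:~R : R) ^+ 2)); last first.
      by rewrite lerDl; apply: sumr_ge0 => e' _; exact: sqr_ge0.
    rewrite -(real_normK (num_real (z e)%:~R)) -intr_norm -abszE.
    rewrite -[(Posz `|z e|)%:~R]/(`|z e|%N%:R) -natrX ler_nat.
    by case: absz => // k; rewrite -mulnn leq_pmulr.
  pose z' : Z := [ffun e => inord (absz (z e + M%:Z))].
  have z'E : zi z' = z.
    apply/ffunP => e; rewrite !ffunE /centered.
    have := zM e; case: (z e) => k /=.
      move=> kM; rewrite inordK; last by rewrite mul2n -addnn ltnS leq_add2r.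
      by rewrite PoszD addrK.
    rewrite NegzE => kM.
    have -> : - (k.+1)%:Z + M%:Z = (M - k.+1)%N%:Z by rewrite addrC subzn.
    rewrite inordK /=; last first.
      by rewrite ltnS (leq_trans (leq_subr _ _)) // mul2n -addnn leq_addr.
    by rewrite -subzn // addrAC subrr add0r.
  have : 0 <= form_gap (Phi w *m Q) Q (2 * l%:R) (of_int R z).
    rewrite /form_gap subr_ge0 -mulmxA -z'E -/(v z').
    have [v0|v0] := leP (nsq (v z')) 0.
      have -> : nsq (v z') = 0 by apply/eqP; rewrite eq_le v0 nsq_ge0.
      by rewrite mulr0 nsq_ge0.
    rewrite leNgt; apply/negP => lt_v; apply: wE2.
    rewrite /E2 -bigcup_seq_cond; exists z'.
      rewrite /= mem_index_enum /=; apply: le_trans z2; rewrite -z'E.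
      by apply: ler_sum => e _; rewrite [zi z' e]ffunE.
    by rewrite /F v0 /= ltW.
  move=> /le_trans /[apply].
  rewrite /form_gap tE -mulmxA !scaleqAr !nsqZ rE Qy.
  (* Outside [E1] the rounding cost uses up half of the threshold 2 l r2 |y|^2; dividing by r2
     leaves |Phi y|^2 >= l |y|^2. *)
  have Qbound : nsq (Phi w *m Q) <= l%:R * (r2 * nsq y).
    apply: (le_trans (ltW wE1)); rewrite /r2 mulfVK // -mulrA.
    apply: ler_wpM2l => //; apply: ler_wpM2l; first exact: ltW.
    by rewrite natrM ler_pM2l.
  move=> H; rewrite -(ler_pM2l r20); lra.
apply: (@le_trans _ _ (P (E1 `|` E2))).
  by apply: le_measure; rewrite ?inE //; exact: measurableU.
apply: le_trans (measureU2 P mE1 mE2) _.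
rewrite addeC EFinD; apply: leeD; last exact: nsq_of_entries_upper.
apply: le_trans (measure_bigsetU_le _ _ _ mF) _.
apply: (@le_trans _ _ (\sum_(z : Z | (\sum_e (centered (z e))%:~R ^+ 2 <= B)%R)
    (expR (- (l%:R * L1 ^+ 2 / 64)))%:E)%E).
  apply: lee_sum => z _; rewrite /F; case: ifP => [v0|_].
    exact: nsq_of_entries_lower.
  by rewrite measure0 lee_fin expR_ge0.
rewrite sumEFin lee_fin.
rewrite (eq_bigr (fun=> expR (- (l%:R * L1 ^+ 2 / 64)) * 1)); last first.
  by move=> z _; rewrite mulr1.
rewrite -mulr_sumr mulrC; apply: ler_wpM2r; first exact: expR_ge0.
by have := @lattice_count R ('I_4 * 'I_s)%type M B; rewrite card_prod !card_ord.
Qed.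

End random_quaternion_matrix.

(** * The error for deterministic sketches *)

Lemma sandwich_idempotent (K : pzRingType) s r (X : 'M[K]_(s, r)) (Y : 'M[K]_(r, s))
    (G : 'M[K]_r) :
  G *m (Y *m X) = 1%:M -> X *m G *m Y *m (X *m G *m Y) = X *m G *m Y.
Proof.
move=> GYX; rewrite !mulmxA -[X *m G *m Y *m X]mulmxA.
by rewrite -[X *m G *m (Y *m X)]mulmxA GYX mulmx1.
Qed.

Section deterministic_error.
Opaque nsq mdot.
Variables (R : realType) (m n r s l : nat).
Variables (A : 'M[quat R]_(m, n)) (W : 'M[quat R]_(n, r)).
Hypothesis WW : qadj W *m W = 1%:M.

Definition tail_part : 'M[quat R]_(m, n) := A - A *m W *m qadj W.

(** The pseudoinverse of F = W^* Om when F has full row rank, written with [qinv] so that it is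
    measurable in [Om]. *)
Definition right_inverse (Om : 'M[quat R]_(n, s)) : 'M[quat R]_(s, r) :=
  let F := qadj W *m Om in qadj F *m qinv (F *m qadj F).

Definition residual (Om : 'M[quat R]_(n, s)) : 'M[quat R]_(m, n) :=
  A - A *m Om *m (right_inverse Om *m qadj W).

Lemma residual_bound (Om : 'M[quat R]_(n, s)) (a : R) : (0 < s)%N -> 0 <= a ->
  (forall x : 'cV_r, s%:R * nsq (W *m x) <= nsq (qadj Om *m (W *m x))) ->
  nsq (qadj Om *m qadj tail_part) <= s%:R * a ^+ 2 * nsq (qadj tail_part) ->
  qfrob (residual Om) <= (1 + a) * qfrob tail_part.
Proof.
move=> s0 a0 Om_lower Om_upper; have sR0 : 0 < s%:R :> R by rewrite ltr0n.
set F := qadj W *m Om.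
have F_lower (x : 'cV_r) : s%:R * nsq x <= nsq (qadj F *m x).
  rewrite /F qadjM qadjK -mulmxA -(nsq_unitary x WW); exact: Om_lower.
have injF : qfull_col_rank (qadj F).
  move=> x Fx; apply: nsq_eq0; apply/eqP; rewrite eq_le nsq_ge0 andbT.
  by rewrite -(ler_pM2l sR0) mulr0; apply: le_trans (F_lower x) _; rewrite Fx nsq0.
have injG := gram_inj injF; rewrite qadjK in injG.
set G := F *m qadj F in injG.
have GG : qadj G = G by rewrite /G qadjM qadjK.
have FM : qadj W *m Om *m right_inverse Om = 1%:M.
  by rewrite /right_inverse -/F mulmxA mulmx_qinv.
have resE : residual Om = tail_part - tail_part *m Om *m right_inverse Om *m qadj W.
  rewrite /residual /tail_part !mulmxBl -[A *m W *m _ *m Om]mulmxA.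
  by rewrite -[A *m W *m _ *m right_inverse Om]mulmxA FM mulmx1 opprB addrA subrK !mulmxA.
set B := tail_part in Om_upper resE *.
(* The lower bound for F^* is applied to y^* with y = x G; then y F = x (G F), and G F is an
   orthogonal projection. *)
have row_le (x : 'rV_s) : nsq (x *m right_inverse Om) <= s%:R^-1 * nsq x.
  rewrite -(ler_pM2l sR0) mulrA divff ?gt_eqF // mul1r.
  set y := x *m _.
  have -> : nsq y = nsq (qadj y) by rewrite nsq_adj.
  apply: le_trans (F_lower (qadj y)) _.
  rewrite -qadjM nsq_adj /y /right_inverse -/F -/G -mulmxA.
  set Pr := _ *m F; rewrite -nsq_adj qadjM.
  have PrE : qadj Pr = Pr.
    by rewrite /Pr qadjM qadjM qadjK (qadj_qinv injG GG) mulmxA.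
  rewrite PrE -[leRHS]nsq_adj; apply: nsq_proj_le => //.
  exact/(sandwich_idempotent (mulqinvmx injG)).
have tail_le : nsq (B *m Om *m right_inverse Om *m qadj W) <= a ^+ 2 * nsq B.
  rewrite nsq_mul_unitary_adj //.
  apply: le_trans (nsq_mulmxr_le _ row_le) _.
  rewrite -[nsq (B *m Om)]nsq_adj qadjM mulrC ler_pdivrMr // mulrC mulrA.
  by rewrite -[nsq B]nsq_adj.
rewrite resE; apply: le_trans (qfrobD _ _) _.
rewrite qfrobN mulrDl mul1r lerD2l.
rewrite -(@ler_pXn2r _ 2) ?nnegrE ?mulr_ge0 ?sqrtr_ge0 //.
by rewrite exprMn !qfrob_sqr.
Qed.

Lemma deterministic_error (Om : 'M[quat R]_(n, s)) (Ps : 'M[quat R]_(l, m))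
    (H : 'M[quat R]_(m, s)) (a b : R) :
  (0 < s)%N -> (0 < l)%N -> 0 <= a -> 0 <= b ->
  (forall x : 'cV_r, s%:R * nsq (W *m x) <= nsq (qadj Om *m (W *m x))) ->
  nsq (qadj Om *m qadj tail_part) <= s%:R * a ^+ 2 * nsq (qadj tail_part) ->
  (forall x : 'cV_s, l%:R * nsq (A *m Om *m x) <= nsq (Ps *m (A *m Om *m x))) ->
  nsq (Ps *m residual Om) <= l%:R * b ^+ 2 * nsq (residual Om) ->
  qrange H = qrange (A *m Om) -> qfull_col_rank H ->
  qfrob (H *m (qpinv (Ps *m H) *m (Ps *m A)) - A) <=
    (1 + b) * ((1 + a) * qfrob tail_part).
Proof.
move=> s0 l0 a0 b0 Om_lower Om_upper Ps_lower Ps_upper HY injH.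
have lR0 : 0 < l%:R :> R by rewrite ltr0n.
have H_lower (x : 'cV_s) : l%:R * nsq (H *m x) <= nsq (Ps *m (H *m x)).
  have : qrange H (H *m x) by exists x.
  by rewrite HY => -[x' _ <-]; exact: Ps_lower.
have injPH : qfull_col_rank (Ps *m H).
  move=> x PHx; apply: injH; apply: nsq_eq0; apply/eqP; rewrite eq_le nsq_ge0 andbT.
  rewrite -(ler_pM2l lR0) mulr0; apply: le_trans (H_lower x) _.
  by rewrite mulmxA PHx nsq0.
set N := qpinv (Ps *m H); set E := residual Om in Ps_upper *.
(* The columns of A - E = A Om G W^* lie in the range of A Om, which is that of [H]. *)
have [C CE] : exists C : 'M[quat R]_(s, n), A - E = H *m C.
  have /choice[f fE] j : exists c : 'cV_s, col j (A - E) = H *m c.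
    have : qrange H (col j (A - E)).
      rewrite HY /E /residual opprB addrC subrK col_mulmx.
      by exists (col j (right_inverse Om *m qadj W)).
    by move=> [c _ <-]; exists c.
  exists (\matrix_(i, j) f j i 0); apply/matrixP => i j.
  have /matrixP /(_ i 0) := fE j; rewrite !mxE => ->.
  by apply: eq_bigr => k _; rewrite !mxE.
have errE : H *m (N *m (Ps *m A)) - A = H *m N *m (Ps *m E) - E.
  have NH : N *m (Ps *m H) = 1%:M by exact: qpinv_left.
  have gen (E0 : 'M[quat R]_(m, n)) : A - E0 = H *m C ->
      H *m (N *m (Ps *m A)) - A = H *m N *m (Ps *m E0) - E0.
    move=> AE; have -> : A = H *m C + E0 by rewrite -AE subrK.
    rewrite mulmxDr [Ps *m (H *m C)]mulmxA !mulmxDr [N *m (_ *m C)]mulmxA NH mul1mx.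
    by rewrite opprD addrACA subrr add0r [H *m (N *m _)]mulmxA.
  exact: gen.
(* The lower bound for [Ps] is applied at H N y, and Ps H N is an orthogonal projection. *)
have HN_le : nsq (H *m N *m (Ps *m E)) <= l%:R^-1 * nsq (Ps *m E).
  apply: nsq_mulmx_le => y; rewrite -(ler_pM2l lR0) mulrA divff ?gt_eqF // mul1r.
  rewrite -mulmxA; apply: le_trans (H_lower _) _.
  by rewrite mulmxA; exact: nsq_qpinv_le.
rewrite errE; apply: le_trans (qfrobD _ _) _; rewrite qfrobN.
apply: (@le_trans _ _ ((1 + b) * qfrob E)); last first.
  by apply: ler_wpM2l; [lra|exact: residual_bound].
rewrite mulrDl mul1r addrC lerD2l.
rewrite -(@ler_pXn2r _ 2) ?nnegrE ?mulr_ge0 ?sqrtr_ge0 //.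
rewrite exprMn !qfrob_sqr; apply: le_trans HN_le _.
by rewrite mulrC ler_pdivrMr // mulrC mulrA.
Qed.

End deterministic_error.

(** * Measurability *)

Section measurable_matrices.
Context d (T : measurableType d) (R : realType).

Definition measurable_mx m n (F : T -> 'M[R]_(m, n)) : Prop :=
  forall i j, measurable_fun setT (fun w => F w i j).

Definition measurable_qmx m n (F : T -> 'M[quat R]_(m, n)) : Prop :=
  measurable_mx (fun w => qreal (F w)).

(** 1 / x = x (x^2)^-1 reduces to a power of a nonnegative number; both sides are 0 at 0. *)
Lemma measurable_inv (f : T -> R) : measurable_fun setT f ->
  measurable_fun setT (fun w => (f w)^-1).
Proof.
move=> mf; have -> : (fun w => (f w)^-1) = (fun w => f w * (f w ^+ 2) `^ (-1)).
  apply/funext => w; rewrite powR_inv1 ?sqr_ge0 // expr2.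
  have [->|f0] := eqVneq (f w) 0; first by rewrite invr0 mul0r.
  by rewrite invfM mulrA mulfV // mul1r.
apply: measurable_funM => //; apply: (measurableT_comp (@measurable_powR R (-1))).
exact: measurable_funX.
Qed.

Lemma measurable_mx_cst m n (A : 'M[R]_(m, n)) : measurable_mx (fun=> A).
Proof. by move=> i j; exact: measurable_cst. Qed.

Lemma measurable_mxM m n p (F : T -> 'M[R]_(m, n)) (G : T -> 'M[R]_(n, p)) :
  measurable_mx F -> measurable_mx G -> measurable_mx (fun w => F w *m G w).
Proof.
move=> mF mG i j; under eq_fun do rewrite mxE.
by apply: measurable_sum => k; exact: measurable_funM.
Qed.

Lemma measurable_mxN m n (F : T -> 'M[R]_(m, n)) :
  measurable_mx F -> measurable_mx (fun w => - F w).
Proof.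
by move=> mF i j; under eq_fun do rewrite mxE; exact: measurable_funN.
Qed.

Lemma measurable_mxZ m n (f : T -> R) (F : T -> 'M[R]_(m, n)) :
  measurable_fun setT f -> measurable_mx F ->
  measurable_mx (fun w => f w *: F w).
Proof.
by move=> mf mF i j; under eq_fun do rewrite mxE; exact: measurable_funM.
Qed.

Lemma measurable_col_mx m1 m2 n (F : T -> 'M[R]_(m1, n)) (G : T -> 'M[R]_(m2, n)) :
  measurable_mx F -> measurable_mx G -> measurable_mx (fun w => col_mx (F w) (G w)).
Proof.
move=> mF mG i j; case: (split_ordP i) => k ->.
  by under eq_fun do rewrite col_mxEu; exact: mF.
by under eq_fun do rewrite col_mxEd; exact: mG.
Qed.

Lemma measurable_row_mx m n1 n2 (F : T -> 'M[R]_(m, n1)) (G : T -> 'M[R]_(m, n2)) :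
  measurable_mx F -> measurable_mx G -> measurable_mx (fun w => row_mx (F w) (G w)).
Proof.
move=> mF mG i j; case: (split_ordP j) => k ->.
  by under eq_fun do rewrite row_mxEl; exact: mF.
by under eq_fun do rewrite row_mxEr; exact: mG.
Qed.

Lemma measurable_det n (F : T -> 'M[R]_n) :
  measurable_mx F -> measurable_fun setT (fun w => \det (F w)).
Proof.
move=> mF; rewrite /determinant; apply: measurable_sum => s.
apply: measurable_funM => //; apply: measurable_prod => i _; exact: mF.
Qed.

Lemma measurable_adj n (F : T -> 'M[R]_n) :
  measurable_mx F -> measurable_mx (fun w => \adj (F w)).
Proof.
move=> mF i j; under eq_fun do rewrite mxE /cofactor.
apply: measurable_funM => //; apply: measurable_det => i' j'.
by under eq_fun do rewrite !mxE; exact: mF.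
Qed.

Lemma measurable_qmxP m n (F : T -> 'M[quat R]_(m, n)) : measurable_qmx F <->
  [/\ measurable_mx (fun w => map_mx (@qw R) (F w)),
      measurable_mx (fun w => map_mx (@qx R) (F w)),
      measurable_mx (fun w => map_mx (@qy R) (F w)) &
      measurable_mx (fun w => map_mx (@qz R) (F w))].
Proof.
split=> [mF|[mw mx my mz]]; last by do 3!(apply: measurable_col_mx => //).
split=> i j.
- have := mF (lshift _ i) j; under eq_fun do rewrite col_mxEu; exact.
- have := mF (rshift _ (lshift _ i)) j.
  by under eq_fun do rewrite col_mxEd col_mxEu; exact.
- have := mF (rshift _ (rshift _ (lshift _ i))) j.
  by under eq_fun do rewrite !col_mxEd col_mxEu; exact.
- have := mF (rshift _ (rshift _ (rshift _ i))) j.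
  by under eq_fun do rewrite !col_mxEd; exact.
Qed.

Lemma measurable_qleft m n (F : T -> 'M[quat R]_(m, n)) :
  measurable_qmx F -> measurable_mx (fun w => qleft (F w)).
Proof.
move=> /measurable_qmxP[mw mx my mz].
by repeat (apply: measurable_col_mx || apply: measurable_row_mx ||
  apply: measurable_mxN || assumption).
Qed.

Lemma measurable_qmx_cst m n (A : 'M[quat R]_(m, n)) : measurable_qmx (fun=> A).
Proof. exact: measurable_mx_cst. Qed.

Lemma measurable_qmxM m n p (F : T -> 'M[quat R]_(m, n))
    (G : T -> 'M[quat R]_(n, p)) :
  measurable_qmx F -> measurable_qmx G -> measurable_qmx (fun w => F w *m G w).
Proof.
move=> mF mG; rewrite /measurable_qmx; under eq_fun do rewrite qrealM.
by apply: measurable_mxM => //; exact: measurable_qleft.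
Qed.

Lemma measurable_qmxB m n (F G : T -> 'M[quat R]_(m, n)) :
  measurable_qmx F -> measurable_qmx G -> measurable_qmx (fun w => F w - G w).
Proof.
move=> /measurable_qmxP[Fw Fx Fy Fz] /measurable_qmxP[Gw Gx Gy Gz].
apply/measurable_qmxP; split=> i j; under eq_fun do rewrite !mxE /=;
  apply: measurable_funB.
- by have := Fw i j; under eq_fun do rewrite mxE; exact.
- by have := Gw i j; under eq_fun do rewrite mxE; exact.
- by have := Fx i j; under eq_fun do rewrite mxE; exact.
- by have := Gx i j; under eq_fun do rewrite mxE; exact.
- by have := Fy i j; under eq_fun do rewrite mxE; exact.
- by have := Gy i j; under eq_fun do rewrite mxE; exact.
- by have := Fz i j; under eq_fun do rewrite mxE; exact.
- by have := Gz i j; under eq_fun do rewrite mxE; exact.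
Qed.

Lemma measurable_qadj m n (F : T -> 'M[quat R]_(m, n)) :
  measurable_qmx F -> measurable_qmx (fun w => qadj (F w)).
Proof.
move=> /measurable_qmxP[Fw Fx Fy Fz].
apply/measurable_qmxP; split=> i j; under eq_fun do rewrite !mxE /=.
- by have := Fw j i; under eq_fun do rewrite mxE; exact.
- apply: measurable_funN.
  by have := Fx j i; under eq_fun do rewrite mxE; exact.
- apply: measurable_funN.
  by have := Fy j i; under eq_fun do rewrite mxE; exact.
- apply: measurable_funN.
  by have := Fz j i; under eq_fun do rewrite mxE; exact.
Qed.

Lemma measurable_qinv n (F : T -> 'M[quat R]_n) :
  measurable_qmx F -> measurable_qmx (fun w => qinv (F w)).
Proof.
move=> mF; rewrite /measurable_qmx /qinv; under eq_fun do rewrite qofrealK.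
apply: measurable_mxZ.
  by apply: measurable_inv; apply: measurable_det; exact: measurable_qleft.
apply: measurable_mxM; last exact: measurable_mx_cst.
by apply: measurable_adj; exact: measurable_qleft.
Qed.

Lemma measurable_nsq m n (F : T -> 'M[quat R]_(m, n)) :
  measurable_qmx F -> measurable_fun setT (fun w => nsq (F w)).
Proof.
move=> /measurable_qmxP[Fw Fx Fy Fz]; apply: measurable_sum => i.
apply: measurable_sum => j; rewrite /normsq.
do !apply: measurable_funD; apply: measurable_funX.
- by have := Fw i j; under eq_fun do rewrite mxE; exact.
- by have := Fx i j; under eq_fun do rewrite mxE; exact.
- by have := Fy i j; under eq_fun do rewrite mxE; exact.
- by have := Fz i j; under eq_fun do rewrite mxE; exact.
Qed.

End measurable_matrices.

Lemma measurable_qmx_comp d d' (T : measurableType d) (T' : measurableType d')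
    (R : realType) m n (F : T -> 'M[quat R]_(m, n)) (g : T' -> T) :
  measurable_fun setT g -> measurable_qmx F -> measurable_qmx (F \o g).
Proof. by move=> mg mF i j; apply: measurableT_comp (mF i j) mg. Qed.

(* [exists x] reduces to integer [x], so that the event is a countable union. *)
Lemma measurable_exists_lt d (T : measurableType d) (R : realType) l m s
    (F : T -> 'M[quat R]_(l, s)) (Y : T -> 'M[quat R]_(m, s)) (c : R) :
  0 <= c -> measurable_qmx F -> measurable_qmx Y ->
  measurable [set w | exists x : 'cV_s, nsq (F w *m x) < c * nsq (Y w *m x)].
Proof.
move=> c0 mF mY.
rewrite (_ : [set w | _] = \bigcup_(z : {ffun 'I_4 * 'I_s -> int}) [set w |
    nsq (F w *m qvec (of_int R z)) < c * nsq (Y w *m qvec (of_int R z))]).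
  apply: countable_bigcupT_measurable => [|z]; first exact: countableP.
  apply: measurable_lt_set.
    apply: measurable_nsq; apply: measurable_qmxM => //; exact: measurable_qmx_cst.
  apply: measurable_funM => //.
  apply: measurable_nsq; apply: measurable_qmxM => //; exact: measurable_qmx_cst.
apply/seteqP; split => w /=.
  by move=> /(exists_int_vector (F w) (Y w) c0) [z Hz]; exists z.
by move=> [z _ Hz]; exists (qvec (of_int R z)).
Qed.

(** * Sub-Gaussian quaternion sketches *)

Lemma independent_rvs_inj d (T : measurableType d) (R : realType)
    (P : probability T R) (I I' : finType) (X : I -> T -> R) (h : I' -> I) :
  injective h -> independent_rvs P X -> independent_rvs P (fun i => X (h i)).
Proof.
move=> inj_h indX J B mB.
pose B' i := if [pick j | h j == i] is Some j then B j else setT.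
have B'h j : B' (h j) = B j.
  by rewrite /B'; case: pickP => [k /eqP /inj_h -> //|/(_ j)]; rewrite eqxx.
have mB' i : measurable (B' i) by rewrite /B'; case: pickP.
have := indX (h @: J)%SET B' mB'.
rewrite big_imset /=; last by move=> ? ? _ _; exact: inj_h.
under eq_bigr do rewrite B'h; move=> <-; congr (P _).
apply/seteqP; split => w /= Bw i /= iJ.
  by have /imsetP[j jJ ->] := iJ; rewrite B'h; exact: Bw.
by rewrite -B'h; apply: Bw => /=; exact: imset_f.
Qed.

Section entries.
Variable R : realType.

Fact coord_index_subproof l (a : 'I_4) (i : 'I_l) : (a * l + i < l + (l + (l + l)))%N.
Proof. by have := ltn_ord a; have := ltn_ord i; nia. Qed.

Definition coord_index l (a : 'I_4) (i : 'I_l) : 'I_(l + (l + (l + l))) :=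
  Ordinal (coord_index_subproof a i).

Lemma coord_index_inj l (a b : 'I_4) (i j : 'I_l) :
  coord_index a i = coord_index b j -> a = b /\ i = j.
Proof.
move=> /(congr1 val) /= E; have := ltn_ord i; have := ltn_ord j => jl il.
have l0 : (0 < l)%N by apply: leq_ltn_trans il.
have := congr1 (divn^~ l) E; rewrite /= !divnMDl // !divn_small // !addn0 => ab.
split; apply: val_inj => //=; move: E; rewrite ab; exact: addnI.
Qed.

Lemma qreal_coord_index l m (G : 'M[quat R]_(l, m)) a i k :
  qreal G (coord_index a i) k = qcomp a (G i k).
Proof.
have qcompE : qcomp a (G i k) = nth 0 [:: qw (G i k); qx (G i k); qy (G i k);
    qz (G i k)] a.
  by case: a => [[|[|[|[|//]]]]] ?; rewrite /qcomp /qdot /=; ring.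
rewrite qcompE; case: a {qcompE} => [[|[|[|[|//]]]]] ia /=.
- rewrite (_ : coord_index _ _ = lshift _ i); last by apply: val_inj => /=; lia.
  by rewrite col_mxEu mxE.
- rewrite (_ : coord_index _ _ = rshift _ (lshift _ i)); last first.
    by apply: val_inj => /=; lia.
  by rewrite col_mxEd col_mxEu mxE.
- rewrite (_ : coord_index _ _ = rshift _ (rshift _ (lshift _ i))); last first.
    by apply: val_inj => /=; lia.
  by rewrite !col_mxEd col_mxEu mxE.
- rewrite (_ : coord_index _ _ = rshift _ (rshift _ (rshift _ i))); last first.
    by apply: val_inj => /=; lia.
  by rewrite !col_mxEd mxE.
Qed.

End entries.

Section standardized_matrices.
Context d (T : measurableType d) (R : realType) (P : probability T R).

(** The largest rate that [exp_square_moment] allows for a = 2 K^2, the constant of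
    [psi2_moment]. *)
Definition entry_rate (K : R) : R := (8 * expR 1 * K ^+ 2)^-1.

(** The moment bound with k = 1 compares the unit variance with 2 K^2, which keeps [K] away from
    0. *)
Lemma standardized_entry (xi : T -> R) (K : R) : subgaussian P xi ->
  ('E_P[xi] = 0)%E -> ('V_P[xi] = 1)%E -> psi2_norm P xi = K%:E ->
  [/\ 0 < K, 1 <= 2 * K ^+ 2, (\int[P]_w (xi w)%:E = 0)%E,
    (\int[P]_w (xi w ^+ 2)%:E = 1)%E &
    (\int[P]_w (expR (entry_rate K * xi w ^+ 2))%:E <= 2%:E)%E].
Proof.
move=> [mxi _] E0 V1 xiK.
have I0 : (\int[P]_w (xi w)%:E = 0)%E by move: E0; rewrite unlock.
have I2 : (\int[P]_w (xi w ^+ 2)%:E = 1)%E.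
  rewrite -V1 /variance [in RHS]unlock [in RHS]E0 [in RHS]unlock.
  apply: eq_integral => w _; congr EFin.
  by rewrite -[in LHS](subr0 (xi w)) expr2.
have [K0 H1] := psi2_moment mxi xiK (ltn0Sn 0).
have K2 : 1 <= 2 * K ^+ 2.
  by move: H1; rewrite muln1 I2 lee_fin mulr1 expr1.
have K_gt0 : 0 < K.
  rewrite lt_neqAle K0 andbT; apply/eqP => K00; move: K2; rewrite -K00 expr0n mulr0; lra.
split => //; have e0 := expR_gt0 (1 : R); have K2_gt0 : 0 < K ^+ 2 by rewrite exprn_gt0.
apply: (@exp_square_moment _ _ _ _ _ (2 * K ^+ 2)) => //.
- by rewrite mulr_ge0 // sqr_ge0.
- by rewrite invr_ge0 !mulr_ge0 // ltW.
- rewrite le_eqVlt; apply/orP; left; apply/eqP.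
  by rewrite /entry_rate; field; rewrite !gt_eqF.
- move=> k k0; have [_ /le_trans] := psi2_moment mxi xiK k0; apply.
  rewrite lee_fin ler_peMl ?ler1n //.
  by rewrite exprn_ge0 // !mulr_ge0 // sqr_ge0.
Qed.

Definition std_subgaussian_mx l m (K : R) (Phi : T -> 'M[quat R]_(l, m)) : Prop :=
  exists (X : 'I_l * ('I_4 * 'I_m) -> T -> R) (u : 'I_4 -> quat R),
  [/\ forall p, measurable_fun setT (X p), independent_rvs P X,
      forall p, [/\ (\int[P]_w (X p w)%:E = 0)%E, (\int[P]_w (X p w ^+ 2)%:E = 1)%E &
        (\int[P]_w (expR (entry_rate K * X p w ^+ 2))%:E <= 2%:E)%E],
      forall a, normsq (u a) = 1 & forall w, Phi w = of_entries X u w].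

Lemma std_qsubgaussian l m (K : R) (Psi : T -> 'M[quat R]_(l, m)) :
  qsubgaussian P Psi -> qstandardized P Psi ->
  (forall ij, psi2_norm P (qentries Psi ij) = K%:E) -> std_subgaussian_mx K Psi.
Proof.
move=> [sPsi iPsi] stPsi PsiK.
pose h (p : 'I_l * ('I_4 * 'I_m)) := (coord_index p.2.1 p.1, p.2.2).
exists (fun p => qentries Psi (h p)), (qunit R); split.
- by move=> p; have [] := sPsi (h p).
- apply: independent_rvs_inj iPsi => -[i [a k]] [j [b k']].
  by rewrite /h /= => -[E ->]; have [|-> ->] :=
    @coord_index_inj l a b i j; first exact: val_inj.
- move=> p; have [E0 V1] := stPsi (h p).
  by have [] := standardized_entry (sPsi (h p)) E0 V1 (PsiK (h p)).
- exact: qunit_norm.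
- move=> w; apply/matrixP => i k; rewrite mxE -[LHS]qcomp_sum.
  by apply: eq_bigr => a _; rewrite /qentries qreal_coord_index.
Qed.

Lemma std_qsubgaussian_adj l m (K : R) (Om : T -> 'M[quat R]_(m, l)) :
  qsubgaussian P Om -> qstandardized P Om ->
  (forall ij, psi2_norm P (qentries Om ij) = K%:E) ->
  std_subgaussian_mx K (fun w => qadj (Om w)).
Proof.
move=> [sOm iOm] stOm OmK.
pose h (p : 'I_l * ('I_4 * 'I_m)) := (coord_index p.2.1 p.2.2, p.1).
exists (fun p => qentries Om (h p)), (fun a => conjq (qunit R a)); split.
- by move=> p; have [] := sOm (h p).
- apply: independent_rvs_inj iOm => -[i [a k]] [j [b k']].
  by rewrite /h /= => -[E ->]; have [|-> ->] :=
    @coord_index_inj m a b k k'; first exact: val_inj.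
- move=> p; have [E0 V1] := stOm (h p).
  by have [] := standardized_entry (sOm (h p)) E0 V1 (OmK (h p)).
- by move=> a; rewrite normsq_conj qunit_norm.
- move=> w; apply/matrixP => i k; rewrite !mxE -[Om w k i]qcomp_sum conjq_sum.
  apply: eq_bigr => a _; rewrite /qentries qreal_coord_index conjqM -realqC.
  by congr (_ * _); apply: quatP => /=; rewrite ?oppr0.
Qed.

(* [kap / K ^+ 2] is [entry_rate K / (48 e ^+ 2)], the rate of the squares of
   linear forms in the entries. *)
Definition kap : R := (8 * 48 * expR 1 ^+ 3)^-1.

(* Chosen so that [l >= range_const K * s] makes the entropy
   [(16 / L1 + 16) s] of the integer points at most [l L1 ^+ 2 / 128]. *)
Definition range_const (K : R) : R :=
  let L1 := kap / K ^+ 2 in 1 + 32 * 64 * (L1^-1 + 1) / L1 ^+ 2.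

Lemma kap_gt0 : 0 < kap.
Proof. by rewrite invr_gt0 !mulr_gt0 ?exprn_gt0 ?expR_gt0 ?ltr0n. Qed.

Lemma range_const_gt0 K : 0 < range_const K.
Proof.
have k0 := kap_gt0.
have L0 : 0 <= kap / K ^+ 2 by rewrite divr_ge0 ?sqr_ge0 // ltW.
rewrite /range_const; apply: ltr_pwDl => //.
apply: divr_ge0; last exact: sqr_ge0.
apply: mulr_ge0; first by rewrite -natrM ler0n.
by rewrite addr_ge0 // invr_ge0.
Qed.

Lemma entry_rateE K : 0 < K -> entry_rate K / (48 * expR 1 ^+ 2) = kap / K ^+ 2.
Proof.
move=> K0; rewrite /entry_rate /kap; field.
by rewrite !gt_eqF // expR_gt0.
Qed.

(** The Chernoff exponent per row is 2 lam: one lam beats the factor 2 <= e, the other gives e^-lam.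
    The mean 4 l |B|^2 contributes a further 4, whence [kap / 4]. *)
Lemma std_upper l m p (K lam : R) (Phi : T -> 'M[quat R]_(l, m))
    (B : 'M[quat R]_(m, p)) :
  std_subgaussian_mx K Phi -> 0 < K -> (0 < l)%N -> 1 <= lam -> 0 < nsq B ->
  (P [set w | (l%:R * (K ^+ 2 * (2 * lam / (kap / 4))) * nsq B <=
      nsq (Phi w *m B))%R] <= (expR (- lam))%:E)%E.
Proof.
move=> [X [u [mX indX EX u1 PhiE]]] K0 l0 lam1 B0.
under eq_set do rewrite PhiE.
have kap0 := kap_gt0.
have L0 : 0 < entry_rate K.
  by rewrite invr_gt0 !mulr_gt0 ?expR_gt0 ?exprn_gt0.
pose t := K ^+ 2 * (2 * lam / (kap / 4)) / 4.
have := nsq_of_entries_upper mX indX (fun p => let: And3 E _ _ := EX p in E)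
  (fun p => let: And3 _ E _ := EX p in E) L0 (fun p => let: And3 _ _ E := EX p in E)
  u1 t B0.
have -> : [set w | l%:R * t * (4 * nsq B) <= nsq (of_entries X u w *m B)] =
    [set w | l%:R * (K ^+ 2 * (2 * lam / (kap / 4))) * nsq B <=
      nsq (of_entries X u w *m B)].
  by congr mkset; apply/funext => w; congr (is_true (_ <= _)); rewrite /t; field;
    rewrite gt_eqF.
move=> /le_trans; apply; rewrite lee_fin entry_rateE //.
have -> : kap / K ^+ 2 * t = 2 * lam by rewrite /t; field; rewrite !gt_eqF.
have l1 : 1 <= l%:R :> R by rewrite ler1n.
have e2 : 2 <= expR 1 :> R by apply: le_trans (expR_ge1Dx 1); lra.
apply: (@le_trans _ _ (expR 1 ^+ l * expR (- (l%:R * (2 * lam))))).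
  by apply: ler_wpM2r; rewrite ?expR_ge0 // lerXn2r ?nnegrE // expR_ge0.
rewrite -expRM_natl mulr1 -expRD ler_expR; nra.
Qed.

(** The gap gives t^2 <= l and C s <= l. The first turns an exponent proportional to l into one in
    t^2; the second makes the entropy of the integer points at most half of l L1^2 / 64. *)
Lemma std_range_lower l m s (K t : R) (Phi : T -> 'M[quat R]_(l, m))
    (Y : 'M[quat R]_(m, s)) :
  std_subgaussian_mx K Phi -> 0 < K -> 1 <= 2 * K ^+ 2 -> 0 < t ->
  0 < Num.sqrt l%:R - range_const K * Num.sqrt s%:R - t ->
  (P [set w | exists x : 'cV_s,
      (nsq (Phi w *m (Y *m x)) < l%:R * nsq (Y *m x))%R] <=
   (2 * expR (- (4 * (kap ^+ 2 / (8 * 64)) * t ^+ 2 / K ^+ 4)))%:E)%E.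
Proof.
move=> [X [u [mX indX EX u1 PhiE]]] K0 K1 t0 lst.
under eq_set do rewrite PhiE.
have kap0 := kap_gt0.
have L0 : 0 < entry_rate K.
  by rewrite invr_gt0 !mulr_gt0 ?expR_gt0 ?exprn_gt0.
set L1 := kap / K ^+ 2; have L10 : 0 < L1 by rewrite divr_gt0 ?exprn_gt0.
have e2 : 2 <= expR 1 :> R by apply: le_trans (expR_ge1Dx 1); lra.
(* Unit variance gives kap <= 1/2 <= K^2. It lets the upper tail, of exponent l, be absorbed in l
   L1^2 / 128. *)
have L1_le1 : L1 <= 1.
  rewrite ler_pdivrMr ?exprn_gt0 // mul1r.
  suff : kap <= 2^-1 by lra.
  rewrite lef_pV2 ?posrE ?mulr_gt0 ?exprn_gt0 ?expR_gt0 //.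
  have : 1 <= expR 1 ^+ 3 :> R by apply: exprn_ege1; lra.
  lra.
(* With tau = 2 / L1 the upper tail is 2^l e^(-2 l) <= e^-l. *)
have tau0 : 0 < 2 / L1 by rewrite divr_gt0.
have := range_lower_bound mX indX (fun p => let: And3 E _ _ := EX p in E)
  (fun p => let: And3 _ E _ := EX p in E) L0 (fun p => let: And3 _ _ E := EX p in E)
  u1 Y tau0.
move=> /le_trans; apply; rewrite lee_fin entry_rateE // -/L1.
move: lst; set C := range_const K => lst; have C0 : 0 < C by exact: range_const_gt0.
have C1 : 1 <= C.
  rewrite /C /range_const -/L1 lerDl; apply: divr_ge0; last exact: sqr_ge0.
  apply: mulr_ge0; first by rewrite -natrM ler0n.
  by rewrite addr_ge0 // invr_ge0 ltW.
have sl0 : 0 <= Num.sqrt l%:R :> R by exact: sqrtr_ge0.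
have ss0 : 0 <= Num.sqrt s%:R :> R by exact: sqrtr_ge0.
have lE : Num.sqrt l%:R ^+ 2 = l%:R :> R by rewrite sqr_sqrtr.
have sE : Num.sqrt s%:R ^+ 2 = s%:R :> R by rewrite sqr_sqrtr.
have tl : t ^+ 2 <= l%:R.
  rewrite -lE lerXn2r ?nnegrE ?(ltW t0) //.
  have : 0 <= C * Num.sqrt s%:R by rewrite mulr_ge0 // ltW.
  lra.
have sl : C * s%:R <= l%:R.
  have : (C * Num.sqrt s%:R) ^+ 2 <= l%:R.
    rewrite -lE lerXn2r ?nnegrE ?mulr_ge0 ?(ltW C0) //; lra.
  rewrite exprMn sE => h; apply: le_trans h; apply: ler_wpM2r => //.
  by rewrite expr2 ler_peMl // ltW.
have sl2 : (16 / L1 + 16) * s%:R <= l%:R * L1 ^+ 2 / (2 * 64).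
  have sR0 : 0 <= s%:R :> R by [].
  have : 32 * 64 * (L1^-1 + 1) / L1 ^+ 2 * s%:R <= l%:R.
    by move: sl; rewrite /C /range_const -/L1 mulrDl mul1r; lra.
  rewrite mulrAC ler_pdivrMr ?exprn_gt0 //; lra.
have rate : l%:R * L1 ^+ 2 / (2 * 64) >= 4 * (kap ^+ 2 / (8 * 64)) * t ^+ 2 / K ^+ 4.
  have -> : 4 * (kap ^+ 2 / (8 * 64)) * t ^+ 2 / K ^+ 4 = t ^+ 2 * (L1 ^+ 2 / (2 * 64)).
    by rewrite /L1; field; rewrite gt_eqF.
  rewrite -mulrA; apply: ler_wpM2r => //.
  by apply: divr_ge0; [exact: sqr_ge0|rewrite -natrM ler0n].
set rhs := expR (- (4 * _ * _ / _)).
have rhs_le : expR (- (l%:R * L1 ^+ 2 / (2 * 64))) <= rhs by rewrite ler_expR lerN2.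
suff [h1 h2] : expR ((2 * (2 / L1) + 2) * (4 * s)%:R) * 3 ^+ (4 * s) *
    expR (- (l%:R * L1 ^+ 2 / 64)) <= rhs /\
    2 ^+ l * expR (- (l%:R * (L1 * (2 / L1)))) <= rhs by lra.
split; apply: le_trans rhs_le.
  (* Since 3 <= e^2, the factor 3^(4 s) costs 8 s, for a total entropy of (16 / L1 + 16) s. *)
  apply: (@le_trans _ _ (expR ((2 * (2 / L1) + 2) * (4 * s)%:R) *
    expR 2 ^+ (4 * s) * expR (- (l%:R * L1 ^+ 2 / 64)))).
    apply: ler_wpM2r; first exact: expR_ge0.
    apply: ler_wpM2l; first exact: expR_ge0.
    rewrite lerXn2r ?nnegrE ?expR_ge0 //.
    by apply: le_trans (expR_ge1Dx 2); lra.
  rewrite -expRM_natl -!expRD ler_expR natrM; lra.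
apply: (@le_trans _ _ (expR 1 ^+ l * expR (- (l%:R * (L1 * (2 / L1)))))).
  by apply: ler_wpM2r; rewrite ?expR_ge0 // lerXn2r ?nnegrE ?expR_ge0.
rewrite -expRM_natl mulr1 -expRD ler_expR [L1 * _]mulrCA divff ?gt_eqF //.
have : l%:R * L1 ^+ 2 <= l%:R by rewrite ler_piMr // exprn_ile1 // ltW.
have : 0 <= l%:R :> R by []; lra.
Qed.

End standardized_matrices.

(** * The tail of the singular value decomposition *)

Section svd_tail.
Variable R : realType.

(** Right multiplication of [V] by this matrix selects the r leading right singular vectors. *)
Definition first_columns n r : 'M[quat R]_(n, r) :=
  \matrix_(i < n, j < r) (if i == j :> nat then 1 else 0).

Lemma first_columns_gram n r : (r <= n)%N ->
  qadj (first_columns n r) *m first_columns n r = 1%:M.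
Proof.
move=> rn; apply/matrixP => i j; rewrite !mxE (bigD1 (widen_ord rn i)) //= !mxE /= eqxx.
rewrite big1 ?addr0 => [|k ki].
  rewrite (_ : conjq 1 = 1) ?mul1r; last by apply: quatP => /=; rewrite ?oppr0.
  by rewrite [in RHS](_ : (i == j) = (i == j :> nat)) //; case: eqP.
rewrite !mxE; move: ki; rewrite -val_eqE /= => /negbTE ->.
by rewrite (_ : conjq 0 = 0) ?mul0r //; apply: quatP => /=; rewrite ?oppr0.
Qed.

Lemma first_columns_proj n r (i j : 'I_n) :
  (first_columns n r *m qadj (first_columns n r)) i j =
  if (i == j) && (i < r)%N then 1 else 0.
Proof.
rewrite !mxE; case: (ltnP i r) => [ir|ri]; rewrite ?andbT ?andbF.
  rewrite (bigD1 (Ordinal ir)) //= !mxE /= eqxx mul1r big1 ?addr0 => [|k ki].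
    rewrite -val_eqE /= eq_sym; case: ifP => _; apply: quatP => /=; rewrite ?oppr0 //.
  rewrite !mxE; move: ki; rewrite -val_eqE /= eq_sym => /negbTE ->.
  by rewrite mul0r.
rewrite big1 // => k _; rewrite !mxE.
by rewrite (_ : (i == k :> nat) = false) ?mul0r //; have := ltn_ord k; lia.
Qed.

Lemma tail_part_svd m n r (U : 'M[quat R]_m) (D : 'M[quat R]_(m, n))
    (V : 'M[quat R]_n) (J : 'M[quat R]_(n, r)) : qadj V *m V = 1%:M ->
  tail_part (U *m D *m qadj V) (V *m J) =
  U *m ((D - D *m (J *m qadj J)) *m qadj V).
Proof.
move=> V1; have -> : (D - D *m (J *m qadj J)) *m qadj V =
    D *m qadj V - D *m J *m qadj J *m qadj V by rewrite mulmxBl mulmxA.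
rewrite mulmxBr /tail_part qadjM; congr (_ - _); first by rewrite mulmxA.
have -> : U *m D *m qadj V *m (V *m J) = U *m D *m J.
  by rewrite mulmxA -[U *m D *m qadj V *m V]mulmxA V1 mulmx1.
by rewrite !mulmxA.
Qed.

Lemma svd_tail_part m n r (A : 'M[quat R]_(m, n)) (U : 'M[quat R]_m)
    (sigma : nat -> R) (V : 'M[quat R]_n) : (r <= n)%N -> is_qsvd A U sigma V ->
  exists2 W : 'M[quat R]_(n, r), qadj W *m W = 1%:M &
    qfrob (tail_part A W) = frob_Sigma2 m n r sigma.
Proof.
move=> rn [[U1 _] [V1 V2] _ ->]; set D := \matrix_(_, _) _.
set J := first_columns n r; exists (V *m J).
  by rewrite qadjM -mulmxA [qadj V *m _]mulmxA V1 mul1mx first_columns_gram.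
rewrite /frob_Sigma2 qfrobE; congr Num.sqrt.
have -> : tail_part (U *m D *m qadj V) (V *m J) =
    U *m ((D - D *m (J *m qadj J)) *m qadj V).
  exact: tail_part_svd.
rewrite nsq_unitary // nsq_mul_unitary_adj //.
have ent i j : (D - D *m (J *m qadj J)) i j =
    if (i == j :> nat) && (r <= j)%N then realq (sigma i) else 0.
  have -> : (D - D *m (J *m qadj J)) i j =
      D i j - \sum_k D i k * (J *m qadj J) k j by rewrite !mxE.
  rewrite (bigD1 j) //= big1 ?addr0 => [|k kj].
    rewrite first_columns_proj eqxx /= mxE.
    case: eqP => _ /=; last by rewrite mul0r subrr.
    by case: ltnP => _; rewrite ?mulr1 ?mulr0 ?subrr ?subr0.
  by rewrite first_columns_proj (negbTE kj) mulr0.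
transitivity (\sum_(i < m) \sum_(j < n)
    (if (i == j :> nat) && (r <= j)%N then sigma i ^+ 2 else 0)).
  apply: eq_bigr => i _; apply: eq_bigr => j _; rewrite ent.
  by case: ifP => _; rewrite /normsq /= ?expr0n /= ?addr0.
transitivity (\sum_(i < m | (i < n)%N && (r <= i)%N) sigma i ^+ 2).
  rewrite [RHS]big_mkcond; apply: eq_bigr => i _.
  case: (ltnP i n) => [i_n|ni] /=.
    rewrite (bigD1 (Ordinal i_n)) //= eqxx /= big1 ?addr0 // => j ji.
    by move: ji; rewrite -val_eqE /= eq_sym => /negbTE ->.
  by rewrite big1 // => j _; case: eqP => //= ij; have := ltn_ord j; lia.
rewrite -(big_mkord (fun i => (i < n)%N && (r <= i)%N) (fun i => sigma i ^+ 2)).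
rewrite (big_nat_widen r (minn m n) m) ?geq_minl //.
rewrite [RHS](big_nat_widenl r 0) //.
by apply: congr_big_nat => // i /andP[_ im]; rewrite andTb leq_min im.
Qed.

End svd_tail.

(** * Conditioning on one of two independent matrices *)

Section independent_matrices.
Context d (T : measurableType d) (R : realType) (P : probability T R).

Definition entry_events m n (F : T -> 'M[quat R]_(m, n)) : set (set T) :=
  [set E | exists i (B : set R), measurable B /\ E = qentries F i @^-1` B].

(* On this copy of the sample space [F] is measurable with respect to its own
   entries, so that independence of [F] and [G] is a product law on
   [entries_type F * entries_type G]. *)
Definition entries_type m n (F : T -> 'M[quat R]_(m, n)) :=
  g_sigma_algebraType (entry_events F).

Lemma measurable_to_entries m n (F : T -> 'M[quat R]_(m, n)) :
  measurable_qmx F -> measurable_fun [set: T] (id : T -> entries_type F).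
Proof.
move=> mF _ B sB; rewrite setTI; apply: (smallest_sub _ _ sB).
  exact: sigma_algebra_measurable.
by move=> _ [[i j] [C [mC ->]]]; rewrite -[X in measurable X]setTI; exact: mF.
Qed.

Lemma measurable_entries m n (F : T -> 'M[quat R]_(m, n)) :
  measurable_qmx (F : entries_type F -> _).
Proof.
move=> i j _ B mB; rewrite setTI; apply: sub_sigma_algebra.
by exists (i, j), B.
Qed.

(** Independence is known for events generated by entries, so [bad] has to be measurable on the
    product of the two entry sigma-algebras. Freezing [F] at M leaves a bound for a fixed matrix. *)
Lemma ind_entries_section_le m n p q (F : T -> 'M[quat R]_(m, n))
    (G : T -> 'M[quat R]_(p, q)) (bad : 'M[quat R]_(m, n) -> 'M[quat R]_(p, q) -> Prop)
    (e : \bar R) :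
  measurable_qmx F -> measurable_qmx G ->
  independent_families P (qentries F) (qentries G) ->
  measurable [set z : entries_type F * entries_type G | bad (F z.1) (G z.2)] ->
  (forall M, P [set w | bad M (G w)] <= e)%E -> (P [set w | bad (F w) (G w)] <= e)%E.
Proof.
move=> mF mG FG mA le_e.
pose X1 := mfun_Sub (mem_set (measurable_to_entries mF)).
pose X2 := mfun_Sub (mem_set (measurable_to_entries mG)).
have ind12 A B : measurable A -> measurable B ->
  P (X1 @^-1` A `&` X2 @^-1` B) = (P (X1 @^-1` A) * P (X2 @^-1` B))%E by exact: FG.
have sections w : (P [set v | bad (F (X1 w)) (G (X2 v))] <= e)%E by exact: le_e.
exact: (ind_section_le ind12 mA sections).
Qed.

End independent_matrices.

(** * The bad events *)

Section failure_probability.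
Context d (T : measurableType d) (R : realType) (P : probability T R).

Lemma measurable_residual m n r s d' (T' : measurableType d')
    (A : 'M[quat R]_(m, n)) (W : 'M[quat R]_(n, r)) (Om : T' -> 'M[quat R]_(n, s)) :
  measurable_qmx Om -> measurable_qmx (fun z => residual A W (Om z)).
Proof.
move=> mOm; apply: measurable_qmxB; first exact: measurable_qmx_cst.
apply: measurable_qmxM.
  by apply: measurable_qmxM => //; exact: measurable_qmx_cst.
have mF : measurable_qmx (fun z => qadj W *m Om z).
  by apply: measurable_qmxM => //; exact: measurable_qmx_cst.
apply: measurable_qmxM; last exact: measurable_qmx_cst.
apply: measurable_qmxM; first exact: measurable_qadj.
by apply: measurable_qinv; apply: measurable_qmxM => //; exact: measurable_qadj.
Qed.

Definition low m n s (F : 'M[quat R]_(m, n)) (Y : 'M[quat R]_(n, s)) : Prop :=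
  exists x : 'cV_s, nsq (F *m (Y *m x)) < m%:R * nsq (Y *m x).

(** The condition 0 < |B|^2 matters: for B = 0 the inequality always holds, and the event would be
    the whole space although the upper bound sought is then trivial. *)
Definition high m n s (a : R) (F : 'M[quat R]_(m, n)) (B : 'M[quat R]_(n, s)) : Prop :=
  0 < nsq B /\ m%:R * a * nsq B <= nsq (F *m B).

Lemma measurable_low m n s d' (T' : measurableType d')
    (F : T' -> 'M[quat R]_(m, n)) (Y : T' -> 'M[quat R]_(n, s)) :
  measurable_qmx F -> measurable_qmx Y -> measurable [set z | low (F z) (Y z)].
Proof.
move=> mF mY; rewrite /low; under eq_set do under eq_exists do rewrite mulmxA.
by apply: measurable_exists_lt => //; exact: measurable_qmxM.
Qed.

Lemma measurable_high m n s a d' (T' : measurableType d')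
    (F : T' -> 'M[quat R]_(m, n)) (B : T' -> 'M[quat R]_(n, s)) :
  measurable_qmx F -> measurable_qmx B -> measurable [set z | high a (F z) (B z)].
Proof.
move=> mF mB; apply: (@measurableI _ _ [set z | 0 < nsq (B z)]).
  by apply: measurable_lt_set => //; exact: measurable_nsq.
apply: measurable_le_set.
  by apply: measurable_funM => //; exact: measurable_nsq.
by apply: measurable_nsq; exact: measurable_qmxM.
Qed.

Lemma std_high l m p (K lam : R) (Phi : T -> 'M[quat R]_(l, m))
    (B : 'M[quat R]_(m, p)) :
  std_subgaussian_mx P K Phi -> 0 < K -> (0 < l)%N -> 1 <= lam ->
  (P [set w | high (K ^+ 2 * (2 * lam / (kap R / 4))) (Phi w) B] <=
   (expR (- lam))%:E)%E.
Proof.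
move=> stPhi K0 l0 lam1; have [B0|B0] := ltP 0 (nsq B).
  apply: le_trans (std_upper stPhi K0 l0 lam1 B0).
  rewrite (_ : [set w | high _ (Phi w) B] = [set w | l%:R *
    (K ^+ 2 * (2 * lam / (kap R / 4))) * nsq B <= nsq (Phi w *m B)]) //.
  by apply/seteqP; split => w /= => [[]|].
rewrite (_ : [set w | _] = set0) ?measure0 ?lee_fin ?expR_ge0 //.
by apply/seteqP; split => w //= -[]; rewrite ltNge B0.
Qed.

End failure_probability.

(** * Collecting the failure probabilities *)

Lemma prob_ge_compl d (T : measurableType d) (R : realType) (P : probability T R)
    (S B : set T) (p q : R) : measurable B -> ~` B `<=` S ->
  (P B <= q%:E)%E -> p <= 1 - q -> prob_ge P S p.
Proof.
move=> mB BS Bq pq; exists (~` B); split => //; first exact: measurableC.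
rewrite probability_setC //; apply: (@le_trans _ _ (1 - q%:E)%E).
  by rewrite -EFinB lee_fin.
exact: leeB.
Qed.

Lemma prob_setU_le d (T : measurableType d) (R : realType) (P : probability T R)
    (A B : set T) (a b : R) : measurable A -> measurable B ->
  (P A <= a%:E -> P B <= b%:E -> P (A `|` B) <= (a + b)%:E)%E.
Proof.
move=> mA mB Aa Bb; apply: le_trans (measureU2 P mA mB) _.
by rewrite EFinD leeD.
Qed.

Lemma prob_ge_npos d (T : measurableType d) (R : realType) (P : probability T R)
    (S : set T) (p : R) : p <= 0 -> prob_ge P S p.
Proof. by move=> p0; exists set0; split => //; rewrite measure0 lee_fin. Qed.

Lemma expRN_lnD_le (R : realType) (N k : nat) : (0 < N)%N -> (0 < k)%N ->
  expR (- (ln N%:R + ln (4 * k)%:R + 1)) <= N%:R^-1 :> R.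
Proof.
move=> N0 k0; have lnk : 0 <= ln (4 * k)%:R :> R by rewrite ln_ge0 // ler1n muln_gt0.
apply: (@le_trans _ _ (expR (- ln N%:R))); first by rewrite ler_expR; lra.
by rewrite expRN lnK // posrE ltr0n.
Qed.

(** The denominator is at most x, so the claimed factor dominates the factor 1 + K S coming from the
    Chernoff bound. *)
Lemma noise_factor_le (R : realType) (K S x y t : R) :
  0 <= K -> 0 <= S -> 0 <= y -> 0 < t -> 0 < x - y - t ->
  1 + K * S <= 1 + K * x * S / (x - y - t).
Proof.
move=> K0 S0 y0 t0 xyt; rewrite lerD2l ler_pdivlMr // -mulrA [x * S]mulrC mulrA.
by apply: ler_wpM2l; [exact: mulr_ge0|lra].
Qed.

Theorem theorem4p5 (R : realType) :
  exists (c1 c2 : R) (C : R -> R),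
    [/\ 0 < c1, 0 < c2 & forall K : R, 0 < C K] /\
    forall (m n r s l : nat) (A : 'M[quat R]_(m, n))
      (U : 'M[quat R]_m) (sigma : nat -> R) (V : 'M[quat R]_n)
      (d : measure_display) (T : measurableType d) (P : probability T R)
      (Omega : T -> 'M[quat R]_(n, s)) (Psi : T -> 'M[quat R]_(l, m)) (K : R)
      (rangefinder : 'M[quat R]_(m, s) -> 'M[quat R]_(m, s)) (t : R),
    let Y := fun w => A *m Omega w in
    let W := fun w => Psi w *m A in
    let H := fun w => rangefinder (Y w) in
    let X := fun w => qpinv (Psi w *m H w) *m W w in
    (r < s)%N -> (s < l)%N -> (l < minn m n)%N ->
    is_qsvd A U sigma V ->
    qsubgaussian P Omega -> qsubgaussian P Psi ->
    qstandardized P Omega -> qstandardized P Psi ->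
    independent_families P (qentries Omega) (qentries Psi) ->
    (forall ij, psi2_norm P (qentries Omega ij) = K%:E) ->
    (forall ij, psi2_norm P (qentries Psi ij) = K%:E) ->
    {ae P, forall w, qrange (H w) = qrange (Y w) /\ qfull_col_rank (H w)} ->
    0 < t ->
    0 < Num.sqrt l%:R - C K * Num.sqrt s%:R - t ->
    0 < Num.sqrt s%:R - C K * Num.sqrt r%:R - t ->
    prob_ge P
      [set w | qfrob (H w *m X w - A) <=
        (1 + K * Num.sqrt l%:R *
               Num.sqrt (2 * (ln (minn (m - s) n)%:R + ln (4 * l)%:R + 1) / c1) /
             (Num.sqrt l%:R - C K * Num.sqrt s%:R - t)) *
        (1 + K * Num.sqrt s%:R *
               Num.sqrt (2 * (ln (minn m n - r)%:R + ln (4 * s)%:R + 1) / c1) /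
             (Num.sqrt s%:R - C K * Num.sqrt r%:R - t)) *
        frob_Sigma2 m n r sigma]
      (1 - 2 * expR (- (2 * c2 * t ^+ 2 / K ^+ 4))
         - (minn (m - s) n)%:R^-1 - (minn m n - r)%:R^-1).
Proof.
have kap0 := kap_gt0 R; have k4 : 0 < kap R / 4 by rewrite divr_gt0.
(* The first constant is that of [std_upper]. With the second, the exponent in [std_range_lower] is
   4 c_2 t^2 / K^4, twice the claimed one. *)
exists (kap R / 4), (kap R ^+ 2 / (8 * 64)), (@range_const R); split.
  split; [exact: k4| |exact: range_const_gt0].
  by rewrite divr_gt0 ?exprn_gt0 // -natrM ltr0n.
move=> m n r s l A U sigma V d T P Omega Psi K rangefinder t Y W H X rs sl lmn svd.
move=> sOm sPsi stOm stPsi ind OmK PsiK HY t0 l_gap s_gap.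
have s0 : (0 < s)%N by lia.
have l0 : (0 < l)%N by lia.
have m0 : (0 < m)%N by lia.
have n0 : (0 < n)%N by lia.
have N1_gt0 : (0 < minn (m - s) n)%N by lia.
have N2_gt0 : (0 < minn m n - r)%N by lia.
move: (minn (m - s) n) (minn m n - r)%N N1_gt0 N2_gt0 => N1 N2 N1_gt0 N2_gt0.
set lam1 := ln N1%:R + ln (4 * l)%:R + 1.
set lam2 := ln N2%:R + ln (4 * s)%:R + 1.
have lam_ge1 N k : (0 < N)%N -> (0 < k)%N -> 1 <= ln N%:R + ln (4 * k)%:R + 1 :> R.
  by move=> N0 k0; rewrite lerDr addr_ge0 // ln_ge0 // ler1n // muln_gt0.
(* As n and s are positive, [Omega] has an entry, whose unit variance bounds [K] from below. *)
have [K0 K1] : 0 < K /\ 1 <= 2 * K ^+ 2.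
  pose ij : 'I_(n + (n + (n + n))) * 'I_s :=
    (coord_index ord0 (Ordinal n0), Ordinal s0).
  have [E0 V1] := stOm ij.
  by have [] := standardized_entry (sOm.1 ij) E0 V1 (OmK ij).
pose a lam := Num.sqrt (2 * lam / (kap R / 4)).
have aE lam : 1 <= lam -> (K * a lam) ^+ 2 = K ^+ 2 * (2 * lam / (kap R / 4)).
  by move=> lam1'; rewrite exprMn sqr_sqrtr // divr_ge0 ?ltW //; lra.
have stdOm := std_qsubgaussian_adj sOm stOm OmK.
have stdPsi := std_qsubgaussian sPsi stPsi PsiK.
have mOm : measurable_qmx Omega by move=> i j; have [] := sOm.1 (i, j).
have mPsi : measurable_qmx Psi by move=> i j; have [] := sPsi.1 (i, j).
have rn : (r <= n)%N by lia.
have [W0 WW tailE] := svd_tail_part rn svd.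
set q := expR (- (2 * (kap R ^+ 2 / (8 * 64)) * t ^+ 2 / K ^+ 4)).
have qq : expR (- (4 * (kap R ^+ 2 / (8 * 64)) * t ^+ 2 / K ^+ 4)) = q * q.
  by rewrite -expRD; congr expR; field; rewrite gt_eqF.
(* The bad events have total mass [4 q ^+ 2 + ...], which is at most
   [2 q + ...] unless the claimed probability is nonpositive. *)
have [q_ge|q_lt] := leP 1 (2 * q).
  apply: prob_ge_npos; have : 0 <= N1%:R^-1 :> R by rewrite invr_ge0.
  have : 0 <= N2%:R^-1 :> R by rewrite invr_ge0.
  lra.
have q0 : 0 < q by exact: expR_gt0.
pose B1 := [set w | low (qadj (Omega w)) W0].
pose B2 := [set w | high (K ^+ 2 * (2 * lam2 / (kap R / 4))) (qadj (Omega w))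
  (qadj (tail_part A W0))].
pose B3 := [set w | low (Psi w) (A *m Omega w)].
pose B4 := [set w | high (K ^+ 2 * (2 * lam1 / (kap R / 4))) (Psi w)
  (residual A W0 (Omega w))].
have mB1 : measurable B1.
  by apply: measurable_low; [exact: measurable_qadj|exact: measurable_qmx_cst].
have mB2 : measurable B2.
  by apply: measurable_high; [exact: measurable_qadj|exact: measurable_qmx_cst].
have mB3 : measurable B3.
  by apply: measurable_low => //; exact: measurable_qmxM.
have mB4 : measurable B4.
  by apply: measurable_high => //; exact: measurable_residual.
have PB1 : (P B1 <= (2 * (q * q))%:E)%E.
  by rewrite -qq; apply: std_range_lower.
have PB2 : (P B2 <= (N2%:R^-1)%:E)%E.
  apply: le_trans (std_high _ stdOm K0 s0 (lam_ge1 _ _ N2_gt0 s0)) _.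
  by rewrite lee_fin; exact: expRN_lnD_le.
have m1 : measurable_qmx (fun z : entries_type Omega * entries_type Psi => Omega z.1).
  by apply: (measurable_qmx_comp (F := Omega : entries_type Omega -> _)) => //;
    exact: measurable_entries.
have m2 : measurable_qmx (fun z : entries_type Omega * entries_type Psi => Psi z.2).
  by apply: (measurable_qmx_comp (F := Psi : entries_type Psi -> _)) => //;
    exact: measurable_entries.
have lowP (Z : 'M[quat R]_(m, s)) : (P [set w | low (Psi w) Z] <= (2 * (q * q))%:E)%E.
  by rewrite -qq; exact: (std_range_lower Z stdPsi K0 K1 t0 l_gap).
have highP p (Z : 'M[quat R]_(m, p)) :
    (P [set w | high (K ^+ 2 * (2 * lam1 / (kap R / 4))) (Psi w) Z] <= (N1%:R^-1)%:E)%E.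
  apply: le_trans (std_high Z stdPsi K0 l0 (lam_ge1 _ _ N1_gt0 l0)) _.
  by rewrite lee_fin; exact: expRN_lnD_le.
(* With [Omega] frozen at M, both A M and the residual are fixed matrices, and the bounds for [Psi]
   on fixed matrices apply. *)
have PB3 : (P B3 <= (2 * (q * q))%:E)%E.
  apply: (ind_entries_section_le (bad := fun M N => low N (A *m M)) mOm mPsi ind).
    by apply: measurable_low => //; exact: measurable_qmxM.
  by move=> M; exact: lowP.
have PB4 : (P B4 <= (N1%:R^-1)%:E)%E.
  apply: (ind_entries_section_le
    (bad := fun M N => high (K ^+ 2 * (2 * lam1 / (kap R / 4))) N (residual A W0 M))
    mOm mPsi ind).
    by apply: measurable_high => //; exact: measurable_residual.
  by move=> M; exact: highP.
(* The rangefinder enters the probability only through a measurable null set covering the outcomes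
   where it fails. *)
have [B5 [mB5 PB5 subB5]] := HY.
apply: (@prob_ge_compl _ _ _ _ _ (B1 `|` B2 `|` (B3 `|` B4) `|` B5) _
  (2 * (q * q) + N2%:R^-1 + (2 * (q * q) + N1%:R^-1) + 0)).
- by do !apply: measurableU.
- move=> w /= /not_orP[/not_orP[/not_orP[nB1 nB2] /not_orP[nB3 nB4]] nB5].
  have [HwY injH] : qrange (H w) = qrange (Y w) /\ qfull_col_rank (H w).
    by apply: contrapT => nH; apply: nB5; exact: subB5.
  have a0 lam : 0 <= K * a lam by rewrite mulr_ge0 ?sqrtr_ge0 // ltW.
  have low_neg p q' u (F : 'M[quat R]_(p, q')) (Z : 'M[quat R]_(q', u)) :
      ~ low F Z -> forall x : 'cV_u, p%:R * nsq (Z *m x) <= nsq (F *m (Z *m x)).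
    by move=> nlow x; rewrite leNgt; apply/negP => lt_x; apply: nlow; exists x.
  have high_neg p q' u c (F : 'M[quat R]_(p, q')) (Z : 'M[quat R]_(q', u)) :
      ~ high c F Z -> nsq (F *m Z) <= p%:R * c * nsq Z.
    move=> nhigh; have [Z0|Z0] := ltP 0 (nsq Z).
      by rewrite leNgt; apply/negP => lt_Z; apply: nhigh; split => //; exact: ltW.
    have -> : Z = 0 by apply: nsq_eq0; apply/eqP; rewrite eq_le Z0 nsq_ge0.
    by rewrite mulmx0 !nsq0 mulr0.
  have Om_upper := high_neg _ _ _ _ _ _ nB2; rewrite -aE ?lam_ge1 // in Om_upper.
  have Ps_upper := high_neg _ _ _ _ _ _ nB4; rewrite -aE ?lam_ge1 // in Ps_upper.
  apply: le_trans (deterministic_error WW s0 l0 (a0 lam2) (a0 lam1)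
    (low_neg _ _ _ _ _ nB1) Om_upper (low_neg _ _ _ _ _ nB3) Ps_upper HwY injH) _.
  have C0 := range_const_gt0 K.
  rewrite tailE mulrA; apply: ler_wpM2r; first exact: sqrtr_ge0.
  by apply: ler_pM; rewrite ?addr_ge0 //; apply: noise_factor_le;
    rewrite ?sqrtr_ge0 ?mulr_ge0 ?sqrtr_ge0 // ltW.
- by do !apply: prob_setU_le => //; rewrite ?PB5 //; do ?apply: measurableU.
- nra.
Qed.
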